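(* Let $\alpha\in(2,3)$, $\lambda>0$, and let $\gamma\in C^{0,1}(\mathbb R/\mathbb Z,\mathbb R^n)$ be parametrized by arc-length (i.e. $|\gamma'|\equiv1$ a.e.) with $E^{(\alpha)}(\gamma)<\infty$. Suppose $\gamma$ is a stationary point of $E^{(\alpha)}+\lambda\mathscr L$, i.e. $$\delta E^{(\alpha)}(\gamma;h)+\lambda\int_{\mathbb R/\mathbb Z}\langle\gamma',h'\rangle=0\quad\text{for all }h\in H^{(1+\alpha)/2,2}(\mathbb R/\mathbb Z,\mathbb R^n),$$ where $$\delta E^{(\alpha)}(\gamma;h)=\lim_{\varepsilon\searrow 0}\iint_{U_\varepsilon}\Big((\alpha-2)\frac{\langle\gamma'(u),h'(u)\rangle}{|w|^\alpha}+2\frac{\langle\gamma'(u),h'(u)\rangle}{|\gamma(u+w)-\gamma(u)|^\alpha}-\alpha\frac{\langle\gamma(u+w)-\gamma(u),h(u+w)-h(u)\rangle}{|\gamma(u+w)-\gamma(u)|^{\alpha+2}}\Big)\,dw\,du$$ is the derivative of $E^{(\alpha)}$ at $\gamma$ in direction $h$. Then $\gamma\in C^\infty(\mathbb R/\mathbb Z,\mathbb R^n)$.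
   Context: For $\gamma\in C^{0,1}(\mathbb R/\mathbb Z,\mathbb R^n)$ let $\mathscr L(\gamma)=\int_0^1|\gamma'(\theta)|d\theta$ and, for $|w|\le 1/2$, $d_\gamma(u+w,u)=\min\{\mathscr L(\gamma|_{[u,u+w]}),\mathscr L(\gamma)-\mathscr L(\gamma|_{[u,u+w]})\}$. O'Hara's energy is $$E^{(\alpha)}(\gamma)=\int_{\mathbb R/\mathbb Z}\int_{-1/2}^{1/2}\Big(\frac1{|\gamma(u+w)-\gamma(u)|^\alpha}-\frac1{d_\gamma(u+w,u)^\alpha}\Big)|\gamma'(u+w)||\gamma'(u)|\,dw\,du\in[0,\infty].$$ $H^{s,p}(\mathbb R/\mathbb Z,\mathbb R^n)=(\mathrm{id}-\Delta)^{-s/2}L^p$ denotes the Bessel potential (fractional Sobolev) space. For $\varepsilon>0$, $U_\varepsilon=\mathbb R/\mathbb Z\times([-\tfrac12,-\varepsilon]\cup[\varepsilon,\tfrac12])$. *)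

(* Defs.v *)
From HB Require Import structures.
From mathcomp Require Import all_boot all_order all_algebra.
From mathcomp Require Import all_classical all_reals all_analysis.
Set Implicit Arguments. Unset Strict Implicit. Unset Printing Implicit Defensive.
Import Order.TTheory GRing.Theory Num.Theory.
Import numFieldNormedType.Exports.
Local Open Scope classical_set_scope.
Local Open Scope ring_scope.

Section OHara.
Variables (R : realType) (n : nat).
Local Notation vec := 'rV[R]_n.
Local Notation leb := (@lebesgue_measure R).

(* Euclidean inner product and norm on R^n (the library norm on 'rV is sup). *)
Definition dotp (x y : vec) : R := \sum_(i < n) x ord0 i * y ord0 i.
Definition enorm (x : vec) : R := Num.sqrt (dotp x x).

(* curves R/Z -> R^n are 1-periodic maps R -> R^n *)
Definition periodic1 (f : R -> vec) : Prop := forall x, f (x + 1) = f x.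

Definition lipschitz_curve (g : R -> vec) : Prop :=
  periodic1 g /\ exists L : R, forall x y, enorm (g x - g y) <= L * `|x - y|.

Definition arclength_param (g : R -> vec) : Prop :=
  {ae leb, forall u, derivable g u 1 /\ enorm (derive1 g u) = 1}.

Definition curve_length (g : R -> vec) : R :=
  Rintegral leb `[0, 1] (fun t => enorm (derive1 g t)).
Definition arc_length (g : R -> vec) (u w : R) : R :=
  Rintegral leb `[Num.min u (u + w), Num.max u (u + w)]
    (fun t => enorm (derive1 g t)).
Definition intr_dist (g : R -> vec) (u w : R) : R :=
  Num.min (arc_length g u w) (curve_length g - arc_length g u w).

Definition inv_powE (alpha x : R) : \bar R :=
  if x == 0 then +oo%E else (x `^ (- alpha))%:E.

(* O'Hara's energy E^(alpha)(g) in [0, +oo] (integrand set to 0 on the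
   null set w = 0) *)
Definition ohara_integrand (alpha : R) (g : R -> vec) (u w : R) : \bar R :=
  let chord := enorm (g (u + w) - g u) in
  let d := intr_dist g u w in
  let jac := enorm (derive1 g (u + w)) * enorm (derive1 g u) in
  if w == 0 then 0%E else
    ((inv_powE alpha chord - inv_powE alpha d) * jac%:E)%E.

Definition ohara_energy (alpha : R) (g : R -> vec) : \bar R :=
  (\int[leb]_(u in `[0%R, 1%R]) \int[leb]_(w in `[(-(1/2))%R, (1/2)%R])
     ohara_integrand alpha g u w)%E.

(* Bessel potential space H^{s,2}(R/Z, R^n), via Fourier coefficients:
   sum_k (1 + 4 pi^2 k^2)^s |hat h(k)|^2 < oo, written with the real
   cosine/sine coefficients.  Elements are represented by their
   (everywhere differentiable) C^1 representative since s > 3/2 here. *)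
Definition fourier_cos (h : R -> vec) (k : nat) (i : 'I_n) : R :=
  Rintegral leb `[0, 1] (fun x => h x ord0 i * cos (2 * pi * k%:R * x)).
Definition fourier_sin (h : R -> vec) (k : nat) (i : 'I_n) : R :=
  Rintegral leb `[0, 1] (fun x => h x ord0 i * sin (2 * pi * k%:R * x)).
Definition in_H2 (s : R) (h : R -> vec) : Prop :=
  periodic1 h /\
  (\sum_(k <oo) ((1 + 4 * pi ^+ 2 * (k%:R) ^+ 2) `^ s *
      \sum_(i < n) (fourier_cos h k i ^+ 2 + fourier_sin h k i ^+ 2))%:E
    < +oo)%E.

Definition first_var_integrand (alpha : R) (g h : R -> vec) (u w : R) : R :=
  (alpha - 2) * dotp (derive1 g u) (derive1 h u) / `|w| `^ alpha
  + 2 * dotp (derive1 g u) (derive1 h u) / enorm (g (u + w) - g u) `^ alpha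
  - alpha * dotp (g (u + w) - g u) (h (u + w) - h u)
      / enorm (g (u + w) - g u) `^ (alpha + 2).

Definition first_var_eps (alpha : R) (g h : R -> vec) (eps : R) : R :=
  Rintegral leb `[0, 1] (fun u =>
    Rintegral leb (`[-(1/2), - eps] `|` `[eps, 1/2])
      (fun w => first_var_integrand alpha g h u w)).

Definition smooth (g : R -> vec) : Prop :=
  forall (k : nat) (x : R), derivable (derive1n k g) x 1.

End OHara.

(* Main.v *)
Require Import Defs.
From HB Require Import structures.
From mathcomp Require Import all_boot all_order all_algebra.
From mathcomp Require Import all_classical all_reals all_analysis.
From mathcomp Require Import measurable_realfun ring lra.
Import Order.TTheory GRing.Theory Num.Theory.
Import numFieldNormedType.Exports.
Local Open Scope classical_set_scope.
Local Open Scope ring_scope.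
Set Implicit Arguments. Unset Strict Implicit. Unset Printing Implicit Defensive.

(* Write f = g', let a_w p be the average of p over [u, u + w], and
   E(p) = iint |w|^-alpha Var_[u, u+w] p.  For a unit-speed curve |chord|^2 = w^2 (1 - Var f), so
   finiteness of the O'Hara energy bounds E(f), and a Morrey-type argument makes g' Hoelder
   continuous of order (alpha - 2) / 2.  In terms of averages the Euler-Lagrange equation is
     alpha E(f, k) + (nonlinear terms) + lambda <f, k> = 0,
   where E(f, k) is the polarisation of E and the nonlinear integrands carry a factor
   |chord / w|^r - 1, which is O(Var f) and therefore integrable against |w|^-alpha.

   Regularity is gained one derivative at a time by difference quotients, without Fourier
   multipliers.  With phi = f^(m) and T = T_d the difference operator of step d, testing with
   (a smoothing of) the m-th derivative of T^* T phi gives E(T phi) <= C |T phi|_oo z, where z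
   measures T phi both uniformly and in energy.  Interpolating |T phi|_oo between energy and L^2
   yields E(T phi) <= C (d^2 + |T phi|_2^2).  Since the energy controls the L^2 modulus of
   continuity, T_d T_d phi is smaller than T_d phi by a power of d, so |T_{2d} phi|_2 is nearly
   2 |T_d phi|_2 and iterating over dyadic d gives |T_d phi|_2 = O(d).  Then E(T_d phi) = O(d^2),
   the difference quotients are equi-Hoelder, and phi is C^1 with E(phi') finite. *)

(** * Global derivatives, primitives and integrals over one period *)

Section Calculus.
Variable R : realType.
Implicit Types (p q dp dq P Q : R -> R) (a b c x y u v w : R).
Local Notation leb := (@lebesgue_measure R).

(** The nonlinear integrands are merely absolutely summable against the weight, so they can only be
    paired with the test function in the sup norm; this is why the a priori bound contains a uniform
    bound of T phi. Both of its sides are quadratic in T phi, and it closes because for alpha > 2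
    the energy dominates a Hoelder norm: in the interpolation the energy gets an arbitrarily small
    factor and is absorbed. The sign of lambda enters once: tested in this way, the length term is
    lambda times a square on the side of the energy. The first variation is a principal value, so no
    singular double integral is formed: energies are cut off at |w| >= eps and bounded uniformly in
    eps. Approximations (smoothing, difference quotients) are removed at a fixed eps, where the
    truncated energy is continuous under uniform convergence. Finite energy is used a second time to
    bound |chord / w| from below; without this, negative powers of chord / w would be unbounded. *)

Definition isD p dp := forall x, is_derive x (1:R) p (dp x).

Lemma isD_ext p q dp dq : p =1 q -> dp =1 dq -> isD p dp -> isD q dq.
Proof. by move=> /funext -> /funext ->. Qed.

Lemma isD_cst c : isD (fun=> c) (fun=> 0).
Proof. by move=> x; exact: is_derive_cst. Qed.

Lemma isD_id : isD (fun x => x) (fun=> 1).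
Proof. by move=> x; exact: is_derive_id. Qed.

Lemma isDD p q dp dq : isD p dp -> isD q dq ->
  isD (fun x => p x + q x) (fun x => dp x + dq x).
Proof. by move=> h k x; exact: (@is_deriveD _ _ _ p q _ _ _ _ (h x) (k x)). Qed.

Lemma isDB p q dp dq : isD p dp -> isD q dq ->
  isD (fun x => p x - q x) (fun x => dp x - dq x).
Proof. by move=> h k x; exact: (@is_deriveB _ _ _ p q _ _ _ _ (h x) (k x)). Qed.

Lemma isDM p q dp dq : isD p dp -> isD q dq ->
  isD (fun x => p x * q x) (fun x => dp x * q x + p x * dq x).
Proof.
move=> h k x; have := @is_deriveM _ _ p q x 1 _ _ (h x) (k x).
by rewrite /GRing.scale /= addrC [q x * _]mulrC.
Qed.

Lemma isDZ c p dp : isD p dp -> isD (fun x => c * p x) (fun x => c * dp x).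
Proof.
move=> h; apply: isD_ext (isDM (isD_cst c) h) => //.
by move=> x; rewrite mul0r add0r.
Qed.

Lemma isD_comp p q dp dq : isD p dp -> isD q dq ->
  isD (fun x => p (q x)) (fun x => dp (q x) * dq x).
Proof. by move=> h k x; exact: (is_derive1_comp (h _) (k x)). Qed.

Lemma isD_shift c p dp : isD p dp -> isD (fun x => p (x + c)) (fun x => dp (x + c)).
Proof.
move=> h; have := isD_comp h (isDD isD_id (isD_cst c)).
by apply: isD_ext => // x; rewrite addr0 mulr1.
Qed.

Lemma isD_continuous p dp : isD p dp -> continuous p.
Proof.
move=> h x; apply: differentiable_continuous; apply/derivable1_diffP.
by have [] := h x.
Qed.

Lemma isD_uniq p dp dq : isD p dp -> isD p dq -> dp =1 dq.
Proof. by move=> h k x; have [_ <-] := h x; have [_ <-] := k x. Qed.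

Lemma isD_MVT p dp a b : isD p dp -> a < b ->
  exists2 c, a < c < b & p b - p a = dp c * (b - a).
Proof.
move=> h ab; have [||c] := @MVT R p dp a b ab.
- by move=> x _; exact: h.
- by apply: continuous_subspaceT; exact: isD_continuous h.
- by rewrite in_itv /= => ac e; exists c.
Qed.

Lemma isD_le p dp a b : isD p dp -> (forall x, a <= x <= b -> 0 <= dp x) ->
  a <= b -> p a <= p b.
Proof.
move=> h k; rewrite le_eqVlt => /predU1P[->//|ab].
have [c /andP[ac cb] e] := isD_MVT h ab.
rewrite -subr_ge0 e; apply: mulr_ge0; last by rewrite subr_ge0 ltW.
by apply: k; rewrite !ltW.
Qed.

Lemma isD_cstE p : isD p (fun=> 0) -> forall x y, p x = p y.
Proof.
move=> h; have le x y : x <= y -> p x = p y.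
  move=> xy; apply/eqP; rewrite eq_le (isD_le h)//=.
  have := isD_le (isDZ (-1) h) (b := y) (a := x).
  rewrite !mulN1r lerN2; apply=> // z _; rewrite mulr0//.
by move=> x y; have [/le//|/ltW/le] := leP x y.
Qed.

Lemma isD_primE P Q p : isD P p -> isD Q p -> forall x y, P x - P y = Q x - Q y.
Proof.
move=> h k x y; have /isD_cstE/(_ x y) : isD (fun x => P x - Q x) (fun=> 0).
  by apply: isD_ext (isDB h k) => // z; rewrite subrr.
by lra.
Qed.

Lemma cts_integrable p a b : continuous p -> leb.-integrable `[a, b] (EFin \o p).
Proof.
move=> h; apply: continuous_compact_integrable; first exact: segment_compact.
exact: continuous_subspaceT.
Qed.

(** The signed integral from 0 to x: an interval [[a, b]] with b < a is empty, so at most one of the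
    two terms is nonzero. *)
Definition prim p x := Rintegral leb `[0, x] p - Rintegral leb `[x, 0] p.

Lemma Rintegral_point p a : Rintegral leb `[a, a] p = 0.
Proof. by rewrite set_itv1 Rintegral_set1. Qed.

Lemma Rintegral_void p a b : b < a -> Rintegral leb `[a, b] p = 0.
Proof. by move=> h; rewrite set_itv_ge ?Rintegral_set0// bnd_simp -ltNge. Qed.

Lemma Rintegral_chasles p a b c : continuous p -> a <= b -> b <= c ->
  Rintegral leb `[a, c] p = Rintegral leb `[a, b] p + Rintegral leb `[b, c] p.
Proof.
move=> cp ab bc; have := @Rintegral_itvB R p (BLeft a) (BRight c) b.
rewrite !bnd_simp => /(_ (cts_integrable a c cp) ab bc).
rewrite Rintegral_itv_obnd_cbnd; last first.
  apply: integrableS (cts_integrable b c cp) => //.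
  by apply: subset_itvr; rewrite bnd_simp.
by lra.
Qed.

Lemma isD_prim p : continuous p -> isD (prim p) p.
Proof.
(* A base point left of both 0 and x: the fundamental theorem is applied to the integral from [a],
   which near x differs from [prim p] by a constant. *)
move=> cp x; pose a := - (`|x| + 1).
have ax : a < x by have := ler_norm (- x); rewrite normrN /a; lra.
have a0 : a < 0 by have := normr_ge0 x; rewrite /a; lra.
pose F y := Rintegral leb `[a, y] p.
have E y : a < y -> prim p y = F y - F 0.
  move=> ay; rewrite /prim /F; have [y0|y0] := leP 0 y.
    have -> : Rintegral leb `[y, 0] p = 0.
      by move: y0; rewrite le_eqVlt => /predU1P[<-|/Rintegral_void]//; exact: Rintegral_point.
    by rewrite (Rintegral_chasles (a:=a) (b:=0) (c:=y))// ?(ltW a0)//; lra.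
  rewrite (Rintegral_chasles (a:=a) (b:=y) (c:=0))// ?(ltW ay) ?(ltW y0)//.
  by rewrite (Rintegral_void p y0); lra.
have xx1 : x < x + 1 by lra.
have [dF dFE] := continuous_FTC1_closed xx1 (cts_integrable a (x + 1) cp) ax (cp x).
have DF : is_derive x 1 F (p x) by apply: DeriveDef; [exact: dF|rewrite -derive1E; exact: dFE].
have DG : is_derive x 1 (fun y => F y - F 0) (p x).
  have := @is_deriveB _ _ _ F (cst (F 0)) _ _ _ _ DF (is_derive_cst _ _ _).
  by rewrite subr0.
apply: near_eq_is_derive DG => //.
by near=> y; rewrite E//; near: y; exact: lt_nbhsr.
Unshelve. all: by end_near. Qed.

Lemma FTC_Rintegral P p a b : isD P p -> continuous p -> a <= b ->
  Rintegral leb `[a, b] p = P b - P a.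
Proof.
move=> h cp; rewrite le_eqVlt => /predU1P[->|ab].
  by rewrite Rintegral_point subrr.
rewrite /Rintegral (@continuous_FTC2 _ _ P)//.
- exact: continuous_subspaceT.
- split=> [x _||]; first by have [] := h x.
  + by apply/cvg_at_right_filter; exact: (isD_continuous h).
  + by apply/cvg_at_left_filter; exact: (isD_continuous h).
- by move=> x _; rewrite derive1E; have [] := h x.
Qed.

Lemma cts_shift p c : continuous p -> continuous (fun x => p (x + c)).
Proof.
move=> cp x; apply: (@continuous_comp _ _ _ (fun x => x + c) p); last exact: cp.
by apply: cvgD; [exact: cvg_id|exact: cvg_cst].
Qed.

Lemma cts_mul p q : continuous p -> continuous q -> continuous (fun x => p x * q x).
Proof. by move=> cp cq x; apply: continuousM; [exact: cp|exact: cq]. Qed.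

Lemma cts_add p q : continuous p -> continuous q -> continuous (fun x => p x + q x).
Proof. by move=> cp cq x; apply: continuousD; [exact: cp|exact: cq]. Qed.

Lemma cts_sub p q : continuous p -> continuous q -> continuous (fun x => p x - q x).
Proof. by move=> cp cq x; apply: continuousB; [exact: cp|exact: cq]. Qed.

Lemma cts_cst c : continuous (fun _ : R => c).
Proof. by move=> x; exact: cst_continuous. Qed.

Lemma cts_scale c p : continuous p -> continuous (fun x => c * p x).
Proof. by move=> cp; apply: cts_mul => //; exact: cts_cst. Qed.

Lemma cts_sqr p : continuous p -> continuous (fun x => p x ^+ 2).
Proof. by move=> cp; exact: (cts_mul cp cp). Qed.

Definition periodic p := forall x, p (x + 1) = p x.
Definition int01 p := Rintegral leb `[0, 1] p.

Lemma int01E P p : isD P p -> continuous p -> int01 p = P 1 - P 0.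
Proof. by move=> h k; exact: FTC_Rintegral. Qed.

Lemma prim_period P p : isD P p -> continuous p -> periodic p ->
  forall x, P (x + 1) - P x = int01 p.
Proof.
move=> h cp pp x; rewrite (int01E h cp) -{2}[1]add0r.
apply: (isD_cstE (p := fun x => P (x + 1) - P x)).
by apply: isD_ext (isDB (isD_shift 1 h) h) => // z; rewrite pp subrr.
Qed.

Lemma int01_shift c p : continuous p -> periodic p ->
  int01 (fun x => p (x + c)) = int01 p.
Proof.
move=> cp pp; have h := isD_prim cp.
rewrite (int01E (isD_shift c h)); last exact: cts_shift.
by rewrite add0r [1 + c]addrC (prim_period h).
Qed.

Lemma int01D p q : continuous p -> continuous q ->
  int01 (fun x => p x + q x) = int01 p + int01 q.
Proof. by move=> cp cq; rewrite /int01 RintegralD//; exact: cts_integrable. Qed.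

Lemma int01B p q : continuous p -> continuous q ->
  int01 (fun x => p x - q x) = int01 p - int01 q.
Proof. by move=> cp cq; rewrite /int01 RintegralB//; exact: cts_integrable. Qed.

Lemma int01Z c p : continuous p -> int01 (fun x => c * p x) = c * int01 p.
Proof. by move=> cp; rewrite /int01 RintegralZl//; exact: cts_integrable. Qed.

Lemma int01_cst c : int01 (fun=> c) = c.
Proof.
have h : isD (fun x => c * x) (fun=> c).
  by apply: isD_ext (isDZ c isD_id) => // x; rewrite mulr1.
by rewrite (int01E h (@cts_cst c)) mulr1 mulr0 subr0.
Qed.

Lemma int01_le p q : continuous p -> continuous q -> (forall x, p x <= q x) ->
  int01 p <= int01 q.
Proof. by move=> cp cq pq; apply: le_Rintegral => //; exact: cts_integrable. Qed.

Lemma int01_ge0 p : (forall x, 0 <= p x) -> 0 <= int01 p.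
Proof. by move=> p0; apply: Rintegral_ge0. Qed.

Lemma int01_norm_le p c : continuous p -> (forall x, `|p x| <= c) -> `|int01 p| <= c.
Proof.
move=> cp pc; rewrite ler_norml -[X in - X <= _](int01_cst c) -{2}(int01_cst c).
have cc := @cts_cst c.
rewrite -mulN1r -int01Z//; apply/andP; split; apply: int01_le => //;
  first exact: cts_scale.
all: by move=> x; have := pc x; rewrite ler_norml ?mulN1r => /andP[].
Qed.

Lemma int01_IBP p q dp dq : isD p dp -> isD q dq -> continuous dp -> continuous dq ->
  periodic p -> periodic q ->
  int01 (fun x => dp x * q x) = - int01 (fun x => p x * dq x).
Proof.
move=> hp hq cdp cdq pp pq.
have cp := isD_continuous hp; have cq := isD_continuous hq.
have := int01E (isDM hp hq).
have -> : p 1 = p 0 by rewrite -(pp 0) add0r.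
have -> : q 1 = q 0 by rewrite -(pq 0) add0r.
rewrite subrr.
rewrite int01D; try exact: cts_mul.
move=> /(_ (cts_add (cts_mul cdp cq) (cts_mul cp cdq))).
by lra.
Qed.

End Calculus.
Arguments cts_shift {R p} c _ _.
Arguments cts_scale {R} c {p} _ _.
Arguments cts_cst {R} c _.

(** * Averages, covariances and variances over an interval [[u, u + w]] *)

Section Averages.
Variable R : realType.
Implicit Types (p q dp dq P Q : R -> R) (a b c d x y u v w t : R).
Local Notation leb := (@lebesgue_measure R).

(** For w < 0 both signs change, so this is the mean over [[u + w, u]]; at w = 0 the value is the
    default 0, whence the side conditions w != 0. *)
Definition avg w p u := (prim p (u + w) - prim p u) / w.

Lemma avgE P p w u : isD P p -> continuous p -> avg w p u = (P (u + w) - P u) / w.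
Proof. by move=> h cp; rewrite /avg (isD_primE (isD_prim cp) h). Qed.

Lemma avgD w p q u : continuous p -> continuous q ->
  avg w (fun x => p x + q x) u = avg w p u + avg w q u.
Proof.
move=> cp cq.
rewrite (avgE _ _ (isDD (isD_prim cp) (isD_prim cq))); last exact: cts_add.
by rewrite /avg -mulrDl; congr (_ / _); ring.
Qed.

Lemma avgZ w c p u : continuous p -> avg w (fun x => c * p x) u = c * avg w p u.
Proof.
move=> cp; rewrite (avgE _ _ (isDZ c (isD_prim cp))); last exact: cts_scale.
by rewrite /avg; ring.
Qed.

Lemma avgB w p q u : continuous p -> continuous q ->
  avg w (fun x => p x - q x) u = avg w p u - avg w q u.
Proof.
move=> cp cq.
rewrite (avgE _ _ (isDB (isD_prim cp) (isD_prim cq))); last exact: cts_sub.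
by rewrite /avg -mulrBl; congr (_ / _); ring.
Qed.

Lemma avg_cst w c u : w != 0 -> avg w (fun=> c) u = c.
Proof.
move=> w0; have h : isD (fun x => c * x) (fun=> c).
  by apply: isD_ext (isDZ c (@isD_id R)) => // x; rewrite mulr1.
rewrite (avgE _ _ h); last exact: cts_cst.
by rewrite mulrDr addrAC subrr add0r mulfK.
Qed.

Lemma avg_ge0 w p u : continuous p -> (forall x, 0 <= p x) -> 0 <= avg w p u.
Proof.
move=> cp p0; have h := isD_prim cp; rewrite /avg.
have [w0|w0|->] := ltgtP w 0; last by rewrite invr0 mulr0.
  rewrite -mulrNN -invrN divr_ge0 ?oppr_ge0 ?(ltW w0)// subr_le0.
  by apply: (isD_le h) => //; lra.
rewrite divr_ge0 ?(ltW w0)// subr_ge0.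
by apply: (isD_le h) => //; lra.
Qed.

Lemma avg_le w p q u : continuous p -> continuous q -> (forall x, p x <= q x) ->
  avg w p u <= avg w q u.
Proof.
move=> cp cq pq; rewrite -subr_ge0 -avgB//; apply: avg_ge0; first exact: cts_sub.
by move=> x; rewrite subr_ge0.
Qed.

Lemma avg_norm_le w p u c : w != 0 -> continuous p -> (forall x, `|p x| <= c) ->
  `|avg w p u| <= c.
Proof.
move=> w0 cp pc; rewrite ler_norml -{1}(avg_cst c u w0) -{2}(avg_cst c u w0).
have cc := cts_cst c.
rewrite -mulN1r -avgZ//; apply/andP; split; apply: avg_le => //;
  first exact: cts_scale.
all: by move=> x; have := pc x; rewrite ler_norml ?mulN1r => /andP[].
Qed.

Lemma avg_shift w p u c : continuous p -> avg w (fun x => p (x + c)) u = avg w p (u + c).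
Proof.
move=> cp; rewrite (avgE _ _ (isD_shift c (isD_prim cp)) (cts_shift c cp)).
by rewrite /avg (addrAC u w c).
Qed.

Lemma isD_avg_quot w p : continuous p -> isD (avg w p) (fun u => (p (u + w) - p u) / w).
Proof.
move=> cp; have h := isD_prim cp.
apply: isD_ext (isDZ w^-1 (isDB (isD_shift w h) h)) => u; exact: mulrC.
Qed.

Lemma cts_avg w p : continuous p -> continuous (avg w p).
Proof. by move=> cp; exact: isD_continuous (isD_avg_quot w cp). Qed.

Lemma isD_avg w p dp : isD p dp -> continuous dp -> isD (avg w p) (avg w dp).
Proof.
move=> h cdp; apply: isD_ext (isD_avg_quot w (isD_continuous h)) => // u.
by rewrite (avgE _ _ h).
Qed.

Lemma periodic_avg w p : continuous p -> periodic p -> periodic (avg w p).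
Proof.
move=> cp pp u; rewrite /avg; have h := prim_period (isD_prim cp) cp pp.
have h1 := h (u + w); have h2 := h u; congr (_ / _).
by rewrite (addrAC u 1 w); lra.
Qed.

(** Fubini is avoided: [avg w p] is the derivative of a difference of the second primitive, and the
    increment of that second primitive over one period is affine in its base point, with slope
    [int01 p]. *)
Lemma int01_avg w p : w != 0 -> continuous p -> periodic p -> int01 (avg w p) = int01 p.
Proof.
move=> w0 cp pp; have h := isD_prim cp; have cP := isD_continuous h.
have H := isD_prim cP.
have D : isD (fun u => w^-1 * (prim (prim p) (u + w) - prim (prim p) u)) (avg w p).
  apply: isD_ext (isDZ w^-1 (isDB (isD_shift w H) H)) => // u.
  by rewrite mulrC.
rewrite (int01E D); last exact: cts_avg.
pose F v := prim (prim p) (v + 1) - prim (prim p) v.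
have DF : isD F (fun=> int01 p).
  apply: isD_ext (isDB (isD_shift 1 H) H) => // u; exact: (prim_period h).
have DL : isD (fun v => int01 p * v) (fun=> int01 p).
  by apply: isD_ext (isDZ (int01 p) (@isD_id R)) => // x; rewrite mulr1.
have := isD_primE DF DL w 0; rewrite /F !add0r mulr0 subr0 [1 + w]addrC => e.
rewrite -[RHS](mulfK w0) -e; field.
exact: w0.
Qed.

(** Covariance for the uniform probability on the interval between u and u + w. *)
Definition cov w p q u := avg w (fun x => p x * q x) u - avg w p u * avg w q u.
Notation var w p := (cov w p p).

Lemma covC w p q u : cov w p q u = cov w q p u.
Proof. by rewrite /cov [avg w q u * _]mulrC; under eq_fun do rewrite mulrC. Qed.

Lemma covDl w p q r u : continuous p -> continuous q -> continuous r ->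
  cov w (fun x => p x + q x) r u = cov w p r u + cov w q r u.
Proof.
move=> cp cq cr; rewrite /cov; under eq_fun do rewrite mulrDl.
by rewrite !avgD//; try exact: cts_mul; ring.
Qed.

Lemma covZl w c p q u : continuous p -> continuous q ->
  cov w (fun x => c * p x) q u = c * cov w p q u.
Proof.
move=> cp cq; rewrite /cov; under eq_fun do rewrite -mulrA.
by rewrite !avgZ//; try exact: cts_mul; ring.
Qed.

Lemma covBl w p q r u : continuous p -> continuous q -> continuous r ->
  cov w (fun x => p x - q x) r u = cov w p r u - cov w q r u.
Proof.
move=> cp cq cr; rewrite /cov; under eq_fun do rewrite mulrBl.
by rewrite !avgB//; try exact: cts_mul; ring.
Qed.

Lemma covDr w p q r u : continuous p -> continuous q -> continuous r ->
  cov w r (fun x => p x + q x) u = cov w r p u + cov w r q u.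
Proof. by move=> *; rewrite covC covDl// !(covC w r). Qed.

Lemma covBr w p q r u : continuous p -> continuous q -> continuous r ->
  cov w r (fun x => p x - q x) u = cov w r p u - cov w r q u.
Proof. by move=> *; rewrite covC covBl// !(covC w r). Qed.

Lemma covZr w c p q u : continuous p -> continuous q ->
  cov w q (fun x => c * p x) u = c * cov w q p u.
Proof. by move=> *; rewrite covC covZl// covC. Qed.

Lemma var_centerE w p c u : w != 0 -> continuous p ->
  avg w (fun x => (p x - c) ^+ 2) u = var w p u + (avg w p u - c) ^+ 2.
Proof.
move=> w0 cp; rewrite /cov.
have -> : (fun x => (p x - c) ^+ 2) = (fun x => p x * p x - (2 * c) * p x + c ^+ 2).
  by apply/funext => x; ring.
rewrite avgD; [|apply: cts_sub; [exact: cts_mul|exact: cts_scale]|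
  exact: cts_cst].
rewrite avgB; [|exact: cts_mul|exact: cts_scale].
by rewrite avgZ// avg_cst//; ring.
Qed.

Lemma var_ge0 w p u : w != 0 -> continuous p -> 0 <= var w p u.
Proof.
move=> w0 cp; have := var_centerE (avg w p u) u w0 cp.
rewrite subrr expr0n addr0 => <-; apply: avg_ge0.
  by apply: cts_sqr; apply: cts_sub => //; exact: cts_cst.
by move=> x; exact: sqr_ge0.
Qed.

Lemma var_lincomb w p q u s t : continuous p -> continuous q ->
  var w (fun x => s * p x + t * q x) u =
  s ^+ 2 * var w p u + 2 * s * t * cov w p q u + t ^+ 2 * var w q u.
Proof.
move=> cp cq; have csp := cts_scale s cp; have ctq := cts_scale t cq.
have cpq := cts_add csp ctq.
rewrite (covDl _ _ csp ctq cpq) (covDr _ _ csp ctq csp) (covDr _ _ csp ctq ctq).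
rewrite (covZl _ _ _ cp csp) (covZl _ _ _ cp ctq) (covZl _ _ _ cq csp) (covZl _ _ _ cq ctq).
rewrite (covZr _ _ _ cp cp) (covZr _ _ _ cq cp) (covZr _ _ _ cp cq) (covZr _ _ _ cq cq).
by rewrite (covC w q p); ring.
Qed.

(** Nonnegativity of the variances of t p + q and t p - q. This Young form of Cauchy-Schwarz keeps t
    free because the two variances are later of different orders in z, and t is then set to z or to
    its inverse. *)
Lemma cov_norm_le w p q u t : w != 0 -> 0 < t -> continuous p -> continuous q ->
  `|cov w p q u| <= (t * var w p u + t^-1 * var w q u) / 2.
Proof.
move=> w0 t0 cp cq.
have h s : 0 <= t ^+ 2 * var w p u + 2 * t * s * cov w p q u + s ^+ 2 * var w q u.
  rewrite -var_lincomb//; apply: var_ge0 => //.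
  by apply: cts_add; exact: cts_scale.
have := h 1; have := h (-1).
set a := cov w p p u; set b := cov w p q u; set d := cov w q q u => h1 h2.
have -> : (t * a + t^-1 * d) / 2 = (t ^+ 2 * a + d) / (2 * t).
  by field; rewrite gt_eqF.
have t2 : 0 < 2 * t by lra.
by rewrite ler_pdivlMr// -[2 * t]gtr0_norm// -normrM ler_norml; apply/andP; split; nra.
Qed.

Lemma cts_cov w p q : continuous p -> continuous q -> continuous (cov w p q).
Proof.
move=> cp cq; apply: cts_sub; first by apply: cts_avg; exact: cts_mul.
by apply: cts_mul; exact: cts_avg.
Qed.

Lemma periodic_cov w p q : continuous p -> continuous q -> periodic p -> periodic q ->
  periodic (cov w p q).
Proof.
move=> cp cq pp pq u; rewrite /cov !periodic_avg//; first exact: cts_mul.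
by move=> x; rewrite pp pq.
Qed.

Lemma cov_shift w p q u c : continuous p -> continuous q ->
  cov w (fun x => p (x + c)) (fun x => q (x + c)) u = cov w p q (u + c).
Proof.
move=> cp cq; rewrite /cov !avg_shift//.
by rewrite (avg_shift _ _ _ (p := fun x => p x * q x)); last exact: cts_mul.
Qed.

Lemma isD_cov w p q dp dq : isD p dp -> isD q dq -> continuous dp -> continuous dq ->
  isD (cov w p q) (fun u => cov w dp q u + cov w p dq u).
Proof.
move=> hp hq cdp cdq; have cp := isD_continuous hp; have cq := isD_continuous hq.
have := isDB (isD_avg w (isDM hp hq)
    (cts_add (cts_mul cdp cq) (cts_mul cp cdq)))
  (isDM (isD_avg w hp cdp) (isD_avg w hq cdq)).
apply: isD_ext => // u; rewrite avgD; try exact: cts_mul.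
by rewrite /cov; ring.
Qed.

(** Discrete Leibniz rule; the shifted factor is harmless because energies are translation
    invariant. *)
Lemma cov_diff w p q u c : continuous p -> continuous q ->
  cov w p q (u + c) - cov w p q u =
  cov w (fun x => p (x + c) - p x) (fun x => q (x + c)) u
  + cov w p (fun x => q (x + c) - q x) u.
Proof.
move=> cp cq; have cpc := cts_shift c cp; have cqc := cts_shift c cq.
by rewrite covBl// covBr// cov_shift//; ring.
Qed.

Lemma int01_cov w p q : w != 0 -> continuous p -> continuous q -> periodic p -> periodic q ->
  int01 (cov w p q) = int01 (fun u => p u * q u - avg w p u * avg w q u).
Proof.
move=> w0 cp cq pp pq; have cpq := cts_mul cp cq.
rewrite !int01B//; [|by apply: cts_mul; exact: cts_avg|
  exact: cts_avg|by apply: cts_mul; exact: cts_avg].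
by rewrite int01_avg// => x; rewrite pp pq.
Qed.

(* Var over [u, u+w] controls the L^2 modulus of continuity at scale d <= w/2 on
   the subinterval [u, u+w-d], since both p and its translate are close to the mean. *)
Lemma avg_sqdiff_le w p u d : 0 < d -> d < w -> continuous p ->
  (w - d) * avg (w - d) (fun x => (p (x + d) - p x) ^+ 2) u <= 4 * w * var w p u.
Proof.
move=> d0 dw cp; have w0 : w != 0 by rewrite gt_eqF//; lra.
have wd0 : w - d != 0 by rewrite subr_eq0 gt_eqF.
set c := avg w p u; have cc := cts_cst c.
pose q := (fun x => (p x - c) ^+ 2).
have cq : continuous q by apply: cts_sqr; exact: cts_sub.
have cqd := cts_shift d cq.
have -> : 4 * w * var w p u = 4 * (w * avg w q u).
  by rewrite /q var_centerE// subrr expr0n addr0 mulrA.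
pose Q := prim q; have hQ : isD Q q := isD_prim cq.
have H : avg (w - d) (fun x => (p (x + d) - p x) ^+ 2) u <=
         avg (w - d) (fun x => 2 * q (x + d) + 2 * q x) u.
  apply: avg_le => [||x]; first by apply: cts_sqr; apply: cts_sub => //; exact: cts_shift.
    by apply: cts_add; exact: cts_scale.
  by rewrite /q; have := sqr_ge0 (p (x + d) - c + (p x - c)); lra.
apply: (le_trans (ler_wpM2l _ H)); first by lra.
rewrite avgD; try exact: cts_scale.
rewrite !avgZ// avg_shift// /avg -/Q.
rewrite (_ : u + d + (w - d) = u + w); last by ring.
have e1 : Q u <= Q (u + d) by apply: (isD_le hQ) => [x _|]; [exact: sqr_ge0|lra].
have e2 : Q (u + (w - d)) <= Q (u + w) by apply: (isD_le hQ) => [x _|]; [exact: sqr_ge0|lra].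
have -> : (w - d) * (2 * ((Q (u + w) - Q (u + d)) / (w - d)) +
   2 * ((Q (u + (w - d)) - Q u) / (w - d))) =
   2 * (Q (u + w) - Q (u + d)) + 2 * (Q (u + (w - d)) - Q u) by field.
have -> : 4 * (w * ((Q (u + w) - Q u) / w)) = 4 * (Q (u + w) - Q u) by field.
by lra.
Qed.

Lemma int01_sqdiff_le w p d : 0 < d -> 2 * d <= w -> continuous p -> periodic p ->
  int01 (fun x => (p (x + d) - p x) ^+ 2) <= 8 * int01 (var w p).
Proof.
move=> d0 dw cp pp; have w0 : w != 0 by rewrite gt_eqF//; lra.
have wd0 : w - d != 0 by rewrite gt_eqF//; lra.
have dw' : d < w by lra.
set s := (fun x => (p (x + d) - p x) ^+ 2).
have cs : continuous s by apply: cts_sqr; apply: cts_sub => //; exact: cts_shift.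
have ps : periodic s by move=> x; rewrite /s addrAC !pp.
have := int01_le (cts_scale (w - d) (cts_avg (w:=w - d) cs))
  (cts_scale (4 * w) (cts_cov (w:=w) cp cp)) (fun u => avg_sqdiff_le u d0 dw' cp).
rewrite !int01Z; try exact: cts_avg; try exact: cts_cov.
rewrite int01_avg//; set a := int01 s; set b := int01 (var w p) => h.
have a0 : 0 <= a by apply: int01_ge0 => x; exact: sqr_ge0.
(* Since w - d >= w / 2, the factor 4 w / (w - d) is at most 8. *)
have : w * a <= w * (8 * b) by nra.
by rewrite ler_pM2l//; lra.
Qed.

End Averages.
Notation var w p := (cov w p p).
Arguments cts_avg {R} w {p} _ _.
Arguments cts_cov {R} w {p q} _ _ _.

(** * Limits and derivatives from power-type rates *)

Section HolderLimits.
Variable R : realType.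
Implicit Types (p d : R -> R) (u v w x y r e M N beta : R).

Lemma powR_sqr x y : 0 <= x -> (x `^ y) ^+ 2 = x `^ (2 * y).
Proof. by move=> x0; rewrite mulrC powRrM powR_mulrn// powR_ge0. Qed.

Lemma small_powR M beta e : 0 < beta -> 0 <= M -> 0 < e ->
  exists2 eta, 0 < eta & forall x, 0 <= x -> x <= eta -> M * x `^ beta <= e.
Proof.
move=> b0 M0 e0; have M1 : 0 < M + 1 by lra.
have h : 0 < e / (M + 1) by rewrite divr_gt0.
exists ((e / (M + 1)) `^ beta^-1); first exact: powR_gt0.
move=> x x0 xh.
have xb : x `^ beta <= e / (M + 1).
  have -> : e / (M + 1) = ((e / (M + 1)) `^ beta^-1) `^ beta.
    by rewrite -powRrM mulVf ?lt0r_neq0// powRr1// ltW.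
  by apply: ge0_ler_powR; rewrite ?nnegrE ?powR_ge0// ltW.
apply: (le_trans (ler_wpM2l M0 xb)).
rewrite mulrA ler_pdivrMr// [leRHS]mulrC; apply: ler_wpM2r; lra.
Qed.

(** Scales within a factor 2 are compared directly, others through repeated halving of w; the errors
    form a geometric series of ratio q, and the identity M q + N = M closes the induction. *)
Lemma dyadic_cauchy (a : R -> R) r0 N beta : 0 < beta -> 0 <= N ->
  (forall v w, w / 2 <= v -> v <= w -> 0 < w -> w <= r0 ->
     `|a v - a w| <= N * w `^ beta) ->
  forall v w, 0 < v -> v <= w -> w <= r0 ->
     `|a v - a w| <= N / (1 - 2^-1 `^ beta) * w `^ beta.
Proof.
move=> b0 N0 H.
have q1 : 2^-1 `^ beta < 1 :> R.
  rewrite [ltRHS](_ : 1 = 1 `^ beta); last by rewrite powR1.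
  by apply: gt0_ltr_powR; rewrite ?nnegrE ?invr_ge0 ?invf_lt1 ?ltr1n.
set q : R := 2^-1 `^ beta in q1 *; set M := N / (1 - q).
have MN : M * q + N = M by rewrite /M; field; rewrite subr_eq0 gt_eqF.
have NM : N <= M.
  by rewrite /M ler_pdivlMr ?subr_gt0//; have := powR_ge0 (2^-1 : R) beta; rewrite -/q; nra.
have K k : forall v w, w / 2 ^+ k <= v -> v <= w -> 0 < w -> w <= r0 ->
    `|a v - a w| <= M * w `^ beta.
  elim: k => [|k IH] v w wv vw w0 wr.
    rewrite expr0 divr1 in wv; have -> : v = w by apply/eqP; rewrite eq_le vw wv.
    by rewrite subrr normr0 mulr_ge0 ?powR_ge0//; lra.
  have [h|h] := leP (w / 2) v.
    by apply: (le_trans (H _ _ h vw w0 wr)); rewrite ler_wpM2r// powR_ge0.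
  have h1 : `|a v - a (w / 2)| <= M * (w / 2) `^ beta.
    by apply: IH => //; [move: wv; rewrite exprS invfM mulrA|lra..].
  have h2 : `|a (w / 2) - a w| <= N * w `^ beta by apply: H => //; lra.
  have := ler_distD (a (w / 2)) (a v) (a w).
  move: h1; rewrite powRM ?invr_ge0//; last exact: ltW.
  by rewrite -/q -{2}MN; lra.
move=> v w v0 vw wr.
have w0 : 0 < w by lra.
have [k hk] : exists k : nat, w / v < 2 ^+ k.
  by exists (Num.Def.archi_bound (w / v)); exact: upper_nthrootP.
apply: (K k) => //; rewrite ler_pdivrMr ?exprn_gt0// mulrC -ler_pdivrMr//.
exact: ltW.
Qed.

(** The intervals of radius M w^beta about a w meet pairwise, so the supremum of their left ends
    lies in all of them; this gives the limit and its rate at once. *)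
Lemma holder_limit (a : R -> R) r0 M beta : 0 < r0 -> 0 <= M ->
  (forall v w, 0 < v -> v <= w -> w <= r0 -> `|a v - a w| <= M * w `^ beta) ->
  exists d : R, forall w, 0 < w -> w <= r0 -> `|a w - d| <= M * w `^ beta.
Proof.
move=> r00 M0 H.
pose S := [set y | exists2 w, 0 < w <= r0 & y = a w - M * w `^ beta].
have ub w : 0 < w -> w <= r0 -> ubound S (a w + M * w `^ beta).
  move=> w0 wr _ [v /andP[v0 vr] ->].
  have mv : 0 <= M * v `^ beta by rewrite mulr_ge0// powR_ge0.
  have mw : 0 <= M * w `^ beta by rewrite mulr_ge0// powR_ge0.
  have [vw|/ltW wv] := leP v w.
    by have := H _ _ v0 vw wr; rewrite ler_norml => /andP[]; lra.
  by have := H _ _ w0 wv vr; rewrite ler_norml => /andP[]; lra.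
have S0 : S !=set0 by exists (a r0 - M * r0 `^ beta), r0; rewrite ?r00/=.
have hS : has_sup S by split => //; exists (a r0 + M * r0 `^ beta); exact: ub.
exists (sup S) => w w0 wr; rewrite ler_norml; apply/andP; split.
  by have := ge_sup S0 (ub _ w0 wr); lra.
have : S (a w - M * w `^ beta) by exists w => //; rewrite w0.
by move/(sup_upper_bound hS); lra.
Qed.

Lemma holder_continuous d r0 M beta : 0 < r0 -> 0 < beta -> 0 <= M ->
  (forall u r, 0 < r -> r <= r0 -> `|d (u + r) - d u| <= M * r `^ beta) -> continuous d.
Proof.
move=> r00 b0 M0 H x; apply/cvgrPdist_le => e e0.
have [eta eta0 He] := small_powR b0 M0 e0.
near=> y.
have hy : `|y - x| <= Num.min eta r0.
  near: y; apply: (@cvgr_distC_le _ _ _ (nbhs x) _ id x) => //.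
  by rewrite lt_min eta0.
move: hy; rewrite le_min => /andP[h1 h2].
have [xy|xy|->] := ltgtP x y; last by rewrite subrr normr0 ltW.
  have e1 : `|y - x| = y - x by rewrite gtr0_norm ?subr_gt0.
  have := H x (y - x); rewrite (_ : x + (y - x) = y) ?[`|d y - _|]distrC => [h|]; last by ring.
  by rewrite e1 in h1 h2; apply: (le_trans (h _ _)); [lra|lra|apply: He; lra].
have e1 : `|y - x| = x - y by rewrite ltr0_norm ?subr_lt0// opprB.
have := H y (x - y); rewrite (_ : y + (x - y) = x) => [h|]; last by ring.
by rewrite e1 in h1 h2; apply: (le_trans (h _ _)); [lra|lra|apply: He; lra].
Unshelve. all: by end_near. Qed.

(** Only right increments are controlled. A left increment at x is a right increment based at x + h,
    and the Hoelder bound on d moves d (x + h) back to d x. *)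
Lemma isD_of_right_rate p d r0 M beta : 0 < r0 -> 0 < beta -> 0 <= M ->
  (forall u w, 0 < w -> w <= r0 -> `|(p (u + w) - p u) / w - d u| <= M * w `^ beta) ->
  (forall u r, 0 < r -> r <= r0 -> `|d (u + r) - d u| <= M * r `^ beta) -> isD p d.
Proof.
move=> r00 b0 M0 H1 H2 x.
have HH : h^-1 *: (p (h *: 1 + x) - p x) @[h --> 0^'] --> d x.
  apply/cvgrPdist_le => e e0.
  have M20 : 0 <= 2 * M by lra.
  have [eta eta0 He] := small_powR b0 M20 e0.
  near=> h.
  have h0 : h != 0 by near: h; exact: nbhs_dnbhs_neq.
  have hy : `|h| <= Num.min eta r0.
    near: h; apply: dnbhs0_le; by rewrite lt_min eta0.
  move: hy; rewrite le_min => /andP[h1 h2].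
  rewrite /GRing.scale /= mulr1 distrC.
  have mh : 0 <= M * `|h| `^ beta by rewrite mulr_ge0// powR_ge0.
  have [hp|hn|h00] := ltgtP 0 h; last by rewrite -h00 eqxx in h0.
    rewrite mulrC [h + x]addrC; apply: le_trans (He _ (normr_ge0 h) h1).
    rewrite (gtr0_norm hp) in mh h2 *; have := H1 x h hp h2.
    by lra.
  have nh : `|h| = - h by rewrite ltr0_norm.
  have nh0 : 0 < - h by lra.
  have k1 := H1 (x + h) (- h) nh0; have k2 := H2 (x + h) (- h) nh0.
  rewrite -nh in k1 k2; move: (k1 h2) (k2 h2).
  have -> : x + h + `|h| = x by rewrite nh; ring.
  have -> : (p x - p (x + h)) / `|h| = h^-1 * (p (h + x) - p x).
    by rewrite nh [h + x]addrC; field.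
  move=> k3 k4; apply: le_trans (He _ (normr_ge0 h) h1).
  by have := ler_distD (d (x + h)) (h^-1 * (p (h + x) - p x)) (d x);
    rewrite [`|d (x + h) - d x|]distrC; lra.
split; first by apply/cvg_ex; exists (d x).
exact/cvg_lim.
Unshelve. all: by end_near. Qed.

End HolderLimits.

(** * A Morrey-type estimate for Jensen deficits *)

Section Morrey.
Variables (R : realType) (n : nat) (P : 'I_n -> R -> R) (A : R -> R).
Implicit Types (u v w x y r : R).

(* If A is a primitive of sum_i (P i)'^2, this is the defect in Jensen's inequality on [u, v],
   hence it decreases when the interval shrinks. *)
Definition deficit u v := A v - A u - (\sum_i (P i v - P i u) ^+ 2) / (v - u).
Definition slope i u w := (P i (u + w) - P i u) / w.

(** Decomposition of a variance into the parts within the two subintervals and the part between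
    their mean slopes. *)
Lemma deficit_split u m v : u < m -> m < v ->
  deficit u v = deficit u m + deficit m v + (m - u) * (v - m) / (v - u) *
   \sum_i ((P i m - P i u) / (m - u) - (P i v - P i m) / (v - m)) ^+ 2.
Proof.
move=> um mv; rewrite /deficit.
have h : (\sum_i (P i v - P i u) ^+ 2) / (v - u) = (\sum_i (P i m - P i u) ^+ 2) / (m - u)
  + (\sum_i (P i v - P i m) ^+ 2) / (v - m) - (m - u) * (v - m) / (v - u) *
   \sum_i ((P i m - P i u) / (m - u) - (P i v - P i m) / (v - m)) ^+ 2.
  rewrite !mulr_suml mulr_sumr -big_split/= -sumrB; apply: eq_bigr => i _.
  by field; rewrite !subr_eq0 !gt_eqF//; lra.
by rewrite h; lra.
Qed.

Hypothesis deficit_ge0 : forall u v, u < v -> 0 <= deficit u v.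

Lemma deficit_le u a b v : u <= a -> a < b -> b <= v -> deficit a b <= deficit u v.
Proof.
have S u' m v' : u' < m -> m < v' ->
    deficit u' m <= deficit u' v' /\ deficit m v' <= deficit u' v'.
  move=> um mv; rewrite (deficit_split um mv).
  have h : 0 <= (m - u') * (v' - m) / (v' - u') *
   \sum_i ((P i m - P i u') / (m - u') - (P i v' - P i m) / (v' - m)) ^+ 2.
    apply: mulr_ge0; last by apply: sumr_ge0 => i _; exact: sqr_ge0.
    by apply: divr_ge0; [apply: mulr_ge0|]; lra.
  by have := deficit_ge0 um; have := deficit_ge0 mv; lra.
move=> ua ab bv; apply: (@le_trans _ _ (deficit u b)).
  by move: ua; rewrite le_eqVlt => /predU1P[->//|ua]; have [] := S _ _ _ ua ab.
move: bv; rewrite le_eqVlt => /predU1P[<-//|bv].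
by have [] := S u b v (le_lt_trans ua ab) bv.
Qed.

Variables (alpha K : R).
Hypothesis alpha_gt2 : 2 < alpha.
Hypothesis alpha_lt3 : alpha < 3.
Hypothesis K_ge0 : 0 <= K.
Hypothesis cts_deficit : forall w, 0 < w -> continuous (fun u => deficit u (u + w)).
Hypothesis per_deficit : forall w, periodic (fun u => deficit u (u + w)).
Hypothesis scale : forall r, 0 < r -> r <= 6^-1 -> exists2 w, 2 * r <= w <= 3 * r &
  int01 (fun u => deficit u (u + w)) <= K * r `^ alpha.

(** For every x in [u - r, u] the interval [x, x + w] contains [u, u + r] because w >= 2 r, so
    monotonicity bounds D by the deficit there; integrating over these x, inside one period, gives r
    D <= K r^alpha. *)
Lemma deficit_bound u r : 0 < r -> r <= 6^-1 -> deficit u (u + r) <= K * r `^ (alpha - 1).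
Proof.
move=> r0 r6; have [w /andP[w2 w3] hw] := scale r0 r6.
have w0 : 0 < w by lra.
set D := deficit u (u + r).
set q := (fun u => deficit u (u + w)) in hw.
have cq : continuous q by exact: cts_deficit.
have q0 x : 0 <= q x by apply: deficit_ge0; lra.
have hQ := isD_prim cq.
have h1 : prim q (u - r + 1) - prim q (u - r) = int01 q.
  by apply: (prim_period hQ) => //; exact: per_deficit.
have h2 : prim q u <= prim q (u - r + 1) by apply: (isD_le hQ) => //; lra.
have h3 : prim q (u - r) - D * (u - r) <= prim q u - D * u.
  apply: (isD_le (p := fun x => prim q x - D * x) (isDB hQ (isDZ D (@isD_id R)))); last by lra.
  move=> x /andP[x1 x2]; rewrite mulr1 subr_ge0; apply: deficit_le; lra.
have h4 : r * D <= K * r `^ alpha by apply: le_trans hw; rewrite -h1; lra.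
have a0 : 0 < alpha by move: alpha_gt2; lra.
by rewrite -(ler_pM2l r0) mulrCA (mulr_powRB1 (ltW r0) a0).
Qed.

Let beta := (alpha - 2) / 2.
Let beta0 : 0 < beta. Proof. by move: alpha_gt2; rewrite /beta; lra. Qed.
Let N := Num.sqrt K.

Lemma deficit_quot_bound u w : 0 < w -> w <= 6^-1 ->
  deficit u (u + w) / w <= (N * w `^ beta) ^+ 2.
Proof.
move=> w0 w6; rewrite exprMn sqr_sqrtr// powR_sqr ?(ltW w0)//.
rewrite ler_pdivrMr//; apply: (le_trans (deficit_bound u w0 w6)).
have a1 : 0 < alpha - 1 by move: alpha_gt2; lra.
rewrite -mulrA [_ * w]mulrC (_ : 2 * beta = alpha - 1 - 1); last by rewrite /beta; field.
by rewrite (mulr_powRB1 (ltW w0) a1).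
Qed.

(** Split [u, u + w] at u + v: the between-part of [deficit_split] is at most the whole deficit, and
    w - v <= v turns it into a bound on the squared difference of the two slopes. *)
Lemma slope_halving i u v w : w / 2 <= v -> v <= w -> 0 < w -> w <= 6^-1 ->
  `|slope i u v - slope i u w| <= N * w `^ beta.
Proof.
move=> wv; rewrite le_eqVlt => /predU1P[->|vw] w0 w6.
  by rewrite subrr normr0 mulr_ge0 ?sqrtr_ge0 ?powR_ge0.
rewrite -(@ler_pXn2r _ 2) ?nnegrE// ?mulr_ge0 ?sqrtr_ge0 ?powR_ge0//.
apply: le_trans (deficit_quot_bound u w0 w6); rewrite real_normK ?num_real//.
have v0 : 0 < v by lra.
have um : u < u + v by lra. have mv : u + v < u + w by lra.
have := deficit_split um mv; have := deficit_ge0 um; have := deficit_ge0 mv.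
set D := deficit u (u + w); set D1 := deficit _ _; set D2 := deficit _ _ => d1 d2.
set s := \sum_i _ => e.
have si : ((P i (u + v) - P i u) / v - (P i (u + w) - P i (u + v)) / (w - v)) ^+ 2 <= s.
  rewrite /s (bigD1 i)//= (_ : u + v - u = v); last by ring.
  rewrite (_ : u + w - (u + v) = w - v); last by ring.
  by rewrite lerDl; apply: sumr_ge0 => j _; exact: sqr_ge0.
have wv0 : w - v != 0 by rewrite subr_eq0 gt_eqF.
have -> : (slope i u v - slope i u w) ^+ 2 = ((w - v) / w) ^+ 2 *
   ((P i (u + v) - P i u) / v - (P i (u + w) - P i (u + v)) / (w - v)) ^+ 2.
  by rewrite /slope -exprMn; congr (_ ^+ 2); field; rewrite wv0 !gt_eqF.
have k1 : ((w - v) / w) ^+ 2 * ((P i (u + v) - P i u) / v -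
    (P i (u + w) - P i (u + v)) / (w - v)) ^+ 2 <= ((w - v) / w) ^+ 2 * s.
  by apply: ler_wpM2l => //; exact: sqr_ge0.
apply: (le_trans k1); rewrite ler_pdivlMr//.
have -> : ((w - v) / w) ^+ 2 * s * w = (w - v) * s * (w - v) / w by field; rewrite gt_eqF.
move: e; rewrite (_ : u + v - u = v); last by ring.
rewrite (_ : u + w - (u + v) = w - v); last by ring.
rewrite (_ : u + w - u = w); last by ring.
have -> : v * (w - v) / w * s = (w - v) * s * v / w by field; rewrite gt_eqF.
have s0 : 0 <= s by apply: sumr_ge0 => j _; exact: sqr_ge0.
have k2 : (w - v) * s * (w - v) / w <= (w - v) * s * v / w.
  apply: ler_wpM2r; first by rewrite invr_ge0 ltW.
  by apply: ler_wpM2l; [apply: mulr_ge0|]; lra.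
by lra.
Qed.

(** The slope over 2 r is the mean of the two adjacent slopes, so this is the halving estimate
    doubled; 12^-1 keeps 2 r below 6^-1. *)
Lemma slope_adjacent i u r : 0 < r -> r <= 12^-1 ->
  `|slope i (u + r) r - slope i u r| <= 4 * N * r `^ beta.
Proof.
move=> r0 r12.
have h : `|slope i u r - slope i u (2 * r)| <= N * (2 * r) `^ beta.
  by apply: slope_halving; lra.
have e : slope i (u + r) r - slope i u r = - 2 * (slope i u r - slope i u (2 * r)).
  rewrite /slope (_ : u + r + r = u + 2 * r); last by ring.
  by field; rewrite gt_eqF.
rewrite e normrM normrN [`|2|]gtr0_norm//.
have k : (2 * r) `^ beta <= 2 * r `^ beta.
  rewrite powRM ?(ltW r0)//; apply: ler_wpM2r; first exact: powR_ge0.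
  by apply: ler1_powR; [|move: alpha_lt3; rewrite /beta]; lra.
have := ler_wpM2l (sqrtr_ge0 K) k; rewrite -/N.
by lra.
Qed.

(** The 6 adds two errors between slopes and limits to the 4 of [slope_adjacent], each taken with
    the geometric factor 1 / (1 - q). *)
Lemma morrey : exists d : 'I_n -> R -> R,
  (forall i u w, 0 < w -> w <= 12^-1 ->
    `|slope i u w - d i u| <= 6 / (1 - 2^-1 `^ beta) * N * w `^ beta) /\
  (forall i u r, 0 < r -> r <= 12^-1 ->
    `|d i (u + r) - d i u| <= 6 / (1 - 2^-1 `^ beta) * N * r `^ beta).
Proof.
have q1 : 2^-1 `^ beta < 1 :> R.
  rewrite [ltRHS](_ : 1 = 1 `^ beta); last by rewrite powR1.
  by apply: gt0_ltr_powR; rewrite ?nnegrE ?invr_ge0 ?invf_lt1 ?ltr1n.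
set q : R := 2^-1 `^ beta in q1 *.
have q0 : 0 <= q by exact: powR_ge0.
have N0 : 0 <= N by exact: sqrtr_ge0.
have c1 : 1 <= 1 / (1 - q) by rewrite ler_pdivlMr; lra.
have ex i u : exists d, forall w, 0 < w -> w <= 12^-1 ->
    `|slope i u w - d| <= N / (1 - q) * w `^ beta.
  apply: holder_limit => //; first by apply: divr_ge0; lra.
  apply: dyadic_cauchy => // v w wv vw w0 w12.
  by apply: slope_halving => //; lra.
pose d i u := sval (cid (ex i u)).
have hd i u := svalP (cid (ex i u)).
have E : 6 / (1 - q) * N = 6 * (N / (1 - q)) by ring.
have F : N <= N / (1 - q) by rewrite -[N / _]mulr1 -mulrA -[leLHS]mulr1 ler_wpM2l//; lra.
exists d; split=> i u r r0 r12.
  apply: (le_trans (hd i u r r0 r12)); rewrite E; apply: ler_wpM2r; first exact: powR_ge0.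
  by lra.
have a1 := hd i u r r0 r12; have a2 := hd i (u + r) r r0 r12.
have a3 := slope_adjacent i u r0 r12.
rewrite -/(d i u) -/(d i (u + r)) in a1 a2.
have G : N * r `^ beta <= N / (1 - q) * r `^ beta by apply: ler_wpM2r => //; exact: powR_ge0.
rewrite E.
have := ler_distD (slope i (u + r) r) (d i (u + r)) (d i u).
have := ler_distD (slope i u r) (slope i (u + r) r) (d i u).
by rewrite (distrC (d i (u + r)) (slope i (u + r) r)); lra.
Qed.

End Morrey.

(** * Truncated double integrals and their slices *)

Section BoxIntegral.
Variable R : realType.
Implicit Types (p q : R -> R) (X Y Z : R -> R -> R) (eps c u w : R).
Local Notation leb := (@lebesgue_measure R).
Local Notation leb2 := (leb \x leb)%E.

Lemma periodicZ p : periodic p -> forall (k : int) x, p (x + k%:~R) = p x.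
Proof.
move=> pp; have hn (m : nat) x : p (x + m%:R) = p x.
  elim: m x => [|m IH] x; first by rewrite addr0.
  by rewrite -natr1 addrA pp IH.
case=> m x; first exact: hn.
by rewrite NegzE mulrNz -pmulrn -(hn m.+1 (x - m.+1%:R)) subrK.
Qed.

Lemma periodic_bounded p : continuous p -> periodic p -> exists C, forall x, `|p x| <= C.
Proof.
move=> cp pp.
have cn : continuous (fun x => `|p x|).
  by move=> x; apply: (continuous_comp (cp x)); exact: norm_continuous.
have [|c _ hc] := @EVT_max R (fun x => `|p x|) 0 1 ler01; first exact: continuous_subspaceT.
exists `|p c| => x; rewrite -(periodicZ pp (- Num.floor x) x); apply: hc.
rewrite in_itv/= rmorphN/= subr_ge0 Num.Theory.ge_floor lerBlDl; apply/ltW.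
by have := Num.Theory.lt_succ_floor x; rewrite intrD1 addrC.
Qed.

Definition W eps : set R := `[-(1/2), - eps] `|` `[eps, 1/2].
Definition box eps : set (R * R) := `[0, 1]%classic `*` W eps.

Lemma WP eps w : 0 < eps -> W eps w -> [/\ w != 0, eps <= `|w| & `|w| <= 1/2].
Proof.
move=> e0 [] /=; rewrite in_itv/= => /andP[h1 h2].
  by rewrite ltr0_norm ?lt_eqF; [split => //| |]; lra.
by rewrite gtr0_norm ?gt_eqF; [split => //| |]; lra.
Qed.

Lemma W_sub eps eps' : eps <= eps' -> W eps' `<=` W eps.
Proof. by move=> h w [] /=; rewrite in_itv/= => /andP[h1 h2]; [left|right]; rewrite /= in_itv/=; lra. Qed.

Lemma measurable_W eps : measurable (W eps).
Proof. by apply: measurableU; exact: measurable_itv. Qed.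

Lemma measurable_box eps : measurable (box eps).
Proof. by apply: measurableX; [exact: measurable_itv|exact: measurable_W]. Qed.

Lemma leb_W_fin eps : (leb (W eps) < +oo)%E.
Proof.
have := @measureU2 _ _ R leb _ _ (measurable_itv `[-(1/2), -eps]) (measurable_itv `[eps, 1/2]).
move=> /le_lt_trans; apply.
by apply: lte_add_pinfty; apply: compact_finite_measure; exact: segment_compact.
Qed.

Lemma leb2_box_fin eps : (leb2 (box eps) < +oo)%E.
Proof.
rewrite /box product_measure1E; [|exact: measurable_itv|exact: measurable_W].
apply: lte_mul_pinfty => //; last exact: leb_W_fin.
by rewrite ge0_fin_numE//; apply: compact_finite_measure; exact: segment_compact.
Qed.

(* The weights are singular at w = 0, which J avoids. *)
Definition adm X := measurable_fun setT (fun z : R * R => X z.1 z.2) /\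
  forall eps, 0 < eps -> exists C, forall u w, W eps w -> `|X u w| <= C.

Lemma adm_ext X Y : (forall u w, X u w = Y u w) -> adm X -> adm Y.
Proof.
move=> h; have -> // : X = Y by apply/funext => u; apply/funext => w; exact: h.
Qed.

Lemma adm_cst c : adm (fun _ _ => c).
Proof. by split; [exact: measurable_cst|move=> e _; exists `|c|]. Qed.

Lemma adm_add X Y : adm X -> adm Y -> adm (fun u w => X u w + Y u w).
Proof.
move=> [mX bX] [mY bY]; split; first exact: measurable_funD.
move=> e e0; have [C hC] := bX e e0; have [D hD] := bY e e0; exists (C + D) => u w h.
by rewrite (le_trans (ler_normD _ _))// lerD ?hC ?hD.
Qed.

Lemma adm_mul X Y : adm X -> adm Y -> adm (fun u w => X u w * Y u w).
Proof.
move=> [mX bX] [mY bY]; split; first exact: measurable_funM.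
move=> e e0; have [C hC] := bX e e0; have [D hD] := bY e e0; exists (C * D) => u w h.
by rewrite normrM ler_pM ?hC ?hD.
Qed.

Lemma adm_scale c X : adm X -> adm (fun u w => c * X u w).
Proof. by apply: adm_mul; exact: adm_cst. Qed.

Lemma adm_sub X Y : adm X -> adm Y -> adm (fun u w => X u w - Y u w).
Proof.
move=> aX aY; apply: adm_ext (adm_add aX (adm_scale (-1) aY)) => u w.
by rewrite mulN1r.
Qed.

Lemma adm_norm X : adm X -> adm (fun u w => `|X u w|).
Proof.
move=> [mX bX]; split; first by apply: measurableT_comp mX; exact: normr_measurable.
by move=> e e0; have [C hC] := bX e e0; exists C => u w h; rewrite normr_id hC.
Qed.

Lemma measurable_sum2 : measurable_fun setT (fun z : R * R => z.1 + z.2).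
Proof. by apply: measurable_funD; [exact: measurable_fst|exact: measurable_snd]. Qed.

Lemma adm_shift c X : adm X -> adm (fun u w => X (u + c) w).
Proof.
move=> [mX bX]; split; last first.
  by move=> e e0; have [C hC] := bX e e0; exists C => u w h; exact: hC.
apply: (@measurableT_comp _ _ _ _ _ _ (fun z : R * R => X z.1 z.2) _ (fun z : R * R => (z.1 + c, z.2))) => //.
apply/measurable_fun_pairP; split; last exact: measurable_snd.
by apply: measurable_funD; [exact: measurable_fst|exact: measurable_cst].
Qed.

Lemma adm_fun p : continuous p -> periodic p -> adm (fun u _ => p u).
Proof.
move=> cp pp; split.
  by apply: measurableT_comp (measurable_fst); exact: continuous_measurable_fun.
by move=> e _; have [C hC] := periodic_bounded cp pp; exists C => u w _; exact: hC.
Qed.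

(** Inversion is discontinuous at 0; it is rewritten through a power function, both sides vanishing
    there. *)
Lemma measurable_invr : measurable_fun setT (fun w : R => w^-1).
Proof.
have -> : (fun w : R => w^-1) = (fun w => w * `|w| `^ (- 2)).
  apply/funext => w; have [->|w0] := eqVneq w 0; first by rewrite invr0 mul0r.
  by rewrite powRN powR_mulrn// real_normK ?num_real//; field.
apply: measurable_funM; first exact: measurable_id.
by apply: (measurableT_comp (measurable_powR (-2))); exact: normr_measurable.
Qed.

Lemma adm_avg p : continuous p -> periodic p -> adm (fun u w => avg w p u).
Proof.
move=> cp pp; split; last first.
  move=> e e0; have [C hC] := periodic_bounded cp pp; exists C => u w /(WP e0)[w0 _ _].
  exact: avg_norm_le.
have mP := continuous_measurable_fun (isD_continuous (isD_prim cp)).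
apply: measurable_funM; last by apply: (measurableT_comp measurable_invr); exact: measurable_snd.
apply: measurable_funB; first by apply: (measurableT_comp mP); exact: measurable_sum2.
by apply: (measurableT_comp mP); exact: measurable_fst.
Qed.

Lemma adm_cov p q : continuous p -> periodic p -> continuous q -> periodic q ->
  adm (fun u w => cov w p q u).
Proof.
move=> cp pp cq pq; apply: adm_sub; last by apply: adm_mul; exact: adm_avg.
by apply: adm_avg; [exact: cts_mul|move=> x; rewrite pp pq].
Qed.

Definition J eps X := Rintegral leb2 (box eps) (fun z => X z.1 z.2).

Lemma adm_integrable eps X : 0 < eps -> adm X ->
  leb2.-integrable (box eps) (EFin \o (fun z => X z.1 z.2)).
Proof.
move=> e0 [mX bX]; apply: measurable_bounded_integrable.
- exact: measurable_box.
- exact: leb2_box_fin.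
- exact: measurable_funTS.
- have [C hC] := bX _ e0; exists C; split; first exact: num_real.
  by move=> D CD z [_ hz] /=; apply: (le_trans (hC _ _ hz)); exact: ltW.
Qed.

Lemma JD eps X Y : 0 < eps -> adm X -> adm Y ->
  J eps (fun u w => X u w + Y u w) = J eps X + J eps Y.
Proof. by move=> e0 aX aY; rewrite /J RintegralD//; [exact: measurable_box|exact: adm_integrable..]. Qed.

Lemma JB eps X Y : 0 < eps -> adm X -> adm Y ->
  J eps (fun u w => X u w - Y u w) = J eps X - J eps Y.
Proof. by move=> e0 aX aY; rewrite /J RintegralB//; [exact: measurable_box|exact: adm_integrable..]. Qed.

Lemma JZ eps c X : 0 < eps -> adm X -> J eps (fun u w => c * X u w) = c * J eps X.
Proof. by move=> e0 aX; rewrite /J RintegralZl//; [exact: measurable_box|exact: adm_integrable]. Qed.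

Lemma J_le eps X Y : 0 < eps -> adm X -> adm Y ->
  (forall u w, W eps w -> X u w <= Y u w) -> J eps X <= J eps Y.
Proof.
move=> e0 aX aY h; apply: le_Rintegral; [exact: measurable_box|exact: adm_integrable..|].
by move=> z [_ hz]; exact: h.
Qed.

Lemma J_ge0 eps X : (forall u w, W eps w -> 0 <= X u w) -> 0 <= J eps X.
Proof. by move=> h; apply: Rintegral_ge0 => z [_ hz]; exact: h. Qed.

Lemma J_eq eps X Y : (forall u w, W eps w -> X u w = Y u w) -> J eps X = J eps Y.
Proof. by move=> h; apply: eq_Rintegral => z; rewrite inE => -[_ hz]; exact: h. Qed.

Lemma J_norm eps X : 0 < eps -> adm X -> `|J eps X| <= J eps (fun u w => `|X u w|).
Proof. by move=> e0 aX; apply: le_normr_Rintegral; [exact: measurable_box|exact: adm_integrable]. Qed.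

Lemma adm_slice1 eps X u : 0 < eps -> adm X -> leb.-integrable (W eps) (EFin \o X u).
Proof.
move=> e0 [mX bX]; apply: measurable_bounded_integrable.
- exact: measurable_W.
- exact: leb_W_fin.
- apply: measurable_funTS.
  exact: (@measurableT_comp _ _ _ _ _ _ (fun z : R * R => X z.1 z.2) _ (pair u) mX (pair1_measurable u)).
- have [C hC] := bX _ e0; exists C; split; first exact: num_real.
  by move=> D CD z hz /=; apply: (le_trans (hC _ _ hz)); exact: ltW.
Qed.

Lemma adm_slice2 eps X w : 0 < eps -> W eps w -> adm X ->
  leb.-integrable `[0, 1] (EFin \o X^~ w).
Proof.
move=> e0 hw [mX bX]; apply: measurable_bounded_integrable.
- exact: measurable_itv.
- by apply: compact_finite_measure; exact: segment_compact.
- apply: measurable_funTS.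
  exact: (@measurableT_comp _ _ _ _ _ _ (fun z : R * R => X z.1 z.2) _ (pair^~ w) mX (pair2_measurable w)).
- have [C hC] := bX _ e0; exists C; split; first exact: num_real.
  by move=> D CD z hz /=; apply: (le_trans (hC _ _ hw)); exact: ltW.
Qed.

Lemma box_memE eps u w : ((u, w) \in box eps) = (u \in `[0, 1]%classic) && (w \in W eps).
Proof. exact: in_setX. Qed.

Lemma J12 eps X : 0 < eps -> adm X ->
  J eps X = Rintegral leb `[0, 1] (fun u => Rintegral leb (W eps) (fun w => X u w)).
Proof.
move=> e0 aX; have iX := adm_integrable e0 aX.
rewrite /J /Rintegral integral_mkcond.
have := iX; rewrite integrable_mkcond; last exact: measurable_box.
move=> iX'; rewrite -(integral12_prod_meas1 iX'); congr fine.
rewrite [RHS]integral_mkcond; apply: eq_integral => u _.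
rewrite /fubini_F /patch; case: ifPn => hu.
  rewrite fineK; last by apply: integrable_fin_num; [exact: measurable_W|exact: adm_slice1].
  rewrite [RHS]integral_mkcond; apply: eq_integral => w _.
  by rewrite /patch box_memE hu.
by apply: integral0_eq => w _; rewrite box_memE (negbTE hu).
Qed.

Lemma J21 eps X : 0 < eps -> adm X ->
  J eps X = Rintegral leb (W eps) (fun w => int01 (X^~ w)).
Proof.
move=> e0 aX; have iX := adm_integrable e0 aX.
rewrite /J /Rintegral integral_mkcond.
have := iX; rewrite integrable_mkcond; last exact: measurable_box.
move=> iX'; rewrite -(integral21_prod_meas1 iX'); congr fine.
rewrite [RHS]integral_mkcond; apply: eq_integral => w _.
rewrite /fubini_G /patch; case: ifPn => hw.
  rewrite /int01 /Rintegral fineK; last first.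
    apply: integrable_fin_num; first exact: measurable_itv.
    by apply: (adm_slice2 e0) => //; move: hw; rewrite inE.
  rewrite [RHS]integral_mkcond; apply: eq_integral => u _.
  by rewrite /patch box_memE hw andbT.
by apply: integral0_eq => u _; rewrite box_memE (negbTE hw) andbF.
Qed.

Lemma J21_integrable eps X : 0 < eps -> adm X ->
  leb.-integrable (W eps) (EFin \o (fun w => int01 (X^~ w))).
Proof.
move=> e0 aX; have iX := adm_integrable e0 aX.
have := iX; rewrite integrable_mkcond; last exact: measurable_box.
move=> iX'; have mG := measurable_fubini_G iX'.
have [C hC] := aX.2 _ e0.
apply: measurable_bounded_integrable.
- exact: measurable_W.
- exact: leb_W_fin.
- apply/measurable_EFinP.
  apply: (eq_measurable_fun _ _ (measurable_funTS mG)) => w hw.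
  rewrite /fubini_G/= /patch /int01 /Rintegral fineK; last first.
    apply: integrable_fin_num; first exact: measurable_itv.
    by apply: (adm_slice2 e0) => //; move: hw; rewrite inE.
  rewrite [RHS]integral_mkcond; apply: eq_integral => u _.
  by rewrite /patch box_memE hw andbT.
- exists C; split; first exact: num_real.
  move=> D CD w hw /=; apply: (le_trans _ (ltW CD)).
  have iw := adm_slice2 e0 hw aX.
  rewrite /int01; apply: le_trans; first by apply: le_normr_Rintegral; [exact: measurable_itv|exact: iw].
  rewrite -[leRHS]int01_cst; apply: le_Rintegral.
  + exact: measurable_itv.
  + exact: (adm_slice2 e0 hw (adm_norm aX)).
  + exact: (adm_slice2 e0 hw (adm_cst C)).
  + by move=> u _; exact: hC.
Qed.

(** Integration by parts, translation and self-adjointness give identities only after integration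
    over a period at fixed w; as the weight depends on w alone, this is enough. *)
Lemma J_eq_slice eps X Y : 0 < eps -> adm X -> adm Y ->
  (forall w, W eps w -> int01 (X^~ w) = int01 (Y^~ w)) -> J eps X = J eps Y.
Proof.
move=> e0 aX aY h; rewrite (J21 e0 aX) (J21 e0 aY); apply: eq_Rintegral => w; rewrite inE; exact: h.
Qed.

Lemma J_mono_eps eps eps' X : 0 < eps -> eps <= eps' -> adm X ->
  (forall u w, W eps w -> 0 <= X u w) -> J eps' X <= J eps X.
Proof.
move=> e0 ee aX X0; rewrite /J /Rintegral.
have e0' : 0 < eps' by exact: lt_le_trans ee.
apply: fine_le.
- by apply: integrable_fin_num; [exact: measurable_box|exact: adm_integrable].
- by apply: integrable_fin_num; [exact: measurable_box|exact: adm_integrable].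
apply: ge0_subset_integral; [exact: measurable_box|exact: measurable_box| | |].
- by apply/measurable_EFinP; apply: measurable_funTS; exact: aX.1.
- by move=> z [_ hz]; rewrite lee_fin X0.
- by move=> z [z1 z2]; split => //; exact: W_sub z2.
Qed.

End BoxIntegral.

(** * The quadratic energy and the norms it controls *)

Section Energy.
Variables (R : realType) (alpha : R).
Hypothesis alpha_gt2 : 2 < alpha.
Hypothesis alpha_lt3 : alpha < 3.
Implicit Types (p q : R -> R) (X Y : R -> R -> R) (eps c d r u w E : R).
Local Notation leb := (@lebesgue_measure R).

Definition wt w : R := `|w| `^ (- alpha).

Lemma wt_ge0 w : 0 <= wt w. Proof. exact: powR_ge0. Qed.

Lemma adm_wt : adm (fun _ w => wt w).
Proof.
split.
  apply: (measurableT_comp (measurable_powR (- alpha))).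
  by apply: (measurableT_comp (@normr_measurable R setT)); exact: measurable_snd.
move=> e e0; exists (e `^ (- alpha)) => u w /(WP e0)[w0 ew _].
rewrite ger0_norm ?wt_ge0// /wt !powRN lef_pV2 ?posrE ?powR_gt0//; last exact: lt_le_trans ew.
by apply: ge0_ler_powR; rewrite ?nnegrE//; move: alpha_gt2; lra.
Qed.

Lemma adm_wtM X : adm X -> adm (fun u w => wt w * X u w).
Proof. by move=> aX; apply: adm_mul => //; exact: adm_wt. Qed.

Lemma Rintegral_cst_itv (a b c : R) : a <= b -> Rintegral leb `[a, b] (fun=> c) = c * (b - a).
Proof.
move=> ab; have h : isD (fun x : R => c * x) (fun=> c).
  by apply: isD_ext (isDZ c (@isD_id R)) => // x; rewrite mulr1.
by rewrite (FTC_Rintegral h (cts_cst c) ab) mulrBr.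
Qed.

(** Mean value argument: if the slice integrals exceeded the bound on all of [2 r, 3 r], where the
    weight is at least (3 r)^-alpha, the double integral would be at least 2 E. The condition r <=
    6^-1 keeps 3 r <= 1/2. *)
Lemma scale_slice Y E r : 0 < r -> r <= 6^-1 -> 0 < E -> adm Y ->
  (forall u w, W (2 * r) w -> 0 <= Y u w) ->
  J (2 * r) (fun u w => wt w * Y u w) <= E ->
  exists2 w, 2 * r <= w <= 3 * r & int01 (Y^~ w) <= 2 * 3 `^ alpha * E * r `^ (alpha - 1).
Proof.
move=> r0 r6 E0 aY Y0 hJ; set B := 2 * _ * _ * _.
have e0 : 0 < 2 * r by lra.
apply: contrapT => hn.
have hB w : 2 * r <= w <= 3 * r -> B <= int01 (Y^~ w).
  by move=> hw; rewrite leNgt; apply/negP => /ltW k; apply: hn; exists w.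
have aZ := adm_wtM aY.
have hW w : 2 * r <= w <= 3 * r -> W (2 * r) w.
  by move=> /andP[h1 h2]; right; rewrite /= in_itv/=; apply/andP; split; lra.
pose g w := int01 (fun u => wt w * Y u w).
have ig : leb.-integrable (W (2 * r)) (EFin \o g) := J21_integrable e0 aZ.
have ig' : leb.-integrable `[2 * r, 3 * r] (EFin \o g).
  apply: integrableS ig; [exact: measurable_W|exact: measurable_itv|].
  by move=> w /=; rewrite in_itv/=; exact: hW.
have g0 w : W (2 * r) w -> 0 <= g w.
  by move=> hw; apply: Rintegral_ge0 => u _; rewrite mulr_ge0 ?wt_ge0 ?Y0.
have h1 : Rintegral leb `[2 * r, 3 * r] g <= E.
  apply: le_trans hJ; rewrite (J21 e0 aZ) /Rintegral; apply: fine_le.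
  - by apply: integrable_fin_num; [exact: measurable_itv|].
  - by apply: integrable_fin_num; [exact: measurable_W|].
  apply: ge0_subset_integral; [exact: measurable_itv|exact: measurable_W| | |].
  - by case/integrableP : ig.
  - by move=> w hw; rewrite lee_fin; exact: g0.
  - by move=> w /=; rewrite in_itv/=; exact: hW.
have B0 : 0 <= B by rewrite /B !mulr_ge0 ?powR_ge0 ?ltW.
have h2 : ((3 * r) `^ (- alpha) * B) * (3 * r - 2 * r) <= Rintegral leb `[2 * r, 3 * r] g.
  rewrite -Rintegral_cst_itv; last by lra.
  apply: le_Rintegral => //; first by exact: cts_integrable (cts_cst _).
  move=> w /=; rewrite in_itv/= => hw; have /andP[w1 w2] := hw.
  have w0 : 0 < w by lra.
  rewrite /g /int01 RintegralZl; [|exact: measurable_itv|exact: adm_slice2 (hW _ hw) aY].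
  apply: ler_pM => //; first exact: powR_ge0.
  - rewrite /wt gtr0_norm// !powRN lef_pV2 ?posrE ?powR_gt0//; last by lra.
    by apply: ge0_ler_powR; rewrite ?nnegrE//; move: alpha_gt2; lra.
  - exact: hB.
have a0 : 0 < alpha by move: alpha_gt2; lra.
have r3 : 0 < 3 * r by lra.
have h3 : ((3 * r) `^ (- alpha) * B) * (3 * r - 2 * r) = 2 * E.
  have -> : 3 * r - 2 * r = r by ring.
  have -> : (3 * r) `^ (- alpha) * B * r =
     2 * E * ((3 * r) `^ (- alpha) * (3 `^ alpha * (r * r `^ (alpha - 1)))) by rewrite /B; ring.
  rewrite (mulr_powRB1 (ltW r0) a0) -powRM ?(ltW r0)// powRN mulVf ?mulr1//.
  by rewrite gt_eqF// powR_gt0.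
by move: h2; rewrite h3; lra.
Qed.

Definition En eps p := J eps (fun u w => wt w * cov w p p u).

Lemma En_ge0 eps p : 0 < eps -> continuous p -> 0 <= En eps p.
Proof.
move=> e0 cp; apply: J_ge0 => u w /(WP e0)[w0 _ _].
by rewrite mulr_ge0 ?wt_ge0 ?var_ge0.
Qed.

(** Averaging preserves the integral over a period, so at fixed w the average of p q may be replaced
    by p q; this is the form in which the energy occurs in the first variation. *)
Lemma J_cov eps p q : 0 < eps -> continuous p -> periodic p -> continuous q -> periodic q ->
  J eps (fun u w => wt w * cov w p q u) =
  J eps (fun u w => wt w * (p u * q u - avg w p u * avg w q u)).
Proof.
move=> e0 cp pp cq pq; have cpq := cts_mul cp cq.
have ppq : periodic (fun x => p x * q x) by move=> x; rewrite pp pq.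
apply: J_eq_slice => //.
- by apply: adm_wtM; exact: adm_cov.
- apply: adm_wtM; apply: adm_sub; first exact: (@adm_fun _ (fun u => p u * q u)).
  by apply: adm_mul; exact: adm_avg.
move=> w /(WP e0)[w0 _ _]; rewrite !int01Z; [by rewrite int01_cov| |exact: cts_cov].
by apply: cts_sub => //; apply: cts_mul; exact: cts_avg.
Qed.

Lemma En_shift eps p c : 0 < eps -> continuous p -> periodic p ->
  En eps (fun x => p (x + c)) = En eps p.
Proof.
move=> e0 cp pp; have cpc := cts_shift c cp.
have ppc : periodic (fun x => p (x + c)) by move=> x; rewrite addrAC pp.
apply: J_eq_slice e0 (adm_wtM (adm_cov cpc ppc cpc ppc)) (adm_wtM (adm_cov cp pp cp pp)) _.
move=> w hw; rewrite !int01Z; try exact: cts_cov.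
congr (_ * _); transitivity (int01 (fun u => cov w p p (u + c))).
  by apply: eq_Rintegral => u _; exact: cov_shift.
by rewrite int01_shift//; [exact: cts_cov|exact: periodic_cov].
Qed.

Lemma var_sub_le w p q u : w != 0 -> continuous p -> continuous q ->
  var w (fun x => p x - q x) u <= 2 * var w p u + 2 * var w q u.
Proof.
move=> w0 cp cq.
have -> : (fun x => p x - q x) = (fun x => 1 * p x + (-1) * q x).
  by apply/funext => x; ring.
rewrite var_lincomb//; have := cov_norm_le u w0 ltr01 cp cq.
by rewrite invr1 ler_norml => /andP[]; lra.
Qed.

Lemma En_sub_le eps p q : 0 < eps -> continuous p -> periodic p -> continuous q -> periodic q ->
  En eps (fun x => p x - q x) <= 2 * En eps p + 2 * En eps q.
Proof.
move=> e0 cp pp cq pq; have cpq := cts_sub cp cq.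
have ppq : periodic (fun x => p x - q x) by move=> x; rewrite pp pq.
have a1 := adm_wtM (adm_cov cp pp cp pp); have a2 := adm_wtM (adm_cov cq pq cq pq).
rewrite /En -(JZ 2 e0 a1) -(JZ 2 e0 a2) -(JD e0 (adm_scale 2 a1) (adm_scale 2 a2)).
apply: J_le => //; first by apply: adm_wtM; exact: adm_cov.
  by apply: adm_add; exact: adm_scale.
move=> u w /(WP e0)[w0 _ _].
have := ler_wpM2l (wt_ge0 w) (var_sub_le u w0 cp cq); lra.
Qed.

Lemma deficit_prim p u w : w != 0 -> continuous p ->
  deficit (fun _ : 'I_1 => prim p) (prim (fun x => p x * p x)) u (u + w) = w * var w p u.
Proof.
move=> w0 cp; rewrite /deficit big_ord1 /cov /avg (_ : u + w - u = w); last by ring.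
by field.
Qed.

(** 6 * 3^alpha is the constant 2 * 3^alpha of [scale_slice] times the 3 of w <= 3 r. *)
Definition morrey_cst : R := 6 / (1 - 2^-1 `^ ((alpha - 2) / 2)) * Num.sqrt (6 * 3 `^ alpha).

Lemma morrey_cst_ge0 : 0 <= morrey_cst.
Proof.
rewrite mulr_ge0 ?sqrtr_ge0// divr_ge0// subr_ge0.
rewrite [leRHS](_ : 1 = 1 `^ ((alpha - 2) / 2)); last by rewrite powR1.
apply: ge0_ler_powR; rewrite ?nnegrE ?invr_ge0 ?invf_le1 ?ler1n//.
by move: alpha_gt2; lra.
Qed.

(** [morrey] for the single component [prim p]: its deficit is w times the variance of p, and the
    limit slope is p by uniqueness of derivatives. *)
Lemma morrey_scalar p E : continuous p -> periodic p -> 0 < E ->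
  (forall eps, 0 < eps -> En eps p <= E) ->
  (forall u w, 0 < w -> w <= 12^-1 ->
     `|avg w p u - p u| <= morrey_cst * Num.sqrt E * w `^ ((alpha - 2) / 2)) /\
  (forall u r, 0 < r -> r <= 12^-1 ->
     `|p (u + r) - p u| <= morrey_cst * Num.sqrt E * r `^ ((alpha - 2) / 2)).
Proof.
move=> cp pp E0 hE; have a2 := alpha_gt2; have a3 := alpha_lt3.
pose K := 6 * 3 `^ alpha * E.
have K0 : 0 <= K by rewrite /K !mulr_ge0 ?powR_ge0// ltW.
pose P (_ : 'I_1) := prim p; pose A := prim (fun x => p x * p x).
have wn0 w : 0 < w -> w != 0 by move=> h; rewrite gt_eqF.
have := @morrey R 1 P A _ alpha K a2 a3 K0; case.
- move=> u v uv; rewrite (_ : v = u + (v - u)); last by ring.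
  have w0 : 0 < v - u by lra.
  by rewrite deficit_prim ?wn0//; apply: mulr_ge0; [exact: ltW|apply: var_ge0 => //; exact: wn0].
- move=> w w0; have -> : (fun u => deficit P A u (u + w)) = (fun u => w * var w p u).
    by apply/funext => u; rewrite deficit_prim// wn0.
  by apply: cts_scale; exact: cts_cov.
- move=> w u; rewrite /deficit /P /A !big_ord1.
  have h1 := prim_period (isD_prim cp) cp pp.
  have cpp := cts_mul cp cp.
  have h2 := prim_period (isD_prim cpp) cpp (fun x => congr2 *%R (pp x) (pp x)).
  have := h1 u; have := h1 (u + w); have := h2 u; have := h2 (u + w).
  rewrite (addrAC u 1 w) => e1 e2 e3 e4.
  rewrite (_ : u + w + 1 - (u + 1) = u + w - u); last by ring.
  have K2 (x y x' y' I : R) : x' - x = I -> y' - y = I -> x' - y' = x - y by lra.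
  by congr (_ - _ ^+ 2 / _); [exact: K2 e1 e2|exact: K2 e3 e4].
- move=> r r0 r6; have [|||w hw hi] := @scale_slice (fun u w => var w p u) E r r0 r6 E0.
  + exact: adm_cov.
  + by move=> u w /WP[]; [lra|move=> w0 _ _; exact: var_ge0].
  + by apply: hE; lra.
  exists w => //; have /andP[w1 w2] := hw; have w0 : 0 < w by lra.
  have -> : (fun u => deficit P A u (u + w)) = (fun u => w * var w p u).
    by apply/funext => u; rewrite deficit_prim// wn0.
  rewrite int01Z; last exact: cts_cov.
  have a0 : 0 < alpha by lra.
  have i0 : 0 <= int01 (var w p) by apply: int01_ge0 => u; apply: var_ge0; rewrite ?wn0.
  apply: (@le_trans _ _ ((3 * r) * (2 * 3 `^ alpha * E * r `^ (alpha - 1)))).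
    by apply: ler_pM => //; lra.
  by rewrite -(mulr_powRB1 (ltW r0) a0) /K; lra.
move=> d [h1 h2].
have M E' : 6 / (1 - 2^-1 `^ ((alpha - 2) / 2)) * Num.sqrt K * E' =
   morrey_cst * Num.sqrt E * E'.
  by rewrite /K sqrtrM ?mulr_ge0 ?powR_ge0// /morrey_cst !mulrA.
have dp : d ord0 =1 p.
  apply: (@isD_uniq _ (prim p)); last exact: isD_prim.
  apply: (@isD_of_right_rate R (prim p) (d ord0) 12^-1 (morrey_cst * Num.sqrt E) ((alpha - 2) / 2)) => //.
  - by lra.
  - by rewrite mulr_ge0 ?sqrtr_ge0 ?morrey_cst_ge0.
  - by move=> u w w0 w12; have := h1 ord0 u w w0 w12; rewrite M.
  - by move=> u w w0 w12; have := h2 ord0 u w w0 w12; rewrite M.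
split=> u w w0 w12.
  by have := h1 ord0 u w w0 w12; rewrite M dp.
by have := h2 ord0 u w w0 w12; rewrite M !dp.
Qed.

(** Jensen bounds the squared average by the average of p^2, and [u, u + w] lies inside one
    period. *)
Lemma avg_sq_le p u w : 0 < w -> w <= 1 -> continuous p -> periodic p ->
  `|avg w p u| <= Num.sqrt (int01 (fun x => p x ^+ 2)) * w `^ (- 2^-1).
Proof.
move=> w0 w1 cp pp; have wn0 : w != 0 by rewrite gt_eqF.
have cpp := cts_mul cp cp.
have ppp : periodic (fun x => p x * p x) by move=> x; rewrite pp.
have h1 := prim_period (isD_prim cpp) cpp ppp u.
have h2 := var_ge0 u wn0 cp.
have h3 : prim (fun x => p x * p x) (u + w) <= prim (fun x => p x * p x) (u + 1).
  by apply: (isD_le (isD_prim cpp)) => [x _|]; [exact: sqr_ge0|lra].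
have i0 : 0 <= int01 (fun x => p x ^+ 2) by apply: int01_ge0 => x; exact: sqr_ge0.
rewrite -(@ler_pXn2r _ 2) ?nnegrE// ?mulr_ge0 ?sqrtr_ge0 ?powR_ge0//.
rewrite exprMn sqr_sqrtr// powR_sqr ?(ltW w0)// mulrN mulfV ?pnatr_eq0// powR_inv1 ?(ltW w0)//.
rewrite real_normK ?num_real//.
apply: (@le_trans _ _ (avg w (fun x => p x * p x) u)); first by move: h2; rewrite /cov; lra.
rewrite /avg ler_pM2r ?invr_gt0//.
by move: h1; rewrite /int01 /=; under [X in Rintegral _ _ X]eq_fun do rewrite -expr2; lra.
Qed.

(** The scale w is the interpolation parameter: a small w makes the energy term small at the price
    of a large factor on the L^2 norm. *)
Lemma sup_le p E u w : 0 < w -> w <= 12^-1 -> continuous p -> periodic p -> 0 < E ->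
  (forall eps, 0 < eps -> En eps p <= E) ->
  `|p u| <= morrey_cst * Num.sqrt E * w `^ ((alpha - 2) / 2)
            + Num.sqrt (int01 (fun x => p x ^+ 2)) * w `^ (- 2^-1).
Proof.
move=> w0 w12 cp pp E0 hE; have [h _] := morrey_scalar cp pp E0 hE.
have w1 : w <= 1 by lra.
have := h u w w0 w12; have := avg_sq_le u w0 w1 cp pp.
have := ler_distD (avg w p u) (p u) 0; rewrite !subr0 (distrC (p u)); lra.
Qed.

(** [scale_slice] supplies a w in [2 d, 3 d] with small integrated variance, and variance controls
    increments of step d <= w / 2. *)
Lemma L2_modulus_le p E d : 0 < d -> d <= 6^-1 -> continuous p -> periodic p -> 0 < E ->
  (forall eps, 0 < eps -> En eps p <= E) ->
  int01 (fun x => (p (x + d) - p x) ^+ 2) <= 16 * 3 `^ alpha * E * d `^ (alpha - 1).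
Proof.
move=> d0 d6 cp pp E0 hE.
have [|||w /andP[w1 w2] hi] := @scale_slice (fun u w => var w p u) E d d0 d6 E0.
- exact: adm_cov.
- by move=> u w /WP[]; [lra|move=> w0 _ _; exact: var_ge0].
- by apply: hE; lra.
by apply: (le_trans (int01_sqdiff_le d0 w1 cp pp)); lra.
Qed.

End Energy.

(** * Steklov smoothing and repeated integration by parts *)

Section Smoothing.
Variables (R : realType).
Implicit Types (p q dp dq : R -> R) (eps c d r u v w eta M beta : R).

(** Once its mean is removed, q has a periodic primitive and integration by parts moves the average
    across; the mean contributes equally to both sides. *)
Lemma avg_adjoint w p q : w != 0 -> continuous p -> periodic p -> continuous q -> periodic q ->
  int01 (fun u => avg w p u * q u) = int01 (fun u => p u * avg (- w) q u).
Proof.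
move=> w0 cp pp cq pq.
pose m := int01 q; pose q0 x := q x - m.
have cq0 : continuous q0 by apply: cts_sub => //; exact: cts_cst.
have pq0 : periodic q0 by move=> x; rewrite /q0 pq.
have hQ := isD_prim cq0; have cQ := isD_continuous hQ.
have i0 : int01 q0 = 0 by rewrite int01B//; [rewrite int01_cst subrr|exact: cts_cst].
have pQ : periodic (prim q0).
  by move=> x; have := prim_period hQ cq0 pq0 x; rewrite i0 => /eqP; rewrite subr_eq0 => /eqP.
have ca := cts_avg w cp; have pa := periodic_avg w cp pp.
have caq : continuous (avg (- w) q) by exact: cts_avg.
have hq x : q x = q0 x + m by rewrite /q0 subrK.
have qE : q = (fun x => q0 x + m) by apply/funext.
have aqE u : avg (- w) q u = w^-1 * (prim q0 u - prim q0 (u - w)) + m.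
  rewrite qE avgD//; last exact: cts_cst.
  rewrite avg_cst ?oppr_eq0// /avg; congr (_ + _).
  by field.
have -> : int01 (fun u => avg w p u * q u) = int01 (fun u => avg w p u * q0 u) + m * int01 p.
  rewrite -(int01_avg w0 cp pp) -int01Z// -int01D; [|exact: cts_mul|exact: cts_scale].
  by apply: eq_Rintegral => u _; rewrite hq; ring.
have -> : int01 (fun u => p u * avg (- w) q u) =
    w^-1 * int01 (fun u => p u * (prim q0 u - prim q0 (u - w))) + m * int01 p.
  have c1 : continuous (fun u => p u * (prim q0 u - prim q0 (u - w))).
    by apply: cts_mul => //; apply: cts_sub => //; exact: cts_shift.
  rewrite -!int01Z// -int01D; [|exact: cts_scale|exact: cts_scale].
  by apply: eq_Rintegral => u _; rewrite aqE; ring.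
congr (_ + _).
have cd : continuous (fun u => (p (u + w) - p u) / w).
  have := cts_scale w^-1 (cts_sub (cts_shift w cp) cp).
  by under eq_fun do rewrite mulrC.
have := int01_IBP hQ (isD_avg_quot w cp) cq0 cd pQ pa.
under eq_fun do rewrite mulrC; move=> ->.
transitivity (- (w^-1 * int01 (fun u => prim q0 u * p (u + w) - prim q0 u * p u))).
  rewrite -int01Z; last by apply: cts_sub; apply: cts_mul => //; exact: cts_shift.
  by congr (- _); apply: eq_Rintegral => u _; ring.
rewrite -mulrN; congr (_ * _).
rewrite int01B; [|by apply: cts_mul => //; exact: cts_shift|exact: cts_mul].
under [X in _ = int01 X]eq_fun do rewrite mulrBr.
rewrite int01B; [|exact: cts_mul|by apply: cts_mul => //; exact: cts_shift].
rewrite -(int01_shift w (p := fun u => p u * prim q0 (u - w))); last 2 first.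
- by apply: cts_mul => //; exact: cts_shift.
- by move=> x; rewrite pp addrAC pQ.
rewrite opprB; congr (_ - _); apply: eq_Rintegral => u _; first exact: mulrC.
by rewrite addrK mulrC.
Qed.

Lemma avg_avg v w p u : continuous p -> avg w (avg v p) u = avg v (avg w p) u.
Proof.
move=> cp; have h := isD_prim cp; have H := isD_prim (isD_continuous h).
have D c : isD (fun x => c^-1 * (prim (prim p) (x + c) - prim (prim p) x)) (avg c p).
  by apply: isD_ext (isDZ c^-1 (isDB (isD_shift c H) H)) => // x; rewrite mulrC.
rewrite (avgE _ _ (D v) (cts_avg v cp)) (avgE _ _ (D w) (cts_avg w cp)).
by rewrite (addrAC u v w); ring.
Qed.

(** The interval is centred at u: the adjoint of averaging over [u, u + w] averages over [u - w, u],
    so centring is what makes the operator self-adjoint. *)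
Definition stek eta p u := avg (2 * eta) p (u - eta).

Lemma cts_stek eta p : continuous p -> continuous (stek eta p).
Proof. by move=> cp; apply: (cts_shift (- eta)); exact: cts_avg. Qed.

Lemma periodic_stek eta p : continuous p -> periodic p -> periodic (stek eta p).
Proof. by move=> cp pp x; rewrite /stek addrAC periodic_avg. Qed.

Lemma stek_norm_le eta p C : eta != 0 -> continuous p -> (forall x, `|p x| <= C) ->
  forall u, `|stek eta p u| <= C.
Proof. by move=> e0 cp h u; apply: avg_norm_le => //; rewrite mulf_neq0// pnatr_eq0. Qed.

Lemma stekB eta p q u : continuous p -> continuous q ->
  stek eta (fun x => p x - q x) u = stek eta p u - stek eta q u.
Proof. by move=> cp cq; rewrite /stek avgB. Qed.

Lemma avg_stek w eta p u : continuous p -> avg w (stek eta p) u = stek eta (avg w p) u.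
Proof.
move=> cp; rewrite /stek (avg_shift w _ (- eta) (p := avg (2 * eta) p)); last exact: cts_avg.
exact: avg_avg.
Qed.

Lemma stek_adjoint eta p q : eta != 0 ->
  continuous p -> periodic p -> continuous q -> periodic q ->
  int01 (fun u => stek eta p u * q u) = int01 (fun u => p u * stek eta q u).
Proof.
move=> e0 cp pp cq pq; have e20 : 2 * eta != 0 by rewrite mulf_neq0// pnatr_eq0.
have cqe := cts_shift eta cq.
have pqe : periodic (fun x => q (x + eta)) by move=> x; rewrite addrAC pq.
transitivity (int01 (fun u => avg (2 * eta) p u * q (u + eta))).
  rewrite -[RHS](int01_shift (- eta)); last 2 first.
  - by apply: cts_mul => //; exact: cts_avg.
  - by move=> x; rewrite periodic_avg// pqe.
  by apply: eq_Rintegral => u _; rewrite subrK.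
rewrite (avg_adjoint e20 cp pp cqe pqe); apply: eq_Rintegral => u _; congr (_ * _).
rewrite avg_shift// /stek /avg.
rewrite (_ : u + eta + - (2 * eta) = u - eta); last by ring.
rewrite (_ : u - eta + 2 * eta = u + eta); last by ring.
by field.
Qed.

Lemma isD_stek_quot eta p : continuous p ->
  isD (stek eta p) (fun u => (2 * eta)^-1 * (p (u + eta) - p (u - eta))).
Proof.
move=> cp; apply: isD_ext (isD_shift (- eta) (isD_avg_quot (2 * eta) cp)) => // u.
by rewrite (_ : u - eta + 2 * eta = u + eta); [ring|ring].
Qed.

Lemma stek_close eta p M beta r0 : 0 < eta -> eta <= r0 -> 0 < beta -> 0 <= M -> continuous p ->
  (forall u r, 0 < r -> r <= r0 -> `|p (u + r) - p u| <= M * r `^ beta) ->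
  forall u, `|stek eta p u - p u| <= M * eta `^ beta.
Proof.
move=> e0 er b0 M0 cp H u; have lt : u - eta < u - eta + 2 * eta by lra.
have [c /andP[c1 c2] hc] := isD_MVT (isD_prim cp) lt.
have -> : stek eta p u = p c.
  rewrite /stek /avg hc (_ : u - eta + 2 * eta - (u - eta) = 2 * eta); last by ring.
  by field; rewrite gt_eqF.
have mono r : 0 <= r -> r <= eta -> M * r `^ beta <= M * eta `^ beta.
  move=> r0' re; apply: ler_wpM2l => //.
  by apply: ge0_ler_powR; rewrite ?nnegrE; lra.
have [uc|cu|->] := ltgtP u c; last by rewrite subrr normr0 mulr_ge0 ?powR_ge0.
  have := H u (c - u); rewrite (_ : u + (c - u) = c); last by ring.
  by move=> /(_ _ _)/le_trans; apply; [lra|lra|apply: mono; lra].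
have := H c (u - c); rewrite (_ : c + (u - c) = u); last by ring.
by rewrite distrC => /(_ _ _)/le_trans; apply; [lra|lra|apply: mono; lra].
Qed.

Lemma iter_stek_cp k eta p : continuous p -> periodic p ->
  continuous (iter k (stek eta) p) /\ periodic (iter k (stek eta) p).
Proof.
move=> cp pp; elim: k => [//|k [IH1 IH2]]; split; [exact: cts_stek|exact: periodic_stek].
Qed.

Lemma iter_stek_norm_le k eta p C : eta != 0 -> continuous p -> periodic p ->
  (forall x, `|p x| <= C) -> forall u, `|iter k (stek eta) p u| <= C.
Proof.
move=> e0 cp pp h; elim: k => [//|k IH]; apply: stek_norm_le => //.
by have [] := iter_stek_cp k eta cp pp.
Qed.

Lemma iter_stek_close k eta p M beta r0 : 0 < eta -> eta <= r0 -> 0 < beta -> 0 <= M ->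
  continuous p -> periodic p ->
  (forall u r, 0 < r -> r <= r0 -> `|p (u + r) - p u| <= M * r `^ beta) ->
  forall u, `|iter k (stek eta) p u - p u| <= k%:R * (M * eta `^ beta).
Proof.
move=> e0 er b0 M0 cp pp H; elim: k => [|k IH] u; first by rewrite subrr normr0 mul0r.
have [c1 p1] := iter_stek_cp k eta cp pp.
have en0 : eta != 0 by rewrite gt_eqF.
have h1 : `|stek eta (fun x => iter k (stek eta) p x - p x) u| <= k%:R * (M * eta `^ beta).
  by apply: stek_norm_le => //; exact: cts_sub.
have h2 := stek_close e0 er b0 M0 cp H u.
rewrite stekB// in h1.
have := ler_distD (stek eta p u) (iter k.+1 (stek eta) p u) (p u).
by rewrite iterS -natr1 mulrDl mul1r; lra.
Qed.

Lemma iter_stek_adjoint k eta p q : eta != 0 ->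
  continuous p -> periodic p -> continuous q -> periodic q ->
  int01 (fun u => iter k (stek eta) p u * q u) = int01 (fun u => p u * iter k (stek eta) q u).
Proof.
move=> e0 cp pp; elim: k q => [//|k IH] q cq pq.
have [c1 p1] := iter_stek_cp k eta cp pp.
rewrite iterS (stek_adjoint e0 c1 p1 cq pq) IH; [|exact: cts_stek|exact: periodic_stek].
by rewrite iterSr.
Qed.

Lemma iter_stek_avg k w eta p : continuous p -> periodic p ->
  avg w (iter k (stek eta) p) =1 iter k (stek eta) (avg w p).
Proof.
move=> cp pp; elim: k => [//|k IH] u; have [c1 p1] := iter_stek_cp k eta cp pp.
rewrite iterS avg_stek//; congr (stek _ _ _).
exact/funext.
Qed.

(** Names the successive derivatives, so that an m-fold integration by parts can index them; [Ck]
    below is the existential form, convenient for closure under shifts, differences and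
    smoothing. *)
Definition dseq m (D : nat -> R -> R) :=
  (forall l, (l < m)%N -> isD (D l) (D l.+1)) /\
  (forall l, (l <= m)%N -> continuous (D l) /\ periodic (D l)).

Fixpoint Ck k p : Prop := [/\ continuous p, periodic p &
  if k is k'.+1 then exists2 dp, isD p dp & Ck k' dp else True].

Lemma Ck_cp k p : Ck k p -> continuous p /\ periodic p.
Proof. by case: k => [|k] []. Qed.

Lemma Ck_shift k p c : Ck k p -> Ck k (fun x => p (x + c)).
Proof.
elim: k p => [|k IH] p /= [cp pp h].
  by split=> //; [exact: cts_shift|move=> x; rewrite addrAC pp].
split; [exact: cts_shift|by move=> x; rewrite addrAC pp|].
by case: h => dp hd cd; exists (fun x => dp (x + c)); [exact: isD_shift|exact: IH].
Qed.

Lemma Ck_sub k p q : Ck k p -> Ck k q -> Ck k (fun x => p x - q x).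
Proof.
elim: k p q => [|k IH] p q /= [cp pp hp] [cq pq hq].
  by split=> //; [exact: cts_sub|move=> x; rewrite pp pq].
split; [exact: cts_sub|by move=> x; rewrite pp pq|].
case: hp => dp hp cdp; case: hq => dq hq cdq.
by exists (fun x => dp x - dq x); [exact: isDB|exact: IH].
Qed.

Lemma Ck_scale k c p : Ck k p -> Ck k (fun x => c * p x).
Proof.
elim: k p => [|k IH] p /= [cp pp h].
  by split=> //; [exact: cts_scale|move=> x; rewrite pp].
split; [exact: cts_scale|by move=> x; rewrite pp|].
by case: h => dp hd cd; exists (fun x => c * dp x); [exact: isDZ|exact: IH].
Qed.

Lemma Ck_stek k eta p : Ck k p -> Ck k.+1 (stek eta p).
Proof.
move=> h; have [cp pp] := Ck_cp h.
split; [exact: cts_stek|exact: periodic_stek|].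
exists (fun u => (2 * eta)^-1 * (p (u + eta) - p (u - eta))); first exact: isD_stek_quot.
by apply: Ck_scale; apply: Ck_sub; exact: Ck_shift.
Qed.

Lemma Ck_iter_stek k j eta p : Ck k p -> Ck (j + k) (iter j (stek eta) p).
Proof. by move=> h; elim: j => [//|j IH]; rewrite addSn iterS; exact: Ck_stek. Qed.

Lemma Ck_dseq k p : Ck k p -> exists2 D, D 0%N = p & dseq k D.
Proof.
elim: k p => [|k IH] p /= [cp pp h].
  exists (fun=> p) => //; split=> // l; by rewrite ltn0.
case: h => dp hd /IH[D D0 [hD cD]].
exists (fun l => if l is l'.+1 then D l' else p) => //; split=> -[|l] //=.
- by rewrite D0.
- exact: hD.
- exact: cD.
Qed.

Lemma dseq_Ck k D : dseq k D -> Ck k (D 0%N).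
Proof.
elim: k D => [|k IH] D [hD cD] /=.
  by have [] := cD 0%N isT; split.
have [c0 p0] := cD 0%N isT; split=> //.
exists (D 1%N); first exact: hD.
by apply: (IH (fun l => D l.+1)); split=> l hl; [exact: (hD l.+1)|exact: (cD l.+1)].
Qed.

Lemma dseq_IBP m X Q : dseq m X -> dseq m Q ->
  int01 (fun u => X 0%N u * Q m u) = (-1) ^+ m * int01 (fun u => X m u * Q 0%N u).
Proof.
move=> [hX cX] [hQ cQ].
suff H l : (l <= m)%N ->
    int01 (fun u => X 0%N u * Q m u) = (-1) ^+ l * int01 (fun u => X l u * Q (m - l)%N u).
  by rewrite (H m)// subnn.
elim: l => [_|l IH lm]; first by rewrite subn0 expr0 mul1r.
rewrite (IH (ltnW lm)) exprS -mulrA mulN1r -mulrN; congr (_ * _).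
have lt : (m - l.+1 < m)%N by rewrite ltn_subrL ltn0Sn (leq_ltn_trans _ lm).
have e : (m - l = (m - l.+1).+1)%N by rewrite subnSK.
rewrite (@int01_IBP _ (X l) (Q (m - l.+1)%N) (X l.+1) (Q (m - l)%N)) ?opprK//.
- exact: hX.
- by rewrite e; exact: hQ.
- by have [] := cX _ lm.
- by have [] := cQ (m - l)%N (leq_subr _ _).
- by have [] := cX _ (ltnW lm).
- by have [] := cQ _ (ltnW lt).
Qed.

End Smoothing.

(** * Real powers on intervals bounded away from zero *)

Section PowR.
Variable R : realType.
Implicit Types (a b c x y r : R) (p dp : R -> R).

(** The power is monotone in a direction given by the sign of r; the sum of the endpoint values
    serves both cases. *)
Lemma powR_le_endpoints a b x r : 0 < a -> a <= x -> x <= b -> x `^ r <= a `^ r + b `^ r.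
Proof.
move=> a0 ax xb; have x0 : 0 < x by exact: lt_le_trans ax.
have [r0|r0] := leP 0 r.
  apply: (@le_trans _ _ (b `^ r)); last by rewrite lerDr powR_ge0.
  by apply: ge0_ler_powR; rewrite ?nnegrE//; lra.
apply: (@le_trans _ _ (a `^ r)); last by rewrite lerDl powR_ge0.
rewrite -[X in _ `^ X <= _]opprK -[X in _ <= _ `^ X]opprK powRN [leRHS]powRN.
rewrite lef_pV2 ?posrE ?powR_gt0//.
by apply: ge0_ler_powR; rewrite ?nnegrE; lra.
Qed.

Lemma powR_continuous_at x r : 0 < x -> {for x, continuous (fun y => y `^ r)}.
Proof.
move=> x0; apply: differentiable_continuous; apply/derivable1_diffP.
by have [] := is_derive1_powR r x0.
Qed.

Lemma powR_lipschitz a b x y r : 0 < a -> a <= x <= b -> a <= y <= b ->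
  `|x `^ r - y `^ r| <= `|r| * (a `^ (r - 1) + b `^ (r - 1)) * `|x - y|.
Proof.
move=> a0; wlog xy : x y / x <= y.
  move=> h hx hy; have [xy|/ltW yx] := leP x y; first exact: h.
  by rewrite distrC [`|x - y|]distrC; exact: h.
move=> /andP[ax xb] /andP[ay yb].
move: xy; rewrite le_eqVlt => /predU1P[->|xy].
  by rewrite !subrr !normr0 mulr0.
have [||c] := @MVT R (fun y => y `^ r) (fun z => r * z `^ (r - 1)) x y xy.
- by move=> z; rewrite in_itv/= => /andP[xz _]; apply: is_derive1_powR; lra.
- apply: continuous_in_subspaceT => z; rewrite inE/= in_itv/= => /andP[xz _].
  by apply: powR_continuous_at; lra.
rewrite in_itv/= => /andP[xc cy] e.
rewrite distrC e [`|x - y|]distrC !normrM -!mulrA; apply: ler_wpM2l => //.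
apply: ler_wpM2r => //; rewrite ger0_norm ?powR_ge0//.
by apply: powR_le_endpoints; lra.
Qed.

Lemma isD_powR p dp r : (forall x, 0 < p x) -> isD p dp ->
  isD (fun x => p x `^ r) (fun x => r * p x `^ (r - 1) * dp x).
Proof.
by move=> p0 h x; exact: (is_derive1_comp (f := fun y => y `^ r) (is_derive1_powR r (p0 x)) (h x)).
Qed.

Lemma cts_powR p r : (forall x, 0 < p x) -> continuous p -> continuous (fun x => p x `^ r).
Proof.
move=> p0 cp x; apply: (continuous_comp (cp x) (g := fun y => y `^ r)).
exact: powR_continuous_at.
Qed.

Lemma powRN_le x y r : 0 <= r -> 0 < x -> x <= y -> y `^ (- r) <= x `^ (- r).
Proof.
move=> r0 x0 xy; have y0 : 0 < y by exact: lt_le_trans xy.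
rewrite !powRN lef_pV2 ?posrE ?powR_gt0//.
by apply: ge0_ler_powR; rewrite ?nnegrE; lra.
Qed.

End PowR.

(** * Classes of integrands stable under products and powers *)

Section Classes.
Variables (R : realType) (alpha : R) (Zrel : R -> R -> Prop).
Hypothesis alpha_gt2 : 2 < alpha.
Hypothesis Zrel_pos : forall d z, Zrel d z -> 0 < z.
Implicit Types (p q : R -> R) (X Y : R -> R -> R) (eps c d z r u w : R).
Local Notation wt := (wt alpha).

Definition W0 w := w != 0 /\ `|w| <= 1/2.

Lemma W_W0 eps w : 0 < eps -> W eps w -> W0 w.
Proof. by move=> e0 /(WP e0)[]. Qed.

(* Zrel d z reads: the increments over d of the top derivative of the curve have size at most z,
   both uniformly and in energy.  Class A inherits the uniform bound; class I is moreover
   summable against the singular weight, together with its increments. *)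
Definition clA0 X := [/\ adm X,
  forall w, W0 w -> continuous (X^~ w) /\ periodic (X^~ w) &
  exists C, 0 <= C /\ (forall u w, W0 w -> `|X u w| <= C) /\
   (forall d z u w, Zrel d z -> W0 w -> `|X (u + d) w - X u w| <= C * z)].

Definition clI0 X := clA0 X /\ exists C, 0 <= C /\
  (forall eps, 0 < eps -> J eps (fun u w => wt w * `|X u w|) <= C) /\
  (forall d z eps, Zrel d z -> 0 < eps ->
     J eps (fun u w => wt w * `|X (u + d) w - X u w|) <= C * z).

(** The base property is imposed on X and on each of its first m derivatives in u; derivatives are
    asked for w in [W0] only, since averages degenerate at w = 0. *)
Fixpoint cl (B : (R -> R -> R) -> Prop) m X : Prop := B X /\
  if m is m'.+1 then exists2 X', (forall w, W0 w -> isD (X^~ w) (X'^~ w)) & cl B m' X'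
  else True.

Notation clA := (cl clA0).
Notation clI := (cl clI0).

Lemma cl_base B m X : cl B m X -> B X.
Proof. by case: m => [|m] []. Qed.

Lemma cl_weaken B m X : cl B m.+1 X -> cl B m X.
Proof.
elim: m X => [|m IH] X [bX]; first by move=> [X' _ _]; split.
by move=> [X' hX' cX']; split => //; exists X' => //; exact: IH.
Qed.

Lemma clA0_cst c : clA0 (fun _ _ => c).
Proof.
split; first exact: adm_cst.
  by move=> w _; split; first exact: cts_cst.
exists `|c|; split=> //; split=> // d z u w Z _.
by rewrite subrr normr0 mulr_ge0// ltW// (Zrel_pos Z).
Qed.

Lemma clA0_add X Y : clA0 X -> clA0 Y -> clA0 (fun u w => X u w + Y u w).
Proof.
move=> [aX cX [C [C0 [hC1 hC2]]]] [aY cY [D [D0 [hD1 hD2]]]].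
split; first exact: adm_add.
  move=> w w0; have [? pX] := cX w w0; have [? pY] := cY w w0.
  by split; [exact: cts_add|move=> u; rewrite pX pY].
exists (C + D); split; first exact: addr_ge0.
split=> [u w w0|d z u w Z w0].
  by rewrite (le_trans (ler_normD _ _))// lerD ?hC1 ?hD1.
rewrite (_ : _ - _ = (X (u + d) w - X u w) + (Y (u + d) w - Y u w)); last by ring.
by rewrite (le_trans (ler_normD _ _))// mulrDl lerD ?hC2 ?hD2.
Qed.

Lemma diffM_le (x x' y y' : R) : `|x' * y' - x * y| <= `|x'| * `|y' - y| + `|x' - x| * `|y|.
Proof.
rewrite (_ : _ - _ = x' * (y' - y) + (x' - x) * y); last by ring.
by rewrite (le_trans (ler_normD _ _))// !normrM.
Qed.

Lemma clA0_mul X Y : clA0 X -> clA0 Y -> clA0 (fun u w => X u w * Y u w).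
Proof.
move=> [aX cX [C [C0 [hC1 hC2]]]] [aY cY [D [D0 [hD1 hD2]]]].
split; first exact: adm_mul.
  move=> w w0; have [? pX] := cX w w0; have [? pY] := cY w w0.
  by split; [exact: cts_mul|move=> u; rewrite pX pY].
have CD : 0 <= C * D by exact: mulr_ge0.
exists (2 * (C * D)); split; first by lra.
split=> [u w w0|d z u w Z w0].
  apply: (@le_trans _ _ (C * D)); last by lra.
  by rewrite normrM ler_pM ?hC1 ?hD1.
apply: (le_trans (diffM_le _ _ _ _)).
have k1 : `|X (u + d) w| * `|Y (u + d) w - Y u w| <= C * (D * z).
  by rewrite ler_pM ?hC1 ?hD2.
have k2 : `|X (u + d) w - X u w| * `|Y u w| <= (C * z) * D.
  by rewrite ler_pM ?hC2 ?hD1.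
by lra.
Qed.

Lemma clA_cst m c : clA m (fun _ _ => c).
Proof.
elim: m c => [|m IH] c; split; try exact: clA0_cst; first by [].
by exists (fun _ _ => 0) => [w _|]; [exact: isD_cst|exact: IH].
Qed.

Lemma clA_add m X Y : clA m X -> clA m Y -> clA m (fun u w => X u w + Y u w).
Proof.
elim: m X Y => [|m IH] X Y [aX hX] [aY hY]; split; try exact: clA0_add; first by [].
case: hX => X' hX cX; case: hY => Y' hY cY.
exists (fun u w => X' u w + Y' u w); last exact: IH.
by move=> w w0; exact: isDD (hX w w0) (hY w w0).
Qed.

Lemma clA_mul m X Y : clA m X -> clA m Y -> clA m (fun u w => X u w * Y u w).
Proof.
elim: m X Y => [|m IH] X Y hX hY.
  by split=> //; apply: clA0_mul; [exact: (cl_base hX)|exact: (cl_base hY)].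
have hX0 := cl_weaken hX; have hY0 := cl_weaken hY.
move: hX hY => [aX [X' hX cX]] [aY [Y' hY cY]].
split; first exact: clA0_mul.
exists (fun u w => X' u w * Y u w + X u w * Y' u w).
  by move=> w w0; exact: isDM (hX w w0) (hY w w0).
by apply: clA_add; exact: IH.
Qed.

Lemma clA_sum m (I : Type) (s : seq I) (X : I -> R -> R -> R) :
  (forall i, clA m (X i)) -> clA m (fun u w => \sum_(i <- s) X i u w).
Proof.
move=> h; elim: s => [|i s IH].
  have -> : (fun u w => \sum_(i <- [::]) X i u w) = (fun _ _ => 0).
    by apply/funext => u; apply/funext => w; rewrite big_nil.
  exact: clA_cst.
have -> : (fun u w => \sum_(j <- i :: s) X j u w) = (fun u w => X i u w + \sum_(j <- s) X j u w).
  by apply/funext => u; apply/funext => w; rewrite big_cons.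
exact: clA_add.
Qed.

Lemma adm_diff X d : adm X -> adm (fun u w => X (u + d) w - X u w).
Proof. by move=> aX; apply: adm_sub => //; exact: adm_shift. Qed.

Lemma adm_wtn X : adm X -> adm (fun u w => wt w * `|X u w|).
Proof. by move=> aX; apply: adm_wtM => //; exact: adm_norm. Qed.

Lemma clI0_add X Y : clI0 X -> clI0 Y -> clI0 (fun u w => X u w + Y u w).
Proof.
move=> [aX [C [C0 [hC1 hC2]]]] [aY [D [D0 [hD1 hD2]]]].
split; first exact: clA0_add.
have [mX _ _] := aX; have [mY _ _] := aY.
exists (C + D); split; first exact: addr_ge0.
split=> [eps e0|d z eps Z e0].
  apply: (@le_trans _ _ (J eps (fun u w => wt w * `|X u w| + wt w * `|Y u w|))).
    apply: J_le => //; first by apply: adm_wtn; exact: adm_add.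
      by apply: adm_add; exact: adm_wtn.
    by move=> u w _; rewrite -mulrDr ler_wpM2l ?wt_ge0// ler_normD.
  by rewrite JD//; [rewrite lerD ?hC1 ?hD1|exact: adm_wtn|exact: adm_wtn].
have mdX := adm_diff d mX; have mdY := adm_diff d mY.
apply: (@le_trans _ _ (J eps (fun u w => wt w * `|X (u + d) w - X u w| + wt w * `|Y (u + d) w - Y u w|))).
  apply: J_le => //; first by apply: adm_wtn; exact: (adm_diff d (adm_add mX mY)).
    by apply: adm_add; exact: adm_wtn.
  move=> u w _; rewrite -mulrDr ler_wpM2l ?wt_ge0//.
  rewrite (_ : _ - _ = (X (u + d) w - X u w) + (Y (u + d) w - Y u w)); last by ring.
  exact: ler_normD.
rewrite JD//; [|exact: adm_wtn|exact: adm_wtn].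
by rewrite mulrDl lerD ?hC2 ?hD2.
Qed.

(** One summable factor is enough: in the Leibniz splitting of an increment, the bounds on the class
    A factor come out of the integral. Class I is thus a module over class A. *)
Lemma clI0_mulA X Y : clA0 X -> clI0 Y -> clI0 (fun u w => X u w * Y u w).
Proof.
move=> aX [aY [D [D0 [hD1 hD2]]]].
split; first exact: clA0_mul.
have [mX _ [C [C0 [hC1 hC2]]]] := aX; have [mY _ _] := aY.
have CD : 0 <= C * D by exact: mulr_ge0.
exists (2 * (C * D)); split; first by lra.
split=> [eps e0|d z eps Z e0].
  apply: (@le_trans _ _ (J eps (fun u w => C * (wt w * `|Y u w|)))).
    apply: J_le => //; first by apply: adm_wtn; exact: adm_mul.
      by apply: adm_scale; exact: adm_wtn.
    move=> u w hw; rewrite normrM mulrCA; apply: ler_wpM2r; last exact: hC1 (W_W0 e0 hw).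
    by rewrite mulr_ge0 ?wt_ge0.
  rewrite JZ//; last exact: adm_wtn.
  by have := ler_wpM2l C0 (hD1 eps e0); lra.
have mdY := adm_diff d mY; have z0 := Zrel_pos Z.
apply: (@le_trans _ _ (J eps (fun u w => C * (wt w * `|Y (u + d) w - Y u w|) + (C * z) * (wt w * `|Y u w|)))).
  apply: J_le => //; first by apply: adm_wtn; exact: (adm_diff d (adm_mul mX mY)).
    by apply: adm_add; apply: adm_scale; exact: adm_wtn.
  move=> u w hw; have w0 := W_W0 e0 hw.
  rewrite mulrCA [C * z * _]mulrCA -mulrDr; apply: ler_wpM2l; first exact: wt_ge0.
  apply: (le_trans (diffM_le _ _ _ _)); apply: lerD.
    by apply: ler_wpM2r => //; exact: hC1.
  by apply: ler_wpM2r => //; exact: hC2.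
rewrite JD//; [|by apply: adm_scale; exact: adm_wtn..].
rewrite !JZ//; [|exact: adm_wtn..].
have Cz : 0 <= C * z by rewrite mulr_ge0// ltW.
have := ler_wpM2l C0 (hD2 d z eps Z e0); have := ler_wpM2l Cz (hD1 eps e0).
by lra.
Qed.

Lemma clI_add m X Y : clI m X -> clI m Y -> clI m (fun u w => X u w + Y u w).
Proof.
elim: m X Y => [|m IH] X Y [aX hX] [aY hY]; split; try exact: clI0_add; first by [].
case: hX => X' hX cX; case: hY => Y' hY cY.
exists (fun u w => X' u w + Y' u w); last exact: IH.
by move=> w w0; exact: isDD (hX w w0) (hY w w0).
Qed.

Lemma clI_mulA m X Y : clA m X -> clI m Y -> clI m (fun u w => X u w * Y u w).
Proof.
elim: m X Y => [|m IH] X Y hX hY.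
  by split=> //; apply: clI0_mulA; [exact: (cl_base hX)|exact: (cl_base hY)].
have hX0 := cl_weaken hX; have hY0 := cl_weaken hY.
move: hX hY => [aX [X' hX cX]] [aY [Y' hY cY]].
split; first exact: clI0_mulA.
exists (fun u w => X' u w * Y u w + X u w * Y' u w).
  by move=> w w0; exact: isDM (hX w w0) (hY w w0).
by apply: clI_add; exact: IH.
Qed.

Lemma clI0_zero : clI0 (fun _ _ => 0).
Proof.
have Z0 eps : J eps (fun u w : R => wt w * `|0 : R|) <= 0.
  rewrite (@J_eq _ _ _ (fun _ _ => 0)) => [|u w _]; last by rewrite normr0 mulr0.
  by rewrite /J /Rintegral integral0.
split; first exact: clA0_cst.
exists 0; split=> //; split=> [eps _|d z eps _ _]; first exact: Z0.
by rewrite subrr mul0r; exact: Z0.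
Qed.

Lemma clI_zero m : clI m (fun _ _ => 0).
Proof.
elim: m => [|m IH]; split; try exact: clI0_zero; first by [].
by exists (fun _ _ => 0) => // w _; exact: isD_cst.
Qed.

Lemma clI_sum m (I : Type) (s : seq I) (X : I -> R -> R -> R) :
  (forall i, clI m (X i)) -> clI m (fun u w => \sum_(i <- s) X i u w).
Proof.
move=> h; elim: s => [|i s IH].
  have -> : (fun u w => \sum_(i <- [::]) X i u w) = (fun _ _ => 0).
    by apply/funext => u; apply/funext => w; rewrite big_nil.
  exact: clI_zero.
have -> : (fun u w => \sum_(j <- i :: s) X j u w) = (fun u w => X i u w + \sum_(j <- s) X j u w).
  by apply/funext => u; apply/funext => w; rewrite big_cons.
exact: clI_add.
Qed.

Variables (G V : R -> R -> R) (c0 : R).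
Hypothesis c0_gt0 : 0 < c0.
Hypothesis G_ge : forall u w, W0 w -> c0 <= G u w.
Hypothesis GV : forall u w, W0 w -> G u w = 1 - V u w.

Lemma adm_powR r : adm G -> adm (fun u w => G u w `^ r).
Proof.
move=> [mG bG]; split.
  exact: (measurableT_comp (measurable_powR r) mG).
move=> e e0; have [C hC] := bG e e0; exists (c0 `^ r + C `^ r) => u w hw; have w0 := W_W0 e0 hw.
rewrite ger0_norm ?powR_ge0//; apply: powR_le_endpoints => //; first exact: G_ge.
by apply: (le_trans (ler_norm _)); exact: hC.
Qed.

Lemma clA0_powR r : clA0 G -> clA0 (fun u w => G u w `^ r).
Proof.
move=> aG; split; first by apply: adm_powR; case: aG.
  move=> w w0; have [_ /(_ w w0)[cG pG] _] := aG; split.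
    by apply: cts_powR => // u; exact: (lt_le_trans c0_gt0 (G_ge u w0)).
  by move=> u; rewrite pG.
have [_ _ [C [C0 [hC1 hC2]]]] := aG.
have GC u w : W0 w -> c0 <= G u w <= C.
  by move=> w0; rewrite G_ge//=; apply: (le_trans (ler_norm _)); exact: hC1.
have L0 : 0 <= `|r| * (c0 `^ (r - 1) + C `^ (r - 1)) by rewrite mulr_ge0// addr_ge0 ?powR_ge0.
have M0 : 0 <= c0 `^ r + C `^ r by rewrite addr_ge0 ?powR_ge0.
have LC := mulr_ge0 L0 C0.
exists (c0 `^ r + C `^ r + `|r| * (c0 `^ (r - 1) + C `^ (r - 1)) * C); split; first exact: addr_ge0.
split=> [u w w0|d z u w Z w0].
  have /andP[g1 g2] := GC u w w0; rewrite ger0_norm ?powR_ge0//.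
  by apply: (le_trans (powR_le_endpoints r c0_gt0 g1 g2)); rewrite lerDl.
apply: (le_trans (powR_lipschitz r c0_gt0 (GC _ _ w0) (GC _ _ w0))).
have := ler_wpM2l L0 (hC2 d z u w Z w0).
by have := mulr_ge0 M0 (ltW (Zrel_pos Z)); lra.
Qed.

Lemma clA_powR m r : clA m G -> clA m (fun u w => G u w `^ r).
Proof.
elim: m r => [|m IH] r hG; first by split=> //; apply: clA0_powR; exact: (cl_base hG).
have hG0 := cl_weaken hG; move: hG => [aG [G' hG cG]].
split; first exact: clA0_powR.
exists (fun u w => r * G u w `^ (r - 1) * G' u w).
  move=> w w0; apply: isD_powR; last exact: hG.
  by move=> u; exact: (lt_le_trans c0_gt0 (G_ge u w0)).
by apply: clA_mul => //; apply: clA_mul; [exact: clA_cst|exact: IH].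
Qed.

(** On an interval away from 0 the r-th power is Lipschitz, so the distance of G^r from its value 1
    at G = 1 is O(|V|), and V is summable. *)
Lemma clI0_powR r : clA0 G -> clI0 V -> clI0 (fun u w => G u w `^ r - 1).
Proof.
move=> aG [aV [D [D0 [hD1 hD2]]]].
have [mV _ _] := aV.
have aP : clA0 (fun u w => G u w `^ r - 1) by apply: clA0_add; [exact: clA0_powR|exact: clA0_cst].
split => //; have [mP _ _] := aP.
have [_ _ [C [C0 [hC1 hC2]]]] := aG.
have GC u w : W0 w -> c0 <= G u w <= C + 1 + c0.
  move=> w0; rewrite G_ge//=; have := le_trans (ler_norm _) (hC1 u w w0).
  by have := c0_gt0; lra.
(* The range of G is enlarged to contain 1, the point of comparison. *)
pose a := Num.min c0 1; pose b := C + 1 + c0.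
have a0 : 0 < a by rewrite lt_min c0_gt0 ltr01.
have GC' u w : W0 w -> a <= G u w <= b.
  by move=> w0; have /andP[h1 ->] := GC u w w0; rewrite andbT (le_trans _ h1)// ge_min lexx.
have ab1 : a <= 1 <= b by rewrite /a ge_min lexx orbT/= /b; move: c0_gt0 C0; lra.
pose L := `|r| * (a `^ (r - 1) + b `^ (r - 1)).
have L0 : 0 <= L by rewrite mulr_ge0// addr_ge0 ?powR_ge0.
exists (L * D); split; first exact: mulr_ge0.
split=> [eps e0|d z eps Z e0].
  apply: (@le_trans _ _ (J eps (fun u w => L * (wt w * `|V u w|)))).
    apply: J_le => //; first exact: adm_wtn.
      by apply: adm_scale; exact: adm_wtn.
    move=> u w hw; have w0 := W_W0 e0 hw; rewrite mulrCA; apply: ler_wpM2l; first exact: wt_ge0.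
    have := powR_lipschitz r a0 (GC' u w w0) ab1; rewrite powR1 -/L.
    by rewrite [G u w - 1](_ : _ = - V u w) ?normrN// GV//; ring.
  rewrite JZ//; last exact: adm_wtn.
  by apply: ler_wpM2l => //; exact: hD1.
have mdV := adm_diff d mV.
apply: (@le_trans _ _ (J eps (fun u w => L * (wt w * `|V (u + d) w - V u w|)))).
  apply: J_le => //; first by apply: adm_wtn; exact: adm_diff.
    by apply: adm_scale; exact: adm_wtn.
  move=> u w hw; have w0 := W_W0 e0 hw; rewrite mulrCA; apply: ler_wpM2l; first exact: wt_ge0.
  have := powR_lipschitz r a0 (GC' (u + d) w w0) (GC' u w w0); rewrite -/L.
  rewrite [G (u + d) w - G u w](_ : _ = - (V (u + d) w - V u w)) ?normrN; last by rewrite !GV//; ring.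
  by rewrite (_ : G (u + d) w `^ r - 1 - _ = G (u + d) w `^ r - G u w `^ r)//; ring.
rewrite JZ//; last exact: adm_wtn.
by rewrite -[leRHS]mulrA; apply: ler_wpM2l => //; exact: hD2.
Qed.

(** The derivative is - r G^(r-1) V': summability is carried by V', so for the factor G^(r-1) class
    A is enough. *)
Lemma clI_powR m r : clA m G -> clI m V -> clI m (fun u w => G u w `^ r - 1).
Proof.
case: m => [|m] hG hV.
  by split=> //; apply: clI0_powR; [exact: (cl_base hG)|exact: (cl_base hV)].
have hG0 := cl_weaken hG; have bG := cl_base hG.
move: hV => [aV [V' hV cV]].
split; first exact: clI0_powR.
exists (fun u w => (r * G u w `^ (r - 1) * (-1)) * V' u w).
  move=> w w0.
  have hGV : isD (G^~ w) (fun u => - V' u w).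
    have := isDB (@isD_cst R 1) (hV w w0); apply: isD_ext => u; last by rewrite sub0r.
    by rewrite GV.
  have p0 u : 0 < G u w by exact: (lt_le_trans c0_gt0 (G_ge u w0)).
  apply: isD_ext (isDB (isD_powR r p0 hGV) (@isD_cst R 1)) => // u.
  by rewrite subr0; ring.
apply: clI_mulA => //; apply: clA_mul; last exact: clA_cst.
by apply: clA_mul; [exact: clA_cst|exact: clA_powR].
Qed.

Lemma clI_dseq m X : clI m X -> exists Xs : nat -> R -> R -> R,
  [/\ Xs 0%N = X, (forall w, W0 w -> dseq m (fun l u => Xs l u w)) & clI0 (Xs m)].
Proof.
elim: m X => [|m IH] X [bX].
  move=> _; exists (fun=> X); split=> // w w0; split=> // l _.
  by have [[_ h _] _] := bX; exact: h.
move=> [X' hX' /IH[Xs [X0 hXs bXs]]].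
exists (fun l => if l is l'.+1 then Xs l' else X); split=> // w w0.
have [h1 h2] := hXs w w0; split=> -[|l] //=.
- by move=> _; rewrite X0; exact: hX'.
- exact: h1.
- by move=> _; have [[_ h _] _] := bX; exact: h.
- exact: h2.
Qed.

End Classes.

(** * Membership of the nonlinear terms in the classes *)

Section Apriori.
Variables (R : realType) (n : nat) (alpha lambda : R) (m : nat)
  (F : 'I_n -> nat -> R -> R) (c0 C1 : R).
Hypothesis alpha_gt2 : 2 < alpha.
Hypothesis alpha_lt3 : alpha < 3.
Hypothesis lambda_gt0 : 0 < lambda.
Implicit Types (p q s : R -> R) (X Y : R -> R -> R) (eps c d z r u w y : R).
Local Notation wt := (wt alpha).
Local Notation En := (En alpha).

Hypothesis dF : forall i, dseq m (F i).
Hypothesis unitF : forall u, \sum_i F i 0%N u ^+ 2 = 1.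
Hypothesis C1_gt0 : 0 < C1.
Hypothesis EF : forall i l eps, (l <= m)%N -> 0 < eps -> En eps (F i l) <= C1.
Hypothesis lowE : forall i l d eps, (l < m)%N -> 0 < d -> d <= 1 -> 0 < eps ->
  En eps (fun x => F i l (x + d) - F i l x) <= C1 * d ^+ 2.
Hypothesis lowS : forall i l d u, (l < m)%N -> 0 < d -> d <= 1 ->
  `|F i l (u + d) - F i l u| <= C1 * d.

Definition chordsq u w := \sum_i avg w (F i 0%N) u ^+ 2.

Hypothesis c0_gt0 : 0 < c0.
Hypothesis chordsq_ge : forall u w, W0 w -> c0 <= chordsq u w.

(** The condition d <= z lets the derivatives of order below m, whose increments are already O(d),
    obey the same bounds as the top one. *)
Definition Zrel d z := [/\ 0 < d, d <= 1, d <= z,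
  forall i u, `|F i m (u + d) - F i m u| <= z &
  forall i eps, 0 < eps -> En eps (fun x => F i m (x + d) - F i m x) <= z ^+ 2].

Local Notation clA := (cl (clA0 Zrel)).
Local Notation clI := (cl (clI0 alpha Zrel)).

Lemma Zrel_pos d z : Zrel d z -> 0 < z.
Proof. by case=> d0 _ dz _ _; exact: lt_le_trans dz. Qed.

Lemma cF i l : (l <= m)%N -> continuous (F i l).
Proof. by move=> h; have [_ /(_ l h)[]] := dF i. Qed.

Lemma pF i l : (l <= m)%N -> periodic (F i l).
Proof. by move=> h; have [_ /(_ l h)[]] := dF i. Qed.

Arguments cF i {l} _ _.
Arguments pF i {l} _ _.

Lemma cts_diff p d : continuous p -> continuous (fun x => p (x + d) - p x).
Proof. by move=> cp; apply: cts_sub => //; exact: cts_shift. Qed.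

Arguments cts_diff {p} d _ _.

Lemma periodic_diff p d : periodic p -> periodic (fun x => p (x + d) - p x).
Proof. by move=> pp x; rewrite addrAC !pp. Qed.

Arguments periodic_diff {p} d _ _.

Lemma diffF_le i l d z u : (l <= m)%N -> Zrel d z ->
  `|F i l (u + d) - F i l u| <= (C1 + 1) * z.
Proof.
move=> lm [d0 d1 dz h _]; have c1 := C1_gt0.
have z0 : 0 < z by exact: lt_le_trans dz.
have cz := mulr_ge0 (ltW C1_gt0) (ltW z0).
move: lm; rewrite leq_eqVlt => /predU1P[->|lm]; first by have := h i u; lra.
by have := lowS i u lm d0 d1; have := ler_wpM2l (ltW C1_gt0) dz; lra.
Qed.

Lemma diffF_En i l d z eps : (l <= m)%N -> Zrel d z -> 0 < eps ->
  En eps (fun x => F i l (x + d) - F i l x) <= (C1 + 1) * z ^+ 2.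
Proof.
move=> lm [d0 d1 dz _ h] e0; have c1 := C1_gt0.
have z0 : 0 < z by exact: lt_le_trans dz.
have z2 := sqr_ge0 z; have cz := mulr_ge0 (ltW C1_gt0) z2.
move: lm; rewrite leq_eqVlt => /predU1P[->|lm]; first by have := h i eps e0; lra.
have d2z2 : d ^+ 2 <= z ^+ 2 by rewrite -subr_ge0 subr_sqr; apply: mulr_ge0; lra.
by have := lowE i lm d0 d1 e0; have := ler_wpM2l (ltW C1_gt0) d2z2; lra.
Qed.

Lemma clA0_F i l : (l <= m)%N -> clA0 Zrel (fun u _ => F i l u).
Proof.
move=> lm; have cf := cF i lm; have pf := pF i lm.
split; first exact: (adm_fun cf pf).
  by move=> w _; split; [exact: cf|exact: pf].
have [B hB] := periodic_bounded cf pf.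
have B0 : 0 <= B by exact: le_trans (hB 0).
exists (B + (C1 + 1)); split; first by have := C1_gt0; lra.
split=> [u w _|d z u w Z _]; first by have := hB u; have := C1_gt0; lra.
have := diffF_le i u lm Z; have := mulr_ge0 B0 (ltW (Zrel_pos Z)); lra.
Qed.

Lemma clA0_avgF i l : (l <= m)%N -> clA0 Zrel (fun u w => avg w (F i l) u).
Proof.
move=> lm; have cf := cF i lm; have pf := pF i lm.
split; [exact: adm_avg|by move=> w _; split; [exact: cts_avg|exact: periodic_avg]|].
have [B hB] := periodic_bounded cf pf.
have B0 : 0 <= B by exact: le_trans (hB 0).
exists (B + (C1 + 1)); split; first by have := C1_gt0; lra.
split=> [u w [w0 _]|d z u w Z [w0 _]].
  by have := avg_norm_le u w0 cf hB; have := C1_gt0; lra.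
rewrite -avg_shift// -avgB//; last exact: cts_shift.
have := avg_norm_le u w0 (cts_diff d cf) (fun x => diffF_le i x lm Z).
by have := mulr_ge0 B0 (ltW (Zrel_pos Z)); lra.
Qed.

Lemma clA_F i l k : (k + l <= m)%N -> clA k (fun u _ => F i l u).
Proof.
elim: k l => [|k IH] l h; split=> //; try by apply: clA0_F; apply: leq_trans h; exact: leq_addl.
exists (fun u _ => F i l.+1 u); last by apply: IH; rewrite addnS -addSn.
move=> w _; have [hD _] := dF i; apply: hD.
by apply: leq_trans h; rewrite addSn ltnS leq_addl.
Qed.

Lemma clA_avgF i l k : (k + l <= m)%N -> clA k (fun u w => avg w (F i l) u).
Proof.
elim: k l => [|k IH] l h; split=> //; try by apply: clA0_avgF; apply: leq_trans h; exact: leq_addl.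
have lm : (l < m)%N by apply: leq_trans h; rewrite addSn ltnS leq_addl.
exists (fun u w => avg w (F i l.+1) u); last by apply: IH; rewrite addnS -addSn.
by move=> w _; have [hD _] := dF i; apply: isD_avg; [exact: hD|exact: cF].
Qed.

(** A covariance is bounded by two energies. Its increment splits by the discrete Leibniz rule into
    terms with one differenced factor of energy O(z^2) and one factor of energy O(1); Young's
    inequality with weights z^-1 and z makes each term O(z). *)
Lemma clI0_cov i l l' : (l <= m)%N -> (l' <= m)%N ->
  clI0 alpha Zrel (fun u w => cov w (F i l) (F i l') u).
Proof.
have K0 (c j j' : R) : j' <= c -> j <= c -> 0 < c -> 2^-1 * j + 2^-1 * j' <= 2 * c + 1 by lra.
have K1 (c x z j1 j2 j3 j4 : R) : x * j1 <= (c + 1) * z -> x * j2 <= (c + 1) * z ->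
    z * j3 <= z * c -> z * j4 <= z * c ->
    2^-1 * x * j1 + 2^-1 * z * j4 + (2^-1 * z * j3 + 2^-1 * x * j2) <= (2 * c + 1) * z by lra.
move=> lm lm'; have cf := cF i lm; have pf := pF i lm; have cg := cF i lm'; have pg := pF i lm'.
have cfg := cts_mul cf cg.
have ga : clA0 Zrel (fun u w => cov w (F i l) (F i l') u).
  have [B hB] := periodic_bounded cf pf; have [D hD] := periodic_bounded cg pg.
  have B0 : 0 <= B by exact: le_trans (hB 0).
  have D0 : 0 <= D by exact: le_trans (hD 0).
  have C10 := ltW C1_gt0.
  have bnd p q b c u w : w != 0 -> continuous p -> continuous q ->
      (forall x, `|p x| <= b) -> (forall x, `|q x| <= c) -> `|cov w p q u| <= 2 * (b * c).
    move=> w0 cp cq hb hc; rewrite /cov.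
    have h1 : `|avg w (fun x => p x * q x) u| <= b * c.
      by apply: avg_norm_le => //; [exact: cts_mul|move=> x; rewrite normrM ler_pM].
    have h2 : `|avg w p u * avg w q u| <= b * c by rewrite normrM ler_pM ?avg_norm_le.
    by apply: (le_trans (ler_normB _ _)); lra.
  split; [exact: adm_cov|by move=> w _; split; [exact: cts_cov|exact: periodic_cov]|].
  have BD := mulr_ge0 B0 D0.
  have k1 : 0 <= (C1 + 1) * D by apply: mulr_ge0 => //; lra.
  have k2 : 0 <= B * (C1 + 1) by apply: mulr_ge0 => //; lra.
  exists (2 * (B * D) + 2 * ((C1 + 1) * D) + 2 * (B * (C1 + 1))); split; first by lra.
  split=> [u w [w0 _]|d z u w Z [w0 _]].
    by have := bnd _ _ _ _ u w w0 cf cg hB hD; lra.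
  have z0 := Zrel_pos Z.
  have b1 := bnd _ _ _ _ u w w0 (cts_diff d cf) (cts_shift d cg)
     (fun x => diffF_le i x lm Z) (fun x => hD (x + d)).
  have b2 := bnd _ _ _ _ u w w0 cf (cts_diff d cg) hB (fun x => diffF_le i x lm' Z).
  rewrite cov_diff//; apply: (le_trans (ler_normD _ _)).
  by have := mulr_ge0 BD (ltW z0); lra.
split=> //.
have aff := adm_wtM alpha_gt2 (adm_cov cf pf cf pf).
have agg := adm_wtM alpha_gt2 (adm_cov cg pg cg pg).
have C10 := C1_gt0.
exists (2 * C1 + 1); split; first by lra.
split=> [eps e0|d z eps Z e0].
  apply: (@le_trans _ _ (J eps (fun u w => 2^-1 * (wt w * cov w (F i l) (F i l) u) +
      2^-1 * (wt w * cov w (F i l') (F i l') u)))).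
    apply: J_le => //; first by apply: adm_wtn => //; exact: adm_cov.
      by apply: adm_add; exact: adm_scale.
    move=> u w /(WP e0)[w0 _ _].
    have := cov_norm_le u w0 ltr01 cf cg; rewrite invr1 => h.
    by have := ler_wpM2l (wt_ge0 alpha w) h; lra.
  rewrite JD//; [|exact: adm_scale..]; rewrite !JZ//.
  exact: K0 (EF i lm' e0) (EF i lm e0) C10.
have z0 := Zrel_pos Z; have zV : 0 < z^-1 by rewrite invr_gt0.
have cfd := cts_diff d cf; have pfd := periodic_diff d pf.
have cgd := cts_diff d cg; have pgd := periodic_diff d pg.
have cgs := cts_shift d cg.
have pgs : periodic (fun x => F i l' (x + d)) by move=> x; rewrite addrAC pg.
have a1 := adm_wtM alpha_gt2 (adm_cov cfd pfd cfd pfd).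
have a2 := adm_wtM alpha_gt2 (adm_cov cgs pgs cgs pgs).
have a3 := adm_wtM alpha_gt2 (adm_cov cgd pgd cgd pgd).
apply: (@le_trans _ _ (J eps (fun u w =>
   (2^-1 * z^-1 * (wt w * cov w (fun x => F i l (x + d) - F i l x) (fun x => F i l (x + d) - F i l x) u)
  + 2^-1 * z * (wt w * cov w (fun x => F i l' (x + d)) (fun x => F i l' (x + d)) u))
  + (2^-1 * z * (wt w * cov w (F i l) (F i l) u)
  + 2^-1 * z^-1 * (wt w * cov w (fun x => F i l' (x + d) - F i l' x) (fun x => F i l' (x + d) - F i l' x) u))))).
  apply: J_le => //.
  - by apply: adm_wtn => //; apply: adm_diff; exact: adm_cov.
  - by apply: adm_add; apply: adm_add; exact: adm_scale.
  move=> u w /(WP e0)[w0 _ _].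
  rewrite cov_diff//.
  have h1 := cov_norm_le u w0 zV cfd cgs; have h2 := cov_norm_le u w0 z0 cf cgd.
  rewrite invrK in h1.
  have h := ler_normD (cov w (fun x => F i l (x + d) - F i l x) (fun x => F i l' (x + d)) u)
    (cov w (F i l) (fun x => F i l' (x + d) - F i l' x) u).
  apply: (le_trans (ler_wpM2l (wt_ge0 alpha w) h)).
  have := ler_wpM2l (wt_ge0 alpha w) h1; have := ler_wpM2l (wt_ge0 alpha w) h2.
  by lra.
rewrite !(JD e0); try by repeat (apply: adm_add || apply: adm_scale || done).
rewrite !(JZ _ e0)//.
have e1 := diffF_En i lm Z e0; have e2 := diffF_En i lm' Z e0.
have e3 := EF i lm e0; have e4 := EF i lm' e0.
rewrite -(En_shift alpha_gt2 d e0 cg pg) in e4.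
rewrite /En in e1 e2 e3 e4.
have f1 := ler_wpM2l (ltW zV) e1; have f2 := ler_wpM2l (ltW zV) e2.
have f3 := ler_wpM2l (ltW z0) e3; have f4 := ler_wpM2l (ltW z0) e4.
have k1 : z^-1 * ((C1 + 1) * z ^+ 2) = (C1 + 1) * z by field; rewrite gt_eqF.
rewrite k1 in f1 f2.
exact: K1 f1 f2 f3 f4.
Qed.

Lemma clI_cov i l l' k : (k + l <= m)%N -> (k + l' <= m)%N ->
  clI k (fun u w => cov w (F i l) (F i l') u).
Proof.
elim: k l l' => [|k IH] l l' h h'; split=> //;
  try by apply: clI0_cov; [apply: leq_trans h|apply: leq_trans h']; exact: leq_addl.
have lm : (l < m)%N by apply: leq_trans h; rewrite addSn ltnS leq_addl.
have lm' : (l' < m)%N by apply: leq_trans h'; rewrite addSn ltnS leq_addl.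
have hk : (k + l <= m)%N by apply: ltnW; rewrite -addSn.
have hk' : (k + l' <= m)%N by apply: ltnW; rewrite -addSn.
exists (fun u w => cov w (F i l.+1) (F i l') u + cov w (F i l) (F i l'.+1) u).
  move=> w _; have [hD _] := dF i.
  by apply: isD_cov; [exact: hD|exact: hD|exact: cF|exact: cF].
by apply: clI_add => //; apply: IH; rewrite // addnS -addSn.
Qed.

Definition defect u w := \sum_i cov w (F i 0%N) (F i 0%N) u.

Lemma avg_bigsum (I : Type) (r : seq I) (p : I -> R -> R) w u :
  (forall i, continuous (p i)) -> w != 0 ->
  avg w (fun x => \sum_(i <- r) p i x) u = \sum_(i <- r) avg w (p i) u.
Proof.
move=> cp w0; have cs (t : seq I) : continuous (fun x => \sum_(i <- t) p i x).
  elim: t => [|i t IH]; first by under eq_fun do rewrite big_nil; exact: cts_cst.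
  by under eq_fun do rewrite big_cons; exact: cts_add.
elim: r => [|i r IH]; first by under eq_fun do rewrite big_nil; rewrite avg_cst// big_nil.
by under eq_fun do rewrite big_cons; rewrite avgD// IH big_cons.
Qed.

(** For a unit vector field, |avg f|^2 = avg |f|^2 - Var f and the first term is 1. *)
Lemma chordsq_defect u w : W0 w -> chordsq u w = 1 - defect u w.
Proof.
move=> [w0 _]; rewrite /defect /cov sumrB -avg_bigsum//; last first.
  by move=> i; apply: cts_mul; exact: cF.
have -> : (fun x => \sum_(i <- index_enum 'I_n) F i 0%N x * F i 0%N x) = fun=> 1.
  by apply/funext => x; rewrite -(unitF x); apply: eq_bigr => i _; rewrite expr2.
rewrite avg_cst// /chordsq.
rewrite (eq_bigr (fun i => avg w (F i 0%N) u * avg w (F i 0%N) u)) => [|i _]; last exact: expr2.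
by ring.
Qed.

Lemma clA_chordsq : clA m chordsq.
Proof.
apply: (@clA_sum R Zrel Zrel_pos m _ _ (fun i u w => avg w (F i 0%N) u ^+ 2)) => i.
apply: (@clA_mul R Zrel m (fun u w => avg w (F i 0%N) u)).
all: by apply: clA_avgF; rewrite addn0.
Qed.

Lemma clI_defect : clI m defect.
Proof.
apply: (@clI_sum R alpha Zrel alpha_gt2 Zrel_pos m _ _ (fun i u w => cov w (F i 0%N) (F i 0%N) u)) => i.
by apply: clI_cov; rewrite addn0.
Qed.

Lemma clI_nonlin1 i r : clI m (fun u w => F i 0%N u * (chordsq u w `^ r - 1)).
Proof.
apply: (@clI_mulA R alpha Zrel alpha_gt2 Zrel_pos m (fun u w => F i 0%N u)).
  by apply: clA_F; rewrite addn0.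
exact: (clI_powR alpha_gt2 Zrel_pos c0_gt0 chordsq_ge chordsq_defect r clA_chordsq clI_defect).
Qed.

Lemma clI_nonlin2 i r : clI m (fun u w => avg w (F i 0%N) u * (chordsq u w `^ r - 1)).
Proof.
apply: (@clI_mulA R alpha Zrel alpha_gt2 Zrel_pos m (fun u w => avg w (F i 0%N) u)).
  by apply: clA_avgF; rewrite addn0.
exact: (clI_powR alpha_gt2 Zrel_pos c0_gt0 chordsq_ge chordsq_defect r clA_chordsq clI_defect).
Qed.

End Apriori.

(** * Moving derivatives and differences to the other factor *)

Section Duality.
Variables (R : realType) (alpha : R).
Hypothesis alpha_gt2 : 2 < alpha.
Implicit Types (p q s : R -> R) (X Y : R -> R -> R) (eps c d z r u w y : R).
Local Notation wt := (wt alpha).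
Local Notation En := (En alpha).

Lemma int01_diff_adjoint p s d : continuous p -> periodic p -> continuous s -> periodic s ->
  int01 (fun u => p u * (s (u - d) - s u)) = int01 (fun u => (p (u + d) - p u) * s u).
Proof.
move=> cp pp cs ps; have csd := cts_shift (- d) cs; have cpd := cts_shift d cp.
under eq_fun do rewrite mulrBr; under [X in _ = int01 X]eq_fun do rewrite mulrBl.
rewrite int01B; [|exact: cts_mul|exact: cts_mul].
rewrite int01B; [|exact: cts_mul|exact: cts_mul].
congr (_ - _); rewrite -(int01_shift d (p := fun u => p u * s (u - d))); last 2 first.
- exact: cts_mul.
- by move=> x; rewrite pp addrAC ps.
by apply: eq_Rintegral => u _; rewrite addrK.
Qed.

(** Slice by slice, m integrations by parts put the derivatives on [Xs]; the backward difference in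
    [Qs 0] then becomes a forward difference of [Xs m], leaving [Sf] bare so that only its sup norm
    will matter. *)
Lemma J_dual eps d m (Xs Qs : nat -> R -> R -> R) Sf : 0 < eps ->
  adm (Xs 0%N) -> adm (Xs m) -> (forall w, W0 w -> dseq m (fun l u => Xs l u w)) ->
  adm (Qs m) -> (forall w, W0 w -> dseq m (fun l u => Qs l u w)) ->
  adm Sf -> (forall w, W0 w -> continuous (Sf^~ w) /\ periodic (Sf^~ w)) ->
  (forall u w, W0 w -> Qs 0%N u w = Sf (u - d) w - Sf u w) ->
  J eps (fun u w => wt w * (Xs 0%N u w * Qs m u w)) =
  (-1) ^+ m * J eps (fun u w => wt w * ((Xs m (u + d) w - Xs m u w) * Sf u w)).
Proof.
move=> e0 aX aXm hX aQ hQ aS hS QS.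
have a1 : adm (fun u w => (Xs m (u + d) w - Xs m u w) * Sf u w).
  by apply: adm_mul => //; exact: adm_diff.
rewrite -JZ//; last exact: adm_wtM.
apply: J_eq_slice => //.
- by apply: adm_wtM => //; exact: adm_mul.
- by apply: adm_scale; exact: adm_wtM.
move=> w hw; have w0 := W_W0 e0 hw; have [cS pS] := hS w w0.
have [_ /(_ m (leqnn m))[cXm pXm]] := hX w w0.
have [_ /(_ 0%N (leq0n m))[cX0 pX0]] := hX w w0.
have [_ /(_ m (leqnn m))[cQm pQm]] := hQ w w0.
have cd : continuous (fun u => (Xs m (u + d) w - Xs m u w) * Sf u w).
  by apply: cts_mul => //; apply: cts_sub => //; exact: (cts_shift d cXm).
rewrite int01Z; last exact: cts_mul.
rewrite int01Z; last exact: cts_scale.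
rewrite int01Z// mulrCA; congr (_ * _).
rewrite (dseq_IBP (hX w w0) (hQ w w0)); congr (_ * _).
rewrite -int01_diff_adjoint//.
by apply: eq_Rintegral => u _; rewrite QS.
Qed.

Lemma adm_diffsq p : continuous p -> periodic p ->
  adm (fun u w => p u * p u - avg w p u * avg w p u).
Proof.
move=> cp pp; have ap := adm_fun cp pp.
by apply: adm_sub; [exact: adm_mul|apply: adm_mul; exact: adm_avg].
Qed.

(** The last factor is finite for each truncation but not bounded uniformly in eps, so the estimate
    serves passages to the limit at a fixed eps. *)
Lemma En_close eps p q y t : 0 < eps -> 0 <= y -> 0 <= t ->
  continuous p -> periodic p -> continuous q -> periodic q ->
  (forall x, `|p x| <= y) -> (forall x, `|q x| <= y) -> (forall x, `|p x - q x| <= t) ->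
  En eps q <= En eps p + 4 * y * t * J eps (fun _ w => wt w).
Proof.
move=> e0 y0 t0 cp pp cq pq hp hq hpq.
have aw := adm_wt alpha_gt2.
rewrite /En !J_cov// -JZ// -JD//; [|by apply: adm_wtM => //; exact: adm_diffsq|exact: adm_scale].
apply: J_le => //.
- by apply: adm_wtM => //; exact: adm_diffsq.
- by apply: adm_add; [apply: adm_wtM => //; exact: adm_diffsq|exact: adm_scale].
move=> u w /(WP e0)[w0 _ _].
have ap := avg_norm_le u w0 cp hp; have aq := avg_norm_le u w0 cq hq.
have apq : `|avg w p u - avg w q u| <= t.
  by rewrite -avgB//; apply: avg_norm_le => //; exact: cts_sub.
have K (a b : R) : `|a| <= y -> `|b| <= y -> `|a - b| <= t -> `|a * a - b * b| <= 2 * y * t.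
  move=> ha hb hab; rewrite (_ : a * a - b * b = (a + b) * (a - b)); last by ring.
  rewrite normrM; apply: ler_pM => //.
  by apply: (le_trans (ler_normD _ _)); lra.
have := K _ _ (hp u) (hq u) (hpq u); have := K _ _ ap aq apq.
rewrite !ler_norml => /andP[k1 k2] /andP[k3 k4].
rewrite [4 * y * t * _]mulrC -mulrDr; apply: ler_wpM2l; first exact: wt_ge0.
by lra.
Qed.

(* All the quadratic terms are squares of the same smoothed function, because
   Steklov averages are self-adjoint and commute with avg. *)
Lemma J_stek_energy eps j eta q : 0 < eps -> eta != 0 -> continuous q -> periodic q ->
  let s := iter (j + j) (stek eta) q in
  J eps (fun u w => wt w * (q u * s u - avg w q u * avg w s u)) =
  En eps (iter j (stek eta) q).
Proof.
move=> e0 en0 cq pq s.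
have [cs ps] : continuous s /\ periodic s by exact: iter_stek_cp.
have [cj pj] := iter_stek_cp j eta cq pq.
have sE : s = iter j (stek eta) (iter j (stek eta) q) by rewrite /s iterD.
have aE w : avg w (iter j (stek eta) q) = iter j (stek eta) (avg w q).
  by apply/funext; exact: iter_stek_avg.
have asE w : avg w s = iter j (stek eta) (avg w (iter j (stek eta) q)).
  by rewrite sE; apply/funext; exact: iter_stek_avg.
have adj p' q' : continuous p' -> periodic p' -> continuous q' -> periodic q' ->
  int01 (fun u => iter j (stek eta) p' u * q' u) = int01 (fun u => p' u * iter j (stek eta) q' u).
  exact: iter_stek_adjoint.
have g1 : int01 (fun u => q u * s u) =
    int01 (fun u => iter j (stek eta) q u * iter j (stek eta) q u).
  by rewrite sE adj.
have g2 w : int01 (fun u => avg w q u * avg w s u) =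
    int01 (fun u => avg w (iter j (stek eta) q) u * avg w (iter j (stek eta) q) u).
  have ca := cts_avg w cq; have pa := periodic_avg w cq pq.
  have [c1 p1] := iter_stek_cp j eta ca pa.
  by rewrite asE aE -adj.
move: cs ps cj pj g1 g2; clear sE aE asE adj.
move: (iter j (stek eta) q) s => sj s cs ps cj pj g1 g2.
rewrite /En (J_cov alpha_gt2 e0 cj pj cj pj).
apply: (J_eq_slice e0).
- apply: (adm_wtM alpha_gt2); apply: adm_sub.
    by apply: adm_mul; [exact: (adm_fun cq pq)|exact: (adm_fun cs ps)].
  by apply: adm_mul; [exact: (adm_avg cq pq)|exact: (adm_avg cs ps)].
- by apply: (adm_wtM alpha_gt2); exact: adm_diffsq.
move=> w /(WP e0)[w0 _ _].
have ca := cts_avg w cq; have cas := cts_avg w cs; have caj := cts_avg w cj.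
rewrite (int01Z _ (cts_sub (cts_mul cq cs) (cts_mul ca cas))).
rewrite (int01Z _ (cts_sub (cts_mul cj cj) (cts_mul caj caj))).
rewrite (int01B (cts_mul cq cs) (cts_mul ca cas)) (int01B (cts_mul cj cj) (cts_mul caj caj)).
by rewrite g1 g2.
Qed.

End Duality.

(** * The a priori energy estimate for differences *)

Section AprioriEstimate.
Variables (R : realType) (n : nat) (alpha lambda : R) (m : nat)
  (F : 'I_n -> nat -> R -> R) (c0 C1 : R).
Hypothesis alpha_gt2 : 2 < alpha.
Hypothesis alpha_lt3 : alpha < 3.
Hypothesis lambda_gt0 : 0 < lambda.
Implicit Types (p q s : R -> R) (X Y : R -> R -> R) (eps c d z r u w y : R).
Local Notation wt := (wt alpha).
Local Notation En := (En alpha).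
Hypothesis dF : forall i, dseq m (F i).
Hypothesis unitF : forall u, \sum_i F i 0%N u ^+ 2 = 1.
Hypothesis C1_gt0 : 0 < C1.
Hypothesis EF : forall i l eps, (l <= m)%N -> 0 < eps -> En eps (F i l) <= C1.
Hypothesis lowE : forall i l d eps, (l < m)%N -> 0 < d -> d <= 1 -> 0 < eps ->
  En eps (fun x => F i l (x + d) - F i l x) <= C1 * d ^+ 2.
Hypothesis lowS : forall i l d u, (l < m)%N -> 0 < d -> d <= 1 ->
  `|F i l (u + d) - F i l u| <= C1 * d.
Hypothesis c0_gt0 : 0 < c0.
Hypothesis chordsq_ge : forall u w, W0 w -> c0 <= chordsq F u w.

(* The integrand of the first variation along the test curve h e_i, with k = h': chords
   divided by w are averages of derivatives, and alpha - 2 is split so that the first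
   summand is the polarised energy. *)
Definition ELint (f : 'I_n -> nat -> R -> R) i (k : R -> R) u w := wt w *
  (alpha * (f i 0%N u * k u - avg w (f i 0%N) u * avg w k u)
  + 2 * (f i 0%N u * (chordsq f u w `^ (- (alpha / 2)) - 1) * k u)
  - alpha * (avg w (f i 0%N) u * (chordsq f u w `^ (- (alpha / 2) - 1) - 1) * avg w k u)).

Hypothesis EL : forall i (h k : R -> R), Ck 3 h -> isD h k ->
  J eps (ELint F i k) @[eps --> 0^'+] --> - (lambda * int01 (fun u => F i 0%N u * k u)).

(* The Euler-Lagrange equation is tested with the m-th derivative of the backward difference
   of the 2(m+2)-fold Steklov average of q := F i m (. + d) - F i m; the smoothing makes this
   a legitimate test function. *)
Lemma apriori_stek i : exists2 C, 0 <= C & forall d z y eta, Zrel alpha m F d z -> 0 <= y ->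
  (forall u, `|F i m (u + d) - F i m u| <= y) -> 0 < eta -> forall eps, 0 < eps ->
  alpha * En eps (iter m.+2 (stek eta) (fun x => F i m (x + d) - F i m x)) <= C * y * z.
Proof.
have a2 := alpha_gt2; have [j jE] : exists j, j = m.+2 by exists m.+2.
rewrite -jE.
have cl1 := clI_nonlin1 alpha_gt2 dF unitF C1_gt0 EF lowE lowS c0_gt0 chordsq_ge i (- (alpha / 2)).
have cl2 := clI_nonlin2 alpha_gt2 dF unitF C1_gt0 EF lowE lowS c0_gt0 chordsq_ge i
  (- (alpha / 2) - 1).
have [X1 [X10 dX1 [[aX1 _ _] [B1 [B10 [_ hB1]]]]]] := clI_dseq cl1.
have [X2 [X20 dX2 [[aX2 _ _] [B2 [B20 [_ hB2]]]]]] := clI_dseq cl2.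
have aX10 : adm (X1 0%N) by rewrite X10; have [[[]]] := cl_base cl1.
have aX20 : adm (X2 0%N) by rewrite X20; have [[[]]] := cl_base cl2.
exists (2 * B1 + alpha * B2).
  by rewrite addr_ge0// mulr_ge0//; lra.
move=> d z y eta Z y0 hy eta0 eps' e'0.
have en0 : eta != 0 by rewrite gt_eqF.
have z0 := Zrel_pos Z.
set phi := F i m; pose q x := phi (x + d) - phi x.
have [_ hcp] := dF i; have [cphi pphi] := hcp m (leqnn m).
have [cf0 pf0] := hcp 0%N (leq0n m).
have cq : continuous q by exact: cts_diff.
have pq : periodic q by exact: periodic_diff.
pose s := iter (j + j) (stek eta) q; pose sj := iter j (stek eta) q.
have [cs ps] : continuous s /\ periodic s by exact: iter_stek_cp.
have [csj psj] : continuous sj /\ periodic sj by exact: iter_stek_cp.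
have hs u : `|s u| <= y by exact: iter_stek_norm_le.
(* The adjoint difference operator applied to s. As s is q smoothed an even number of times, half of
   the averages can be moved onto the other factor, and pairing with [kappa] produces squares of
   [sj]. *)
pose kappa x := s (x - d) - s x.
have Cs : Ck (j + j) s.
  by rewrite -[X in Ck X]addn0; apply: Ck_iter_stek; split.
have Ckap : Ck (j + j) kappa by apply: Ck_sub => //; exact: Ck_shift.
have [ckap pkap] := Ck_cp Ckap.
(* A mean-zero function has a periodic primitive. The test function is the m-th derivative of this
   primitive, so that its derivative k is the m-th derivative of [kappa]. *)
have i0 : int01 kappa = 0.
  rewrite int01B//; last exact: (cts_shift (- d) cs).
  by rewrite int01_shift// subrr.
have hK := isD_prim ckap.
have pK : periodic (prim kappa).
  by move=> x; have := prim_period hK ckap pkap x; rewrite i0 => /eqP; rewrite subr_eq0 => /eqP.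
have CK : Ck (j + j).+1 (prim kappa).
  by split=> //; [exact: isD_continuous hK|exists kappa].
have [D D0 [hD cD]] := Ck_dseq CK.
have D1 : D 1%N = kappa.
  by apply/funext; apply: isD_uniq (hD 0%N isT) _; rewrite D0.
(* Regularity count: a C^3 test function requires m + 3 derivatives of the primitive, while 2 (m +
   2) smoothings and one integration provide 2 m + 5. *)
have lem l : (l <= m.+3)%N -> (l <= (j + j).+1)%N.
  by move=> h; apply: (leq_trans h); rewrite jE ltnS leq_addl.
have m2 : (m <= m.+2)%N by rewrite -addn2 leq_addr.
have Ch : Ck 3 (D m).
  apply: (dseq_Ck (D := fun l => D (l + m)%N)); split=> l hl.
    by apply: hD; apply: lem; rewrite -(add3n m) ltn_add2r.
  by apply: cD; apply: lem; rewrite -(add3n m) leq_add2r.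
have hk : isD (D m) (D m.+1) by apply: hD; exact: lem.
set k := D m.+1 in hk.
have [ck pk] : continuous k /\ periodic k by apply: cD; exact: lem.
have dQ : dseq m (fun l => D l.+1).
  split=> l hl; first by apply: hD; apply: lem; exact: leq_trans hl m2.
  by apply: cD; apply: lem; exact: leq_trans hl m2.
have daQ w : dseq m (fun l => avg w (D l.+1)).
  have [h1 h2] := dQ; split=> l hl.
    by apply: isD_avg; [exact: h1|have [] := h2 l.+1 hl].
  by have [c p] := h2 l hl; split; [exact: cts_avg|exact: periodic_avg].
have daF w : dseq m (fun l => avg w (F i l)).
  have [h1 h2] := dF i; split=> l hl.
    by apply: isD_avg; [exact: h1|have [] := h2 l.+1 hl].
  by have [c p] := h2 l hl; split; [exact: cts_avg|exact: periodic_avg].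
have af0 := adm_fun cf0 pf0; have aaf0 := adm_avg cf0 pf0.
have aphi := adm_fun cphi pphi; have aaphi := adm_avg cphi pphi.
have ak := adm_fun ck pk; have aak := adm_avg ck pk.
have as_ := adm_fun cs ps; have aas := adm_avg cs ps.
have avgq u w : avg w phi (u + d) - avg w phi u = avg w q u.
  by rewrite -avg_shift// -avgB//; exact: cts_shift.
have avgk u w : avg w kappa u = avg w s (u - d) - avg w s u.
  by rewrite -avg_shift// -avgB//; exact: cts_shift.
have hS1 w : W0 w -> continuous (fun u => s u) /\ periodic (fun u => s u) by [].
have hS2 w : W0 w -> continuous (fun u => avg w s u) /\ periodic (fun u => avg w s u).
  by move=> _; split; [exact: cts_avg|exact: periodic_avg].
have Q1 u w : W0 w -> D 1%N u = s (u - d) - s u by rewrite D1.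
have Q2 u w : W0 w -> avg w (D 1%N) u = avg w s (u - d) - avg w s u by rewrite D1 avgk.
have E1 eps : 0 < eps -> J eps (fun u w => wt w * (F i 0%N u * k u - avg w (F i 0%N) u * avg w k u))
    = (-1) ^+ m * En eps sj.
  move=> e0.
  have t1 := J_dual a2 (Xs := fun l u _ => F i l u) (Qs := fun l u _ => D l.+1 u)
     (Sf := fun u _ => s u) e0 af0 aphi (fun _ _ => dF i) ak (fun _ _ => dQ) as_ hS1 Q1.
  have t2 := J_dual a2 (Xs := fun l u w => avg w (F i l) u) (Qs := fun l u w => avg w (D l.+1) u)
     (Sf := fun u w => avg w s u) e0 aaf0 aaphi (fun w _ => daF w) aak (fun w _ => daQ w) aas hS2 Q2.
  under eq_fun do under eq_fun do rewrite mulrBr.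
  rewrite JB//; [|by apply: adm_wtM => //; exact: adm_mul..].
  rewrite t1 t2 -mulrBr -JB//; last 2 first.
  - by apply: adm_wtM => //; apply: adm_mul => //; exact: (adm_diff d aphi).
  - by apply: adm_wtM => //; apply: adm_mul => //; exact: (adm_diff d aaphi).
  rewrite -J_stek_energy//; congr (_ * _); apply: J_eq => u w _.
  by rewrite avgq mulrBr.
(* One factor is the uniform bound y of the test function, the other the summed increments of a
   class I function, whence the product y z. *)
have bound (Xs Qs : nat -> R -> R -> R) (Sf : R -> R -> R) B eps : 0 < eps ->
    adm (Xs 0%N) -> adm (Xs m) -> (forall w, W0 w -> dseq m (fun l u => Xs l u w)) ->
    adm (Qs m) -> (forall w, W0 w -> dseq m (fun l u => Qs l u w)) ->
    adm Sf -> (forall w, W0 w -> continuous (Sf^~ w) /\ periodic (Sf^~ w)) ->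
    (forall u w, W0 w -> Qs 0%N u w = Sf (u - d) w - Sf u w) ->
    (forall u w, W0 w -> `|Sf u w| <= y) ->
    J eps (fun u w => wt w * `|Xs m (u + d) w - Xs m u w|) <= B * z ->
    `|J eps (fun u w => wt w * (Xs 0%N u w * Qs m u w))| <= y * (B * z).
  move=> e0 aX aXm hX aQ hQ aS hS QS hSy hB.
  rewrite (J_dual (d := d) a2 e0 aX aXm hX aQ hQ aS hS QS) normrM normrX normrN1 expr1n mul1r.
  have ad := adm_diff d aXm.
  have a1 : adm (fun u w => wt w * ((Xs m (u + d) w - Xs m u w) * Sf u w)).
    by apply: adm_wtM => //; exact: adm_mul.
  apply: (le_trans (J_norm e0 a1)).
  apply: (@le_trans _ _ (J eps (fun u w => y * (wt w * `|Xs m (u + d) w - Xs m u w|)))).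
    apply: J_le => //; first exact: adm_norm.
      by apply: adm_scale; exact: adm_wtn.
    move=> u w hw; rewrite !normrM (ger0_norm (wt_ge0 _ _)) [leRHS]mulrCA.
    apply: ler_wpM2l; first exact: wt_ge0.
    by rewrite mulrC; apply: ler_wpM2r => //; apply: hSy; exact: W_W0 hw.
  rewrite JZ//; last exact: adm_wtn.
  exact: ler_wpM2l.
have hSa u w : W0 w -> `|avg w s u| <= y by move=> [w0 _]; exact: avg_norm_le.
have E2 eps : 0 < eps ->
    `|J eps (fun u w => wt w * (F i 0%N u * (chordsq F u w `^ (- (alpha / 2)) - 1) * k u))|
    <= y * (B1 * z).
  move=> e0; have := bound X1 (fun l u _ => D l.+1 u) (fun u _ => s u) B1 eps e0 aX10 aX1 dX1
    ak (fun _ _ => dQ) as_ hS1 Q1 (fun u _ _ => hs u) (hB1 d z eps Z e0).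
  by rewrite X10.
have E3 eps : 0 < eps ->
    `|J eps (fun u w => wt w * (avg w (F i 0%N) u * (chordsq F u w `^ (- (alpha / 2) - 1) - 1) * avg w k u))|
    <= y * (B2 * z).
  move=> e0; have := bound X2 (fun l u w => avg w (D l.+1) u) (fun u w => avg w s u) B2 eps e0 aX20 aX2 dX2
    aak (fun w _ => daQ w) aas hS2 Q2 hSa (hB2 d z eps Z e0).
  by rewrite X20.
have E4 : int01 (fun u => F i 0%N u * k u) = (-1) ^+ m * int01 (fun u => sj u * sj u).
  rewrite (dseq_IBP (dF i) dQ); congr (_ * _).
  rewrite D1 int01_diff_adjoint// /s iterD iter_stek_adjoint//.
have ELE eps : 0 < eps -> (-1) ^+ m * J eps (ELint F i k) = alpha * En eps sj
   + (-1) ^+ m * (2 * J eps (fun u w => wt w * (F i 0%N u * (chordsq F u w `^ (- (alpha / 2)) - 1) * k u))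
   - alpha * J eps (fun u w => wt w * (avg w (F i 0%N) u * (chordsq F u w `^ (- (alpha / 2) - 1) - 1) * avg w k u))).
  move=> e0.
  have b1 : adm (fun u w => wt w * (F i 0%N u * k u - avg w (F i 0%N) u * avg w k u)).
    by apply: adm_wtM => //; apply: adm_sub; exact: adm_mul.
  have b2 : adm (fun u w => wt w * (F i 0%N u * (chordsq F u w `^ (- (alpha / 2)) - 1) * k u)).
    by apply: adm_wtM => //; have aN := aX10; rewrite X10 in aN; exact: (adm_mul aN ak).
  have b3 : adm (fun u w => wt w * (avg w (F i 0%N) u * (chordsq F u w `^ (- (alpha / 2) - 1) - 1) * avg w k u)).
    by apply: adm_wtM => //; have aN := aX20; rewrite X20 in aN; exact: (adm_mul aN aak).
  have e5 : J eps (ELint F i k) =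
     alpha * J eps (fun u w => wt w * (F i 0%N u * k u - avg w (F i 0%N) u * avg w k u)) +
     2 * J eps (fun u w => wt w * (F i 0%N u * (chordsq F u w `^ (- (alpha / 2)) - 1) * k u)) -
     alpha * J eps (fun u w => wt w * (avg w (F i 0%N) u * (chordsq F u w `^ (- (alpha / 2) - 1) - 1) * avg w k u)).
    have c1 := adm_scale alpha b1; have c2 := adm_scale 2 b2; have c3 := adm_scale alpha b3.
    rewrite -(JZ alpha e0 b1) -(JZ 2 e0 b2) -(JZ alpha e0 b3) -(JD e0 c1 c2).
    rewrite -(JB e0 (adm_add c1 c2) c3); apply: J_eq => u w _; rewrite /ELint.
    by ring.
  have sg : (-1) ^+ m * (-1) ^+ m = 1 :> R by rewrite -exprMn mulrNN mulr1 expr1n.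
  rewrite e5 E1//; set j1 := J eps _; set j2 := J eps _; set sgn := (-1) ^+ m in sg *.
  have -> : sgn * (alpha * (sgn * En eps sj) + 2 * j1 - alpha * j2) =
     (sgn * sgn) * (alpha * En eps sj) + sgn * (2 * j1 - alpha * j2) by ring.
  by rewrite sg mul1r.
have lim : (-1) ^+ m * J eps (ELint F i k) @[eps --> 0^'+] --> - (lambda * int01 (fun u => sj u * sj u)).
  have -> : - (lambda * int01 (fun u => sj u * sj u)) =
      (-1) ^+ m * - (lambda * int01 (fun u => F i 0%N u * k u)).
    have sg : (-1) ^+ m * (-1) ^+ m = 1 :> R by rewrite -exprMn mulrNN mulr1 expr1n.
    rewrite E4; set I2 := int01 _; set sgn := (-1) ^+ m in sg *.
    have -> : sgn * - (lambda * (sgn * I2)) = - ((sgn * sgn) * (lambda * I2)) by ring.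
    by rewrite sg mul1r.
  apply: cvgM; first exact: cvg_cst.
  exact: (EL Ch hk).
apply/ler_addgt0Pr => e e0.
(* The equation holds only in the limit, so it is used at some eps below eps'; the truncated energy
   grows as the cut-off shrinks. *)
near (0:R)^'+ => eps.
have eps0 : 0 < eps by near: eps; exact: nbhs_right_gt.
have epse : eps <= eps' by near: eps; exact: nbhs_right_le.
have hlim : `|- (lambda * int01 (fun u => sj u * sj u)) - (-1) ^+ m * J eps (ELint F i k)| < e.
  by near: eps; move/cvgrPdist_lt : lim; exact.
have mono : En eps' sj <= En eps sj.
  apply: J_mono_eps => //; first by apply: adm_wtM => //; exact: adm_cov.
  by move=> u w /(WP eps0)[w0 _ _]; rewrite mulr_ge0 ?wt_ge0 ?var_ge0.
(* Positivity of lambda: the length term joins the energy as a square and is discarded. *)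
have sq0 : 0 <= lambda * int01 (fun u => sj u * sj u).
  by apply: mulr_ge0; [exact: ltW|apply: int01_ge0 => u; exact: sqr_ge0].
have amono : alpha * En eps' sj <= alpha * En eps sj by apply: ler_wpM2l mono; lra.
move: hlim; rewrite ELE// ltr_norml => /andP[h1 h2].
have e2 := E2 eps eps0; have e3 := E3 eps eps0.
move: h1 h2 e2 e3; set j1 := J eps _; set j2 := J eps _ => h1 h2 e2 e3.
have hr : `|(-1) ^+ m * (2 * j1 - alpha * j2)| <= 2 * (y * (B1 * z)) + alpha * (y * (B2 * z)).
  rewrite normrM normrX normrN1 expr1n mul1r; apply: (le_trans (ler_normB _ _)).
  rewrite !normrM (gtr0_norm (_ : 0 < 2))// (gtr0_norm (_ : 0 < alpha)); last by lra.
  have a0 : 0 <= alpha by lra.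
  by apply: lerD; apply: ler_wpM2l.
move: hr; rewrite ler_norml => /andP[h3 h4].
by rewrite -/q -/sj; lra.
Unshelve. all: by end_near. Qed.

(** Removal of the smoothing: at fixed eps the iterated Steklov averages converge uniformly to the
    Hoelder function q as eta tends to 0, and C does not depend on eta. *)
Lemma apriori i : exists2 C, 0 <= C & forall d z y, Zrel alpha m F d z -> 0 <= y ->
  (forall u, `|F i m (u + d) - F i m u| <= y) -> forall eps, 0 < eps ->
  alpha * En eps (fun x => F i m (x + d) - F i m x) <= C * y * z.
Proof.
have a2 := alpha_gt2; have a0 : 0 <= alpha by lra.
have K (A B c d e : R) : A <= B + d -> B <= c -> d <= e -> A <= c + e by lra.
have [C C0 hC] := apriori_stek i; exists C => // d z y Z y0 hy eps e0.
have [_ hcp] := dF i; have [cphi pphi] := hcp m (leqnn m).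
set q := (fun x => _).
have cq : continuous q by exact: cts_diff.
have pq : periodic q by exact: periodic_diff.
pose b := (alpha - 2) / 2; have b0 : 0 < b by rewrite /b; lra.
have [_ hol] := morrey_scalar alpha_gt2 alpha_lt3 cphi pphi C1_gt0 (fun eps h => EF i (leqnn m) h).
set M := morrey_cst alpha * Num.sqrt C1 in hol.
have M0 : 0 <= M by rewrite mulr_ge0 ?sqrtr_ge0 ?morrey_cst_ge0.
have holq u r : 0 < r -> r <= 12^-1 -> `|q (u + r) - q u| <= (2 * M) * r `^ b.
  move=> r0 r12; have h1 := hol (u + d) r r0 r12; have h2 := hol u r r0 r12.
  rewrite /q (_ : F i m (u + r + d) - F i m (u + r) - (F i m (u + d) - F i m u) =
    (F i m (u + d + r) - F i m (u + d)) - (F i m (u + r) - F i m u)); last first.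
    by rewrite (addrAC u r d); ring.
  by apply: (le_trans (ler_normB _ _)); rewrite -/b in h1 h2; lra.
apply/ler_addgt0Pr => e ee0.
set Jw := J eps (fun _ w => wt w).
have Jw0 : 0 <= Jw by apply: J_ge0 => u w _; exact: wt_ge0.
pose N := alpha * (4 * y * (m.+2%:R * (2 * M)) * Jw).
have N0 : 0 <= N.
  rewrite /N; apply: mulr_ge0; first by lra.
  apply: mulr_ge0 => //; apply: mulr_ge0; first by lra.
  by apply: mulr_ge0; [exact: ler0n|lra].
have [eta0 eta00 heta] := small_powR b0 N0 ee0.
pose eta := Num.min eta0 12^-1.
have eta_gt0 : 0 < eta by rewrite lt_min eta00/=; lra.
have etar : eta <= 12^-1 by rewrite /eta ge_min lexx orbT.
have eta_le : eta <= eta0 by rewrite /eta ge_min lexx.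
have en0 : eta != 0 by rewrite gt_eqF.
have M20 : 0 <= 2 * M by lra.
have close := iter_stek_close m.+2 eta_gt0 etar b0 M20 cq pq holq.
have [csj psj] := iter_stek_cp m.+2 eta cq pq.
have hsj := iter_stek_norm_le m.+2 en0 cq pq hy.
have t0 : 0 <= m.+2%:R * (2 * M * eta `^ b).
  by apply: mulr_ge0; [exact: ler0n|apply: mulr_ge0 => //; exact: powR_ge0].
have := En_close a2 e0 y0 t0 csj psj cq pq hsj hy close; rewrite -/Jw => h1.
have h2 := hC d z y eta Z y0 hy eta_gt0 eps e0.
have h3 := heta eta (ltW eta_gt0) eta_le.
have h4 : alpha * (En eps (iter m.+2 (stek eta) q) + 4 * y * (m.+2%:R * (2 * M * eta `^ b)) * Jw) =
   alpha * En eps (iter m.+2 (stek eta) q) + N * eta `^ b by rewrite /N; ring.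
have := ler_wpM2l a0 h1; rewrite h4 => h5; exact: K h5 h2 h3.
Qed.

End AprioriEstimate.

(** * Regularity from difference quotients and decay from doubling *)

Section EquiHolder.
Variable R : realType.
Implicit Types (p : R -> R) (d u v w r M beta : R).

(** The quotient of step c averaged over a window of length l is a second difference of a primitive,
    symmetric in c and l. Hence the quotients of steps v and w take a common value near u, and
    equi-Hoelder continuity in u becomes a Cauchy rate in the step. *)
Lemma C1_of_equiholder p M beta r0 : continuous p -> 0 < r0 -> 0 < beta -> 0 <= M ->
  (forall u r w, 0 < r -> r <= r0 -> 0 < w -> w <= r0 ->
    `|(p (u + r + w) - p (u + r)) / w - (p (u + w) - p u) / w| <= M * r `^ beta) ->
  exists d : R -> R, [/\ isD p d, continuous d &
    forall u w, 0 < w -> w <= r0 -> `|(p (u + w) - p u) / w - d u| <= 2 * M * w `^ beta].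
Proof.
move=> cp r00 b0 M0 H; pose a u w := (p (u + w) - p u) / w.
have M20 : 0 <= 2 * M by lra.
have mono r r' : 0 <= r -> r <= r' -> M * r `^ beta <= M * r' `^ beta.
  move=> r1 rr; apply: ler_wpM2l => //.
  by apply: ge0_ler_powR; rewrite ?nnegrE; lra.
have cauchy u v w : 0 < v -> v <= w -> w <= r0 -> `|a u v - a u w| <= 2 * M * w `^ beta.
  move=> v0 vw wr; have w0 : 0 < w by lra.
  have hP := isD_prim cp.
  have key c l : 0 < c -> 0 < l -> exists2 s, 0 < s < l &
     prim p (u + c + l) - prim p (u + l) - prim p (u + c) + prim p u = c * l * a (u + s) c.
    move=> c0' l0; have [|s sl e] := @isD_MVT R _ _ 0 l (isDB
      (isD_shift (u + c) hP) (isD_shift u hP)); first by [].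
    exists s => //; rewrite /a (_ : u + c + l = l + (u + c)); last by ring.
    rewrite (_ : u + l = l + u); last by ring.
    move: e; rewrite !add0r subr0 (_ : s + (u + c) = u + s + c); last by ring.
    rewrite [s + u]addrC => e.
    have -> : c * l * ((p (u + s + c) - p (u + s)) / c) = (p (u + s + c) - p (u + s)) * l.
      by field; rewrite gt_eqF.
    by rewrite -e; ring.
  have [s1 /andP[s10 s1w] e1] := key v w v0 w0.
  have [s2 /andP[s20 s2v] e2] := key w v w0 v0.
  have e : a (u + s1) v = a (u + s2) w.
    have vw0 : v * w != 0 by rewrite mulf_neq0 ?gt_eqF.
    apply: (mulfI vw0); rewrite -e1 [v * w]mulrC -e2.
    by rewrite (addrAC u w v); ring.
  have h1 : `|a (u + s1) v - a u v| <= M * w `^ beta.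
    apply: (le_trans (H u s1 v s10 (le_trans (ltW s1w) wr) v0 (le_trans vw wr))).
    exact: mono (ltW s10) (ltW s1w).
  have h2 : `|a (u + s2) w - a u w| <= M * w `^ beta.
    have s2w : s2 <= w := le_trans (ltW s2v) vw.
    apply: (le_trans (H u s2 w s20 (le_trans s2w wr) w0 wr)).
    exact: mono (ltW s20) s2w.
  have := ler_distD (a (u + s1) v) (a u v) (a u w).
  by rewrite distrC in h1; rewrite {2}e; lra.
have ex u : exists d : R, forall w, 0 < w -> w <= r0 -> `|a u w - d| <= 2 * M * w `^ beta.
  by apply: holder_limit => //; exact: cauchy.
pose d u := sval (cid (ex u)).
have hd u : forall w, 0 < w -> w <= r0 -> `|a u w - d u| <= 2 * M * w `^ beta := svalP (cid (ex u)).
have hol u r : 0 < r -> r <= r0 -> `|d (u + r) - d u| <= 5 * M * r `^ beta.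
  move=> r1 rr; have h1 := hd u r r1 rr; have h2 := hd (u + r) r r1 rr.
  have h3 := H u r r r1 rr r1 rr; rewrite -/(a (u + r) r) -/(a u r) in h3.
  have := ler_distD (a (u + r) r) (d (u + r)) (d u).
  have := ler_distD (a u r) (a (u + r) r) (d u).
  by rewrite (distrC (d (u + r)) (a (u + r) r)); lra.
have M50 : 0 <= 5 * M by lra.
exists d; split=> //; last exact: (holder_continuous r00 b0 M50 hol).
apply: (isD_of_right_rate r00 b0 M50 _ hol) => u w w0 wr.
apply: (le_trans (hd u w w0 wr)); apply: ler_wpM2r; first exact: powR_ge0.
by lra.
Qed.

(* The doubling inequality says that om(d)/d^2 grows by a factor 1 + O(sqrt d) when d is halved;
   the product of these factors converges. *)
Lemma doubling_decay (om : R -> R) (C4 K0 : R) : 0 <= C4 -> 0 <= K0 ->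
  (forall d, 0 < d -> d <= 1 -> 0 <= om d <= K0) ->
  (forall d, 0 < d -> d <= 12^-1 ->
     4 * om d <= (1 + Num.sqrt d) * om (2 * d) + C4 * Num.sqrt d * (d ^+ 2 + om d)) ->
  exists2 K, 0 <= K & forall d, 0 < d -> d <= 1 -> om d <= K * d ^+ 2.
Proof.
move=> C40 K00 hK0 dbl.
(* Write R d for d^2 + om d. For d <= d0 the quantity R d (1 + B sqrt d) / d^2 is at most its value
   at 2 d: the gain from sqrt (2 d) >= 7/5 sqrt d, multiplied by the large B, outweighs the errors
   sqrt d and C4 sqrt d, and [v0] is small enough for the second-order terms. *)
pose B := 10 * (C4 + 1).
have B0 : 0 < B by rewrite /B; lra.
pose v0 := (2 * B * (C4 + 2))^-1.
have v00 : 0 < v0 by rewrite invr_gt0 !mulr_gt0//; lra.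
have v0E : v0 * (2 * B * (C4 + 2)) = 1.
  by rewrite mulVf// gt_eqF// !mulr_gt0//; lra.
pose d0 := Num.min (v0 ^+ 2) 24^-1.
have d00 : 0 < d0 by rewrite lt_min exprn_gt0//= invr_gt0.
have d024 : d0 <= 24^-1 by rewrite /d0 ge_min lexx orbT.
have d0v d : 0 < d -> d <= d0 -> Num.sqrt d <= v0.
  move=> dp dd; rewrite -[leRHS](ger0_norm (ltW v00)) -sqrtr_sqr ler_sqrt//.
    by apply: (le_trans dd); rewrite /d0 ge_min lexx.
  exact: exprn_ge0 (ltW v00).
have s2 d : 0 < d -> 7 / 5 * Num.sqrt d <= Num.sqrt (2 * d).
  move=> dp; rewrite sqrtrM//; apply: ler_wpM2r; first exact: sqrtr_ge0.
  have h75 : (0 : R) <= 7 / 5 by lra.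
  by rewrite -[leLHS](ger0_norm h75) -sqrtr_sqr ler_sqrt//; lra.
pose K := (1 + K0) * (1 + B) / d0 ^+ 2.
have d02 : 0 < d0 ^+ 2 by exact: exprn_gt0.
have KE : K * d0 ^+ 2 = (1 + K0) * (1 + B) by rewrite /K divfK// gt_eqF.
have K_ge0 : 0 <= K by rewrite /K divr_ge0 ?ltW// mulr_gt0//; lra.
have base d : d0 < d -> d <= 1 -> (d ^+ 2 + om d) * (1 + B * Num.sqrt d) <= K * d ^+ 2.
  move=> dd d1; have dp : 0 < d by exact: lt_trans dd.
  have /andP[ o0 oK] := hK0 d dp d1.
  have sd0 := sqrtr_ge0 d.
  have sd1 : Num.sqrt d <= 1 by rewrite -[leRHS]sqrtr1 ler_sqrt.
  have d21 : d ^+ 2 <= 1 by rewrite expr_le1// ltW.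
  have d2d : d0 ^+ 2 <= d ^+ 2.
    by rewrite -subr_ge0 subr_sqr; apply: mulr_ge0; lra.
  apply: (@le_trans _ _ ((1 + K0) * (1 + B))).
    apply: ler_pM; [by have := sqr_ge0 d; lra|by have := mulr_ge0 (ltW B0) sd0; lra|lra|].
    by have := ler_wpM2l (ltW B0) sd1; lra.
  by rewrite -KE; exact: ler_wpM2l.
have main k d : 0 < d -> d <= 2 * d0 -> d0 < 2 ^+ k * d ->
    (d ^+ 2 + om d) * (1 + B * Num.sqrt d) <= K * d ^+ 2.
  elim: k d => [|k IH] d dp d2 dk.
    by apply: base; [move: dk; rewrite expr0 mul1r|lra].
  have [dd|dd] := ltP d0 d; first by apply: base => //; lra.
  have IHd : ((2 * d) ^+ 2 + om (2 * d)) * (1 + B * Num.sqrt (2 * d)) <= K * (2 * d) ^+ 2.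
    by apply: IH; [lra|lra|rewrite mulrA -exprSr].
  have h := dbl d dp; move: h => /(_ _)h; have {}h := h ltac:(lra).
  have sv := d0v d dp dd; have s0 := sqrtr_ge0 d; have ss := s2 d dp.
  have /andP[ o0 _] := hK0 d dp ltac:(lra).
  have /andP[ o20 _] := hK0 (2 * d) ltac:(lra) ltac:(lra).
  set v := Num.sqrt d in h sv s0 ss *; set v2 := Num.sqrt (2 * d) in IHd ss.
  set Rd := d ^+ 2 + om d in h *.
  have dd2 := sqr_ge0 d.
  have Rd0 : 0 <= Rd by rewrite /Rd; lra.
  set R2 := (2 * d) ^+ 2 + om (2 * d) in IHd.
  have R20 : 0 <= R2 by rewrite /R2; have := sqr_ge0 (2 * d); lra.
  have vd2 := mulr_ge0 s0 dd2.
  have h1 : (4 - C4 * v) * Rd <= (1 + v) * R2.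
    by move: h; rewrite /Rd /R2; lra.
  have vB : v * (2 * B * (C4 + 2)) <= 1.
    by rewrite -[leRHS]v0E; apply: ler_wpM2r sv; rewrite !mulr_ge0//; lra.
  have Bv := mulr_ge0 (ltW B0) s0; have Cv := mulr_ge0 C40 s0.
  have BCv := mulr_ge0 (ltW B0) Cv.
  have Cv1 : C4 * v <= 1.
    by have : 1 * (C4 * v) <= B * (C4 * v); [apply: ler_wpM2r => //; rewrite /B; lra|lra].
  have h2 : 4 * ((1 + v) * (1 + B * v)) <= (4 - C4 * v) * (1 + B * v2).
    apply: (@le_trans _ _ ((4 - C4 * v) * (1 + B * (7 / 5 * v)))); last first.
      apply: ler_wpM2l; first by lra.
      by rewrite lerD2l; apply: ler_wpM2l => //; exact: ltW.
    have q1 : v * (v * (2 * B * (C4 + 2))) <= v * 1 by exact: ler_wpM2l.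
    have q2 := mulr_ge0 s0 Bv; have q3 := mulr_ge0 s0 BCv; rewrite /B in q1 q2 q3 *.
    have q4 := mulr_ge0 s0 Cv; have q5 := mulr_ge0 C40 q4; have q6 := mulr_ge0 s0 s0.
    by lra.
  have p4 : 0 < 4 - C4 * v by lra.
  rewrite -(ler_pM2l p4).
  have h3 : (4 - C4 * v) * (Rd * (1 + B * v)) <= ((1 + v) * R2) * (1 + B * v).
    by rewrite mulrA; apply: ler_wpM2r => //; lra.
  apply: (le_trans h3).
  have h4 : R2 * (4 * ((1 + v) * (1 + B * v))) <= R2 * ((4 - C4 * v) * (1 + B * v2)).
    exact: ler_wpM2l.
  have h5 := ler_wpM2l (ltW p4) IHd.
  by lra.
exists (K + K0 / d0 ^+ 2).
  by apply: addr_ge0 => //; apply: divr_ge0 => //; exact: ltW.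
move=> d dp d1; have d20 := sqr_ge0 d.
have KK : 0 <= K0 / d0 ^+ 2 by apply: divr_ge0 => //; exact: ltW.
have /andP[ o0 oK] := hK0 d dp d1.
have [dd|dd] := leP d (2 * d0).
  have h := main (Num.Def.archi_bound (d0 / d)) d dp dd.
  have {}h : (d ^+ 2 + om d) * (1 + B * Num.sqrt d) <= K * d ^+ 2.
    by apply: h; rewrite -ltr_pdivrMr//; exact: upper_nthrootP.
  have BB := mulr_ge0 (ltW B0) (sqrtr_ge0 d).
  have := mulr_ge0 (addr_ge0 d20 o0) BB; have := mulr_ge0 KK d20; lra.
have dd0 : d0 ^+ 2 <= d ^+ 2 by rewrite -subr_ge0 subr_sqr; apply: mulr_ge0; lra.
have := ler_wpM2l KK dd0; rewrite divfK ?gt_eqF//.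
by have := mulr_ge0 K_ge0 d20; lra.
Qed.

End EquiHolder.

(** * Gain of one derivative *)

Section RegularityStep.
Variables (R : realType) (n : nat) (alpha lambda : R) (m : nat)
  (F : 'I_n -> nat -> R -> R) (c0 C1 : R).
Hypothesis alpha_gt2 : 2 < alpha.
Hypothesis alpha_lt3 : alpha < 3.
Hypothesis lambda_gt0 : 0 < lambda.
Implicit Types (p q s : R -> R) (X Y : R -> R -> R) (eps c d z r u w y : R).
Local Notation wt := (wt alpha).
Local Notation En := (En alpha).
Hypothesis dF : forall i, dseq m (F i).
Hypothesis unitF : forall u, \sum_i F i 0%N u ^+ 2 = 1.
Hypothesis C1_gt0 : 0 < C1.
Hypothesis EF : forall i l eps, (l <= m)%N -> 0 < eps -> En eps (F i l) <= C1.
Hypothesis lowE : forall i l d eps, (l < m)%N -> 0 < d -> d <= 1 -> 0 < eps ->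
  En eps (fun x => F i l (x + d) - F i l x) <= C1 * d ^+ 2.
Hypothesis lowS : forall i l d u, (l < m)%N -> 0 < d -> d <= 1 ->
  `|F i l (u + d) - F i l u| <= C1 * d.
Hypothesis c0_gt0 : 0 < c0.
Hypothesis chordsq_ge : forall u w, W0 w -> c0 <= chordsq F u w.
Hypothesis EL : forall i (h k : R -> R), Ck 3 h -> isD h k ->
  J eps (ELint alpha F i k) @[eps --> 0^'+] --> - (lambda * int01 (fun u => F i 0%N u * k u)).

Let phi i := F i m.
Let dphi i d x := phi i (x + d) - phi i x.

Let cphi i : continuous (phi i).
Proof. by have [_ /(_ m (leqnn m))[]] := dF i. Qed.
Let pphi i : periodic (phi i).
Proof. by have [_ /(_ m (leqnn m))[]] := dF i. Qed.
Let cdphi i d : continuous (dphi i d). Proof. exact: cts_diff. Qed.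
Let pdphi i d : periodic (dphi i d). Proof. exact: periodic_diff. Qed.

Definition L2diff d := \sum_i int01 (fun x => dphi i d x ^+ 2).

Lemma int01_sqr_ge0 p : 0 <= int01 (fun x => p x ^+ 2).
Proof. by apply: int01_ge0 => x; exact: sqr_ge0. Qed.

Lemma L2diff_ge0 d : 0 <= L2diff d.
Proof. by apply: sumr_ge0 => i _; exact: int01_sqr_ge0. Qed.

Lemma L2diff_ge i d : int01 (fun x => dphi i d x ^+ 2) <= L2diff d.
Proof.
by rewrite /L2diff (bigD1 i)//= lerDl; apply: sumr_ge0 => j _; exact: int01_sqr_ge0.
Qed.

Lemma energy_diff_L2 : exists2 C3, 0 < C3 & forall d i eps, 0 < d -> d <= 1 -> 0 < eps ->
  En eps (dphi i d) <= C3 * (d ^+ 2 + L2diff d).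
Proof.
have a2 := alpha_gt2; have a3 := alpha_lt3.
have ap i := apriori alpha_gt2 alpha_lt3 lambda_gt0 dF unitF C1_gt0 EF lowE lowS c0_gt0 chordsq_ge EL i.
pose Ci i := sval (cid2 (ap i)).
have Ci0 i : 0 <= Ci i by rewrite /Ci; case: cid2.
have Ciap i : forall d z y, Zrel alpha m F d z -> 0 <= y ->
  (forall u, `|dphi i d u| <= y) -> forall eps, 0 < eps ->
  alpha * En eps (dphi i d) <= Ci i * y * z.
  by rewrite /Ci; case: cid2.
pose C := \sum_i Ci i.
have C0 : 0 <= C by exact: sumr_ge0.
(* Chosen so that 4 C th <= 1: the energy coming back on the right is then at most x2, against alpha
   x2 on the left, and alpha >= 2 leaves at least x2. *)
pose th := (4 * C + 4)^-1.
have th0 : 0 < th by rewrite invr_gt0; lra.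
have thE : th * (4 * C + 4) = 1 by rewrite mulVf// gt_eqF//; lra.
have th1 : th <= 1 by have := mulr_ge0 (ltW th0) C0; lra.
have b0 : 0 < (alpha - 2) / 2 by lra.
have [r1 r10 hr1] := small_powR b0 (morrey_cst_ge0 alpha_gt2) th0.
pose r := Num.min r1 12^-1.
have r0 : 0 < r by rewrite lt_min r10/=; lra.
have r12 : r <= 12^-1 by rewrite /r ge_min lexx orbT.
have rr1 : r <= r1 by rewrite /r ge_min lexx.
have hr := hr1 r (ltW r0) rr1.
pose D := r `^ (- 2^-1).
have D0 : 0 <= D by exact: powR_ge0.
pose C3 := alpha + C * (2 + th^-1) * D ^+ 2.
have thV : 0 < th^-1 by rewrite invr_gt0.
have CD0 : 0 <= C * (2 + th^-1) * D ^+ 2.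
  by apply: mulr_ge0; [apply: mulr_ge0 => //; lra|exact: sqr_ge0].
exists C3; first by rewrite /C3; lra.
move=> d i0 eps0 dp d1 eps00.
pose S i := [set En eps (dphi i d) | eps in [set eps : R | 0 < eps]].
have ubS i : ubound (S i) (4 * C1).
  move=> _ [eps /= e0 <-]; have cs := cts_shift d (@cphi i).
  have ps : periodic (fun x => phi i (x + d)) by move=> x; rewrite addrAC pphi.
  apply: (le_trans (En_sub_le a2 e0 cs ps (@cphi i) (@pphi i))).
  by rewrite En_shift//; have := EF i (leqnn m) e0; rewrite -/(phi i); lra.
have hS i : has_sup (S i).
  split; last by exists (4 * C1); exact: ubS.
  by exists (En 1 (dphi i d)); exists 1 => //=; exact: ltr01.
pose e i := sup (S i).
have he i eps : 0 < eps -> En eps (dphi i d) <= e i.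
  by move=> e0; apply: (sup_upper_bound (hS i)); exists eps.
have e0 i : 0 <= e i by apply: le_trans (he i 1 ltr01); apply: En_ge0.
(* Adding d^2 makes the quantity positive and gives d <= x, as [Zrel] demands. *)
pose x2 := \sum_i e i + d ^+ 2.
have d20 : 0 < d ^+ 2 by exact: exprn_gt0.
have se0 : 0 <= \sum_i e i by exact: sumr_ge0.
have x20 : 0 < x2 by rewrite /x2; lra.
have ei i : e i <= x2.
  have : e i <= \sum_j e j by rewrite (bigD1 i)//= lerDl; exact: sumr_ge0.
  by rewrite /x2; lra.
pose x := Num.sqrt x2; have x0 : 0 <= x by exact: sqrtr_ge0.
have xx : x ^+ 2 = x2 by rewrite sqr_sqrtr// ltW.
pose om := Num.sqrt (L2diff d); have om0 : 0 <= om by exact: sqrtr_ge0.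
have om2 : om ^+ 2 = L2diff d by rewrite sqr_sqrtr// L2diff_ge0.
pose y := th * x + D * om.
have tx := mulr_ge0 (ltW th0) x0; have Do := mulr_ge0 D0 om0.
have y0 : 0 <= y by rewrite /y; lra.
have hy i u : `|dphi i d u| <= y.
  have hE eps : 0 < eps -> En eps (dphi i d) <= x2.
    by move=> e0'; apply: le_trans (ei i); exact: he.
  apply: (le_trans (sup_le a2 a3 u r0 r12 (@cdphi i d) (@pdphi i d) x20 hE)).
  rewrite -/x -/D /y; apply: lerD.
    by rewrite mulrAC; apply: ler_wpM2r.
  rewrite mulrC; apply: ler_wpM2l => //.
  by rewrite ler_sqrt ?L2diff_ge0// L2diff_ge.
have dx : d <= x.
  by rewrite -[leLHS](ger0_norm (ltW dp)) -sqrtr_sqr /x ler_sqrt ?(ltW x20)// /x2; lra.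
have Z : Zrel alpha m F d (x + y).
  split=> //; first by lra.
    by move=> i u; apply: (le_trans (hy i u)); lra.
  move=> i eps ep; apply: (le_trans (he i eps ep)); apply: (le_trans (ei i)).
  by rewrite -xx -subr_ge0 subr_sqr; apply: mulr_ge0; lra.
have k1 i : alpha * e i <= Ci i * y * (x + y).
  have al0 : 0 < alpha by lra.
  rewrite -ler_pdivlMl//; apply: ge_sup; first by have [] := hS i.
  move=> _ [eps /= ep <-]; rewrite ler_pdivlMl//.
  exact: Ciap.
have k2 : alpha * \sum_i e i <= C * y * (x + y).
  by rewrite /C mulr_sumr !mulr_suml; apply: ler_sum => i _; exact: k1.
have k3 : y * (x + y) <= 4 * th * x2 + (2 + th^-1) * D ^+ 2 * om ^+ 2.
  rewrite -xx /y; set a := D * om in Do *.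
  have -> : (2 + th^-1) * D ^+ 2 * om ^+ 2 = (2 + th^-1) * a ^+ 2 by rewrite /a; ring.
  have ax : a * x <= th * x ^+ 2 + th^-1 * a ^+ 2.
    have := sqr_ge0 (th * x - a).
    have -> : (th * x - a) ^+ 2 = th * (th * x ^+ 2 + th^-1 * a ^+ 2 - 2 * (a * x)).
      by field; rewrite gt_eqF.
    rewrite (pmulr_rge0 _ th0); have := mulr_ge0 Do x0; lra.
  have q1 : (th * x + a) ^+ 2 <= 2 * th * x ^+ 2 + 2 * a ^+ 2.
    have s1 := sqr_ge0 (th * x - a).
    have s2 : th * (th * x ^+ 2) <= 1 * (th * x ^+ 2).
      by apply: ler_wpM2r => //; apply: mulr_ge0; [exact: ltW|exact: sqr_ge0].
    by lra.
  by lra.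
have k4 := ler_wpM2l C0 k3.
have Cx : C * (4 * th * x2) <= x2.
  have -> : C * (4 * th * x2) = (th * (4 * C + 4) - 4 * th) * x2 by ring.
  rewrite thE -[leRHS]mul1r; apply: ler_wpM2r; [exact: ltW|lra].
rewrite om2 in k3 k4.
have k5 : \sum_i e i = x2 - d ^+ 2 by rewrite /x2; ring.
have k6 : x2 <= alpha * d ^+ 2 + C * (2 + th^-1) * D ^+ 2 * L2diff d.
  have : alpha * (x2 - d ^+ 2) <= x2 + C * (2 + th^-1) * D ^+ 2 * L2diff d.
    by rewrite -k5; apply: (le_trans k2); move: k4; lra.
  have : 0 <= (alpha - 2) * x2 by apply: mulr_ge0; [lra|exact: ltW].
  by lra.
apply: (le_trans (he i0 eps0 eps00)); apply: (le_trans (ei i0)); apply: (le_trans k6).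
have L0 := L2diff_ge0 d.
have := mulr_ge0 CD0 (ltW d20); have := mulr_ge0 (ltW (lt_trans (ltr0n _ 2) a2)) L0.
by rewrite /C3; lra.
Qed.

Lemma L2diff_bounded : exists2 K0, 0 <= K0 & forall d, L2diff d <= K0.
Proof.
have bd i : exists B, forall x, `|phi i x| <= B by exact: periodic_bounded.
pose B i := sval (cid (bd i)); have hB i x : `|phi i x| <= B i := svalP (cid (bd i)) x.
have B0 i : 0 <= B i by apply: le_trans (hB i 0).
exists (\sum_i 4 * B i ^+ 2).
  by apply: sumr_ge0 => i _; rewrite mulr_ge0// sqr_ge0.
move=> d; apply: ler_sum => i _; rewrite -[leRHS]int01_cst; apply: int01_le.
- exact: cts_sqr.
- exact: cts_cst.
move=> x; have h : `|dphi i d x| <= 2 * B i.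
  by apply: (le_trans (ler_normB _ _)); have := hB i x; have := hB i (x + d); lra.
rewrite -real_normK ?num_real//.
have -> : 4 * B i ^+ 2 = (2 * B i) ^+ 2 by ring.
by rewrite ler_pXn2r ?nnegrE//; have := B0 i; lra.
Qed.

Lemma L2diff_doubling : exists2 C4, 0 <= C4 & forall d, 0 < d -> d <= 12^-1 ->
  4 * L2diff d <= (1 + Num.sqrt d) * L2diff (2 * d) + C4 * Num.sqrt d * (d ^+ 2 + L2diff d).
Proof.
have a2 := alpha_gt2; have a3 := alpha_lt3.
have [C3 C30 hC3] := energy_diff_L2.
pose A := 16 * 3 `^ alpha * C3.
have A0 : 0 <= A by rewrite !mulr_ge0 ?powR_ge0// ltW.
exists (n%:R * (2 * A)).
  by apply: mulr_ge0; [exact: ler0n|lra].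
(* Young's parameter t = sqrt d is balanced for the second difference q: up to a common factor its
   squared L^2 norm is at most d, and (1 + t^-1) d <= 2 t. *)
move=> d d0 d12; set t := Num.sqrt d.
have t0 : 0 < t by rewrite sqrtr_gt0.
have tt : t * t = d by rewrite -expr2 sqr_sqrtr// ltW.
have t1 : t <= 1 by rewrite -[leRHS]sqrtr1 ler_sqrt//; lra.
pose E := C3 * (d ^+ 2 + L2diff d).
have L0 := L2diff_ge0 d.
have d20 : 0 < d ^+ 2 by exact: exprn_gt0.
have E0 : 0 < E by rewrite /E mulr_gt0//; lra.
have dd : d `^ (alpha - 1) <= d.
  rewrite -[leRHS](powRr1 (ltW d0)); apply: ger_powR; lra.
have h i : 4 * int01 (fun x => dphi i d x ^+ 2) <=
    (1 + t) * int01 (fun x => dphi i (2 * d) x ^+ 2) + 2 * A * t * (d ^+ 2 + L2diff d).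
  pose q x := dphi i d (x + d) - dphi i d x.
  have cq : continuous q by apply: cts_diff; exact: cdphi.
  have hq : int01 (fun x => q x ^+ 2) <= A * (d ^+ 2 + L2diff d) * d.
    have d6 : d <= 6^-1 by lra.
    have d1 : d <= 1 by lra.
    have hE eps : 0 < eps -> En eps (dphi i d) <= E by move=> e0; exact: hC3.
    apply: (le_trans (L2_modulus_le a2 d0 d6 (@cdphi i d) (@pdphi i d) E0 hE)).
    rewrite /A /E (_ : 16 * 3 `^ alpha * (C3 * (d ^+ 2 + L2diff d)) =
      16 * 3 `^ alpha * C3 * (d ^+ 2 + L2diff d)); last by ring.
    apply: ler_wpM2l dd; apply: mulr_ge0; first exact: A0.
    by lra.
  have qE x : q x = dphi i (2 * d) x - 2 * dphi i d x.
    by rewrite /q /dphi (_ : x + d + d = x + 2 * d); ring.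
  have tV : 0 < t^-1 by rewrite invr_gt0.
  have pt x : 4 * dphi i d x ^+ 2 <= (1 + t) * dphi i (2 * d) x ^+ 2 + (1 + t^-1) * q x ^+ 2.
    rewrite -[4 * _ ^+ 2](_ : (dphi i (2 * d) x - q x) ^+ 2 = _); last by rewrite qE; ring.
    set a := dphi i (2 * d) x; set b := q x.
    have : 0 <= t * (a + t^-1 * b) ^+ 2 by apply: mulr_ge0; [exact: ltW|exact: sqr_ge0].
    have -> : t * (a + t^-1 * b) ^+ 2 = t * a ^+ 2 + 2 * (a * b) + t^-1 * b ^+ 2.
      by field; rewrite gt_eqF.
    by lra.
  have c1 := cts_sqr (@cdphi i d); have c2 := cts_sqr (@cdphi i (2 * d)); have c3 := cts_sqr cq.
  have := int01_le (cts_scale 4 c1) (cts_add (cts_scale (1 + t) c2) (cts_scale (1 + t^-1) c3)) pt.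
  rewrite int01D; [|exact: cts_scale|exact: cts_scale]; rewrite !int01Z// => hh.
  apply: (le_trans hh); rewrite lerD2l.
  have tV1 : 0 <= 1 + t^-1 by lra.
  apply: (le_trans (ler_wpM2l tV1 hq)).
  have -> : (1 + t^-1) * (A * (d ^+ 2 + L2diff d) * d) =
     (A * (d ^+ 2 + L2diff d)) * (t * t + t).
    by rewrite -{3}tt; field; rewrite gt_eqF.
  have -> : 2 * A * t * (d ^+ 2 + L2diff d) = (A * (d ^+ 2 + L2diff d)) * (2 * t) by ring.
  apply: ler_wpM2l; first by apply: mulr_ge0 => //; lra.
  have := ler_wpM2l (ltW t0) t1; lra.
rewrite /L2diff mulr_sumr; apply: (le_trans (ler_sum _ (fun i _ => h i))).
rewrite big_split/= -mulr_sumr sumr_const card_ord -/(L2diff d) -mulr_natl.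
rewrite lerD2l le_eqVlt; apply/orP; left; apply/eqP; ring.
Qed.

Lemma En_scale eps c p : 0 < eps -> continuous p -> periodic p ->
  En eps (fun x => c * p x) = c ^+ 2 * En eps p.
Proof.
move=> e0 cp pp; have a := adm_wtM alpha_gt2 (adm_cov cp pp cp pp).
rewrite /En -(JZ _ e0 a); apply: J_eq => u w _.
by rewrite covZl ?covZr//; [ring|exact: cts_scale].
Qed.

Lemma regularity_step : exists2 C2, 0 < C2 &
  [/\ forall i d eps, 0 < d -> d <= 1 -> 0 < eps ->
        En eps (fun x => F i m (x + d) - F i m x) <= C2 * d ^+ 2,
      forall i d u, 0 < d -> d <= 1 -> `|F i m (u + d) - F i m u| <= C2 * d &
      forall i, exists psi : R -> R, [/\ isD (F i m) psi, continuous psi, periodic psi &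
        forall eps, 0 < eps -> En eps psi <= C2]].
Proof.
have a2 := alpha_gt2; have a3 := alpha_lt3.
have K' (x c d e a : R) : x <= c + d -> c <= a -> d <= e -> x <= a + e by lra.
have [C3 C30 hC3] := energy_diff_L2.
have [C4 C40 hC4] := L2diff_doubling.
have [K0 K00 hK0] := L2diff_bounded.
have [|K K_ge0 hK] := @doubling_decay R L2diff C4 K0 C40 K00 _ hC4.
  by move=> d _ _; rewrite L2diff_ge0 hK0.
pose A := C3 * (1 + K).
have A0 : 0 < A by rewrite mulr_gt0//; lra.
have hE i d eps : 0 < d -> d <= 1 -> 0 < eps -> En eps (dphi i d) <= A * d ^+ 2.
  move=> d0 d1 e0; apply: (le_trans (hC3 d i eps d0 d1 e0)).
  rewrite /A -mulrA; apply: ler_wpM2l; first exact: ltW.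
  by have := hK d d0 d1; lra.
pose b := (alpha - 2) / 2.
have b0 : 0 < b by rewrite /b; lra.
pose M := morrey_cst alpha * Num.sqrt A.
have M0 : 0 <= M by rewrite mulr_ge0 ?sqrtr_ge0 ?morrey_cst_ge0.
have w120 : (0 : R) < 12^-1 by lra.
(* This is [sup_le] at the fixed scale 12^-1, for increments of energy at most A d^2 and squared L^2
   norm at most K d^2. *)
pose S := M * 12^-1 `^ b + Num.sqrt K * 12^-1 `^ (- 2^-1).
have S0 : 0 <= S by rewrite addr_ge0// mulr_ge0 ?powR_ge0 ?sqrtr_ge0.
have sqd d c : 0 < d -> 0 <= c -> Num.sqrt (c * d ^+ 2) = Num.sqrt c * d.
  by move=> d0 c0'; rewrite sqrtrM// sqrtr_sqr gtr0_norm.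
have hS i d u : 0 < d -> d <= 1 -> `|dphi i d u| <= S * d.
  move=> d0 d1; have E0 : 0 < A * d ^+ 2 by rewrite mulr_gt0// exprn_gt0.
  have hE' eps : 0 < eps -> En eps (dphi i d) <= A * d ^+ 2 by exact: hE.
  apply: (le_trans (sup_le a2 a3 u w120 (lexx _) (@cdphi i d) (@pdphi i d) E0 hE')).
  rewrite -/b sqd ?(ltW A0)// /S mulrDl; apply: lerD; first by rewrite /M; lra.
  rewrite [leRHS]mulrAC; apply: ler_wpM2r; first exact: powR_ge0.
  rewrite -sqd// ler_sqrt; last by rewrite mulr_ge0// sqr_ge0.
  by apply: (le_trans (L2diff_ge i d)); exact: hK.
exists (A + S + 1); first by lra.
split.
- move=> i d eps d0 d1 e0; apply: (le_trans (hE i d eps d0 d1 e0)).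
  by apply: ler_wpM2r; [exact: sqr_ge0|lra].
- move=> i d u d0 d1; apply: (le_trans (hS i d u d0 d1)).
  by apply: ler_wpM2r; [exact: ltW|lra].
move=> i.
have hol d u r : 0 < d -> d <= 1 -> 0 < r -> r <= 12^-1 ->
    `|dphi i d (u + r) - dphi i d u| <= M * d * r `^ b.
  move=> d0 d1 r0 r12; have E0 : 0 < A * d ^+ 2 by rewrite mulr_gt0// exprn_gt0.
  have hE' eps : 0 < eps -> En eps (dphi i d) <= A * d ^+ 2 by exact: hE.
  have [_ h] := morrey_scalar a2 a3 (@cdphi i d) (@pdphi i d) E0 hE'.
  by have := h u r r0 r12; rewrite -/b sqd ?(ltW A0)// mulrA.
have [|psi [Dpsi cpsi hpsi]] := @C1_of_equiholder R (phi i) M b 12^-1 (@cphi i) w120 b0 M0.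
  move=> u r w r0 r12 w0 w12; have w1 : w <= 1 by lra.
  rewrite -mulrBl normrM [`|w^-1|]gtr0_norm ?invr_gt0// ler_pdivrMr//.
  by have := hol w u r w0 w1 r0 r12; rewrite /dphi; lra.
have ppsi : periodic psi.
  have := isD_shift 1 Dpsi; have -> : (fun x => phi i (x + 1)) = phi i.
    by apply/funext => x; exact: pphi.
  by move=> /isD_uniq/(_ Dpsi).
exists psi; split=> // eps e0.
have b12 : 12^-1 `^ b <= 1 :> R.
  rewrite [leRHS](_ : 1 = 1 `^ b); last by rewrite powR1.
  by apply: ge0_ler_powR; rewrite ?nnegrE; lra.
have ha u w : 0 < w -> w <= 12^-1 -> `|w^-1 * dphi i w u| <= S.
  move=> w0 w12; rewrite normrM gtr0_norm ?invr_gt0// mulrC ler_pdivrMr//.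
  by apply: hS => //; lra.
have hpb u : `|psi u| <= S + 2 * M.
  have h1 := hpsi u 12^-1 w120 (lexx _); have h2 := ha u 12^-1 w120 (lexx _).
  have h3 := ler_wpM2l M0 b12.
  rewrite mulrC in h2; have := ler_distD ((phi i (u + 12^-1) - phi i u) / 12^-1) (psi u) 0.
  by rewrite !subr0 distrC in h1 *; rewrite /dphi in h2; lra.
(* At fixed eps, psi is the uniform limit of the difference quotients of [phi i]; by quadratic
   scaling their energies are at most A. *)
apply: (@le_trans _ _ A); last by lra.
apply/ler_addgt0Pr => e ep.
set Jw := J eps (fun _ w => wt w).
have Jw0 : 0 <= Jw by apply: J_ge0 => u w _; exact: wt_ge0.
pose y := S + 2 * M; have y0 : 0 <= y by rewrite /y; lra.
pose N := 4 * y * (2 * M) * Jw.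
have M20 : 0 <= 2 * M by lra.
have y40 : 0 <= 4 * y by lra.
have N0 : 0 <= N := mulr_ge0 (mulr_ge0 y40 M20) Jw0.
have [w1 w10 hw1] := small_powR b0 N0 ep.
pose w := Num.min w1 12^-1.
have w0 : 0 < w by rewrite lt_min w10/=; lra.
have w12 : w <= 12^-1 by rewrite /w ge_min lexx orbT.
have ww1 : w <= w1 by rewrite /w ge_min lexx.
have ca : continuous (fun x => w^-1 * dphi i w x) by apply: cts_scale; exact: cdphi.
have pa : periodic (fun x => w^-1 * dphi i w x) by move=> x; rewrite pdphi.
have t0 : 0 <= 2 * M * w `^ b := mulr_ge0 M20 (powR_ge0 _ _).
have close x : `|w^-1 * dphi i w x - psi x| <= 2 * M * w `^ b.
  by have := hpsi x w w0 w12; rewrite mulrC.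
have hya x : `|w^-1 * dphi i w x| <= y by apply: (le_trans (ha x w w0 w12)); rewrite /y; lra.
have := En_close a2 e0 y0 t0 ca pa cpsi ppsi hya hpb close.
rewrite -/Jw En_scale// => h1.
have h2 : w^-1 ^+ 2 * En eps (dphi i w) <= A.
  rewrite exprVn mulrC ler_pdivrMr ?exprn_gt0//.
  by apply: hE w0 (le_trans w12 _) e0; rewrite invf_le1 ?ler1n.
have h3 := hw1 w (ltW w0) ww1.
have h4 : 4 * y * (2 * M * w `^ b) * Jw = N * w `^ b by rewrite /N; ring.
by rewrite h4 in h1; exact: K' h1 h2 h3.
Qed.

End RegularityStep.

(** * Induction on the order of differentiability *)

Section Bootstrap.
Variables (R : realType) (n : nat) (alpha lambda : R) (f : 'I_n -> R -> R) (c0 E0 : R).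
Hypothesis alpha_gt2 : 2 < alpha.
Hypothesis alpha_lt3 : alpha < 3.
Hypothesis lambda_gt0 : 0 < lambda.
Local Notation En := (En alpha).
Let F i l := derive1n l (f i).
Hypothesis cf : forall i, continuous (f i).
Hypothesis pf : forall i, periodic (f i).
Hypothesis unitf : forall u, \sum_i f i u ^+ 2 = 1.
Hypothesis E0_gt0 : 0 < E0.
Hypothesis Ef : forall i eps, 0 < eps -> En eps (f i) <= E0.
Hypothesis c0_gt0 : 0 < c0.
Hypothesis chordsq_ge : forall u w, W0 w -> c0 <= chordsq F u w.
Hypothesis EL : forall i (h k : R -> R), Ck 3 h -> isD h k ->
  J eps (ELint alpha F i k) @[eps --> 0^'+] --> - (lambda * int01 (fun u => F i 0%N u * k u)).

(** One constant must serve all orders up to m, so each step adds its own. The bounds on increments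
    that [regularity_step] returns for order m become the low-order hypotheses of the next step. *)
Lemma bootstrap m : exists2 C1, 0 < C1 & [/\ forall i, dseq m (F i),
  forall i l eps, (l <= m)%N -> 0 < eps -> En eps (F i l) <= C1,
  forall i l d eps, (l < m)%N -> 0 < d -> d <= 1 -> 0 < eps ->
    En eps (fun x => F i l (x + d) - F i l x) <= C1 * d ^+ 2 &
  forall i l d u, (l < m)%N -> 0 < d -> d <= 1 ->
    `|F i l (u + d) - F i l u| <= C1 * d].
Proof.
elim: m => [|m [C1 C10 [dF EF lowE lowS]]].
  exists E0 => //; split=> // [i|i l eps]; last by rewrite leqn0 => /eqP->; exact: Ef.
  split=> // l; rewrite leqn0 => /eqP->; split; [exact: cf|exact: pf].
have [C2 C20 [stE stS stD]] := regularity_step alpha_gt2 alpha_lt3 lambda_gt0 dF unitf C10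
  EF lowE lowS c0_gt0 chordsq_ge EL.
have FE i psi : isD (F i m) psi -> F i m.+1 = psi.
  by move=> h; apply/funext => x; rewrite /F derive1nS derive1E; have [_ ->] := h x.
have dE (d : R) : C1 * d ^+ 2 <= (C1 + C2) * d ^+ 2 /\ C2 * d ^+ 2 <= (C1 + C2) * d ^+ 2.
  by split; apply: ler_wpM2r; rewrite ?sqr_ge0//; lra.
have dS (d : R) : 0 < d -> C1 * d <= (C1 + C2) * d /\ C2 * d <= (C1 + C2) * d.
  by move=> d0; split; apply: ler_wpM2r; rewrite ?(ltW d0)//; lra.
exists (C1 + C2); first by lra.
split.
- move=> i; have [hD cD] := dF i; have [psi [D1 c1 p1 _]] := stD i; split=> l.
    rewrite ltnS leq_eqVlt => /predU1P[->|]; last exact: hD.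
    by rewrite (FE _ _ D1).
  rewrite leq_eqVlt => /predU1P[->|]; last exact: cD.
  by rewrite (FE _ _ D1).
- move=> i l eps; rewrite leq_eqVlt => /predU1P[->|lm] e0.
    have [psi [D1 _ _ hE]] := stD i; rewrite (FE _ _ D1).
    by have := hE eps e0; lra.
  by have := EF i l eps lm e0; lra.
- move=> i l d eps; rewrite ltnS leq_eqVlt => /predU1P[->|lm] d0 d1 e0.
    by apply: (le_trans (stE i d eps d0 d1 e0)); have [] := dE d.
  by apply: (le_trans (lowE i l d eps lm d0 d1 e0)); have [] := dE d.
- move=> i l d u; rewrite ltnS leq_eqVlt => /predU1P[->|lm] d0 d1.
    by apply: (le_trans (stS i d u d0 d1)); have [] := dS d d0.
  by apply: (le_trans (lowS i l d u lm d0 d1)); have [] := dS d d0.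
Qed.

End Bootstrap.

(** * Comparison of integrals up to null sets *)

Section MeasureLemmas.
Variable R : realType.
Local Notation leb := (@lebesgue_measure R).

(* No measurability is needed: the integral of a nonnegative function is a supremum
   over the simple functions below it. *)
Lemma ge0_le_integral_any d (T : measurableType d) (mu : {measure set T -> \bar R})
    (D : set T) (f1 f2 : T -> \bar R) :
  (forall x, D x -> (0 <= f1 x)%E) -> (forall x, D x -> (f1 x <= f2 x)%E) ->
  (\int[mu]_(x in D) f1 x <= \int[mu]_(x in D) f2 x)%E.
Proof.
move=> f10 f12; rewrite !ge0_integralE//; last first.
  by move=> x Dx; apply: le_trans (f12 x Dx); exact: f10.
apply: le_ereal_sup => _ [h /= hf <-]; exists h => // x.
apply: (le_trans (hf x)); rewrite /patch; case: ifPn => //.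
by rewrite inE; exact: f12.
Qed.

(** The null set is removed from the integral of the measurable v; f then has to dominate v on the
    complement only. *)
Lemma ae_le_integral (D N : set R) (v f : R -> \bar R) : measurable D -> measurable N ->
  leb N = 0%E -> measurable_fun D v -> (forall x, D x -> (0 <= v x)%E) ->
  (forall x, D x -> (0 <= f x)%E) -> (forall x, D x -> ~ N x -> (v x <= f x)%E) ->
  (\int[leb]_(x in D) v x <= \int[leb]_(x in D) f x)%E.
Proof.
move=> mD mN N0 mv v0 f0 vf.
rewrite (@ge0_negligible_integral _ _ _ leb _ _ _ mN mD mv v0 N0) integral_mkcond [leRHS]integral_mkcond.
apply: ge0_le_integral_any => x _; rewrite /patch.
  by case: ifPn => //; rewrite inE => -[Dx _]; exact: v0.
case: ifPn => [|_]; first by rewrite inE => -[Dx nN]; rewrite mem_set//; exact: vf.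
by case: ifPn => //; rewrite inE; exact: f0.
Qed.

(** The integral of f is squeezed: from above by that of the function equal to +oo on a measurable
    null set and to 1 elsewhere, from below by [ae_le_integral]. *)
Lemma Rintegral_ae_one (f : R -> R) a b : a <= b -> (forall x, 0 <= f x) ->
  {ae leb, forall x, f x = 1} -> Rintegral leb `[a, b] f = b - a.
Proof.
move=> ab f0 [N [mN N0 subN]].
have nN x : ~ N x -> f x = 1.
  by move=> h; apply: contrapT => k; apply: h; exact: subN.
have mD : measurable (`[a, b] : set R) by exact: measurable_itv.
have e1 : (\int[leb]_(x in `[a, b]) (1 : R)%:E)%E = (b - a)%:E.
  have := Rintegral_cst_itv 1 ab; rewrite mul1r /Rintegral => <-.
  by rewrite fineK//; apply: integrable_fin_num => //; exact: cts_integrable (cts_cst 1).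
rewrite /Rintegral; suff -> : (\int[leb]_(x in `[a, b]) (f x)%:E)%E = (b - a)%:E by [].
apply/eqP; rewrite eq_le; apply/andP; split.
  pose fU x : \bar R := if x \in N then +oo%E else 1%E.
  apply: (@le_trans _ _ (\int[leb]_(x in `[a, b]) fU x)%E).
    apply: ge0_le_integral_any => x _; first by rewrite lee_fin.
    by rewrite /fU; case: ifPn; [rewrite leey|rewrite notin_setE => /nN ->].
  have fU0 x : (0 <= fU x)%E by rewrite /fU; case: ifP.
  have mfU : measurable_fun setT fU.
    apply: measurable_fun_if => //; try exact: measurable_cst.
    apply: (measurable_fun_bool true); rewrite setTI.
    have -> : (fun x => x \in N) @^-1` [set true] = N; last exact: mN.
    by apply/seteqP; split=> x /=; [exact: set_mem|exact: mem_set].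
  have mfU' : measurable_fun (`[a, b] : set R) fU by exact: measurable_funTS.
  rewrite -e1 (@ge0_negligible_integral _ _ _ leb _ _ _ mN mD mfU' (fun x _ => fU0 x) N0).
  rewrite integral_mkcond [leRHS]integral_mkcond; apply: ge0_le_integral_any => x _.
    by rewrite /patch; case: ifP.
  rewrite /patch; case: ifPn => [|_]; last by case: ifP.
  by rewrite inE => -[Dx h]; rewrite mem_set// /fU memNset.
rewrite -e1; apply: (ae_le_integral mD mN N0) => //.
- by move=> x _; rewrite lee_fin.
- by move=> x _ /nN ->.
Qed.

(** Uniqueness of Lebesgue measure: the pushforward by a translation has the same values on
    half-open intervals. *)
Lemma leb_translate (A : set R) c : measurable A -> leb [set x | A (x + c)] = leb A.
Proof.
move=> mA.
have mf : measurable_fun [set: measurableTypeR R] ((fun x => x + c) : measurableTypeR R -> measurableTypeR R).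
  by apply: measurable_funD; [exact: measurable_id|exact: measurable_cst].
pose sh := (fun x => x + c) : measurableTypeR R -> measurableTypeR R.
have := @lebesgue_measure_unique R (pushforward leb sh).
move=> /(_ mf _ A mA) h; symmetry; apply: h.
move=> _ [[a b]] _ <-; rewrite /pushforward.
have E : sh @^-1` [set` `]a, b]] = [set` `](a - c), (b - c)]].
  by apply/seteqP; split=> x /=; rewrite !in_itv/= /sh ltrBlDr lerBrDr.
transitivity (leb [set` `](a - c), (b - c)]]); last by rewrite -E.
rewrite !lebesgue_measure_itv/= !lte_fin ltrD2r; case: ifP => // _.
by rewrite -!EFinB; congr EFin; ring.
Qed.

End MeasureLemmas.

(** * Lipschitz functions with almost everywhere bounded derivative *)

Section LipschitzAe.
Variable R : realType.
Local Notation leb := (@lebesgue_measure R).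
Implicit Types (q : R -> R) (L B a b x y : R).

Lemma lipschitz_cts q L : 0 <= L -> (forall x y, `|q x - q y| <= L * `|x - y|) -> continuous q.
Proof.
move=> L0 h; apply: (@holder_continuous R q 1 L 1) => // u r r0 _.
rewrite powRr1 ?(ltW r0)//; have := h (u + r) u.
by rewrite (_ : u + r - u = r); [rewrite (gtr0_norm r0)|ring].
Qed.

(* Dominated convergence is applied to the positive part of (difference quotient - B), which
   avoids the theory of absolutely continuous functions. *)
Lemma lipschitz_ae_le q L B a b : 0 <= L -> (forall x y, `|q x - q y| <= L * `|x - y|) ->
  {ae leb, forall x, derivable q x 1 /\ derive1 q x <= B} -> a < b ->
  q b - q a <= B * (b - a).
Proof.
move=> L0 hL hae ab; have cq := lipschitz_cts L0 hL.
pose tau k : R := k.+1%:R^-1.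
have tau0 k : 0 < tau k by rewrite invr_gt0 ltr0n.
have tau_cvg : tau k @[k --> \oo] --> (0 : R) by exact: cvg_harmonic.
pose D k x := (q (x + tau k) - q x) / tau k.
have cD k : continuous (D k).
  have := cts_scale (tau k)^-1 (cts_sub (cts_shift (tau k) cq) cq).
  by under eq_fun do rewrite mulrC.
have DL k x : `|D k x| <= L.
  rewrite normrM [`|(tau k)^-1|]gtr0_norm ?invr_gt0// ler_pdivrMr//.
  have := hL (x + tau k) x; rewrite (_ : x + tau k - x = tau k); last by ring.
  by rewrite [`|tau k|]gtr0_norm.
pose e k x := Num.max (D k x - B) 0.
have e0 k x : 0 <= e k x by rewrite /e le_max lexx orbT.
have eL k x : `|e k x| <= L + `|B|.
  rewrite ger0_norm// /e ge_max; apply/andP; split; last by rewrite addr_ge0.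
  have := DL k x; rewrite ler_norml => /andP[_ h]; have := ler_norm (- B); rewrite normrN.
  by lra.
have me k : measurable_fun setT (e k).
  apply: measurable_maxr; last exact: measurable_cst.
  by apply: continuous_measurable_fun; apply: cts_sub => //; exact: cts_cst.
have mD : measurable (`[a, b] : set R) by exact: measurable_itv.
have mfin : (leb `[a, b]%classic < +oo)%E by apply: compact_finite_measure; exact: segment_compact.
have ie k : leb.-integrable `[a, b] (EFin \o e k).
  apply: measurable_bounded_integrable; [exact: mD|exact: mfin|exact: measurable_funTS (me k)|].
  exists (L + `|B|); split; first exact: num_real.
  by move=> C hC x _ /=; apply: le_trans (ltW hC); exact: eL.
have ptw : {ae leb, forall x, `[a, b]%classic x -> (e k x)%:E @[k --> \oo] --> (0%:E : \bar R)}.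
  have [N [mN N0 sN]] := hae; exists N; split=> // x nx; apply: sN => -[dx hx]; apply: nx => _.
  apply: cvg_EFin; first by apply: nearW.
  apply/cvgrPdist_le => t t0.
  have : h^-1 *: (q (h *: 1 + x) - q x) @[h --> 0^'] --> derive1 q x.
    by rewrite derive1E; exact: dx.
  move=> /cvgrPdist_le/(_ t t0)[r /= r0 hr].
  near=> k.
  have tk : tau k < r.
    have : `|0 - tau k| < r by near: k; move/cvgrPdist_lt : tau_cvg; exact.
    by rewrite sub0r normrN gtr0_norm.
  have := hr (tau k); rewrite /ball_/= sub0r normrN gtr0_norm// => /(_ tk).
  rewrite gt_eqF// => /(_ isT); rewrite /GRing.scale/= mulr1 [_ + x]addrC mulrC -/(D k x) => hh.
  rewrite sub0r normrN ger0_norm// /e ge_max (ltW t0) andbT.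
  by move: hh; rewrite ler_norml => /andP[h1 _]; lra.
have ig : leb.-integrable `[a, b] (EFin \o (fun=> L + `|B|)) by exact: cts_integrable (cts_cst _).
have hg : {ae leb, forall x k, `[a, b]%classic x -> (`|(e k x)%:E| <= (EFin \o (fun=> L + `|B|)%R) x)%E}.
  by apply: aeW => x k _; rewrite lee_fin; exact: eL.
have [_ _ lim] := @dominated_convergence _ _ _ leb _ mD (fun k x => (e k x)%:E) (fun=> 0%:E)
   (EFin \o (fun=> L + `|B|))
   (fun k => (measurable_EFinP _ _).2 (measurable_funTS (me k))) (@measurable_cst _ _ _ _ _ _) ptw
   ig hg.
rewrite integral0 in lim.
have {}lim : Rintegral leb `[a, b] (e k) @[k --> \oo] --> (0 : R) by exact: fine_cvg lim.
apply/ler_addgt0Pr => t t0; near \oo => k.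
have h1 : Rintegral leb `[a, b] (e k) <= t / 2.
  have : `|0 - Rintegral leb `[a, b] (e k)| <= t / 2.
    by near: k; move/cvgrPdist_le : lim; apply; lra.
  by rewrite sub0r normrN ger0_norm//; apply: Rintegral_ge0 => x _; exact: e0.
have h2 : 2 * L * tau k <= t / 2.
  have M0 : 0 < t / 2 / (2 * L + 1) by rewrite divr_gt0//; lra.
  have : `|0 - tau k| <= t / 2 / (2 * L + 1).
    by near: k; move/cvgrPdist_le : tau_cvg; apply; rewrite !divr_gt0//; lra.
  rewrite sub0r normrN gtr0_norm// ler_pdivlMr; last by lra.
  by have := tau0 k; lra.
have hQ := isD_prim cq.
have hP : isD (fun x => (tau k)^-1 * (prim q (x + tau k) - prim q x)) (D k).
  apply: isD_ext (isDZ (tau k)^-1 (isDB (isD_shift (tau k) hQ) hQ)) => // x.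
  by rewrite mulrC.
have hI := FTC_Rintegral hP (@cD k) (ltW ab).
have hm x : `|(tau k)^-1 * (prim q (x + tau k) - prim q x) - q x| <= L * tau k.
  have lt : x < x + tau k by rewrite ltrDl.
  have [c /andP[c1 c2] ->] := isD_MVT hQ lt.
  have -> : (tau k)^-1 * (q c * (x + tau k - x)) = q c by field; rewrite gt_eqF.
  apply: (le_trans (hL c x)); apply: ler_wpM2l => //.
  by rewrite gtr0_norm ?subr_gt0// lerBlDl ltW.
have h3 : Rintegral leb `[a, b] (D k) <= B * (b - a) + Rintegral leb `[a, b] (e k).
  have ic : leb.-integrable `[a, b] (EFin \o (fun=> B)) by exact: cts_integrable (cts_cst B).
  rewrite -(Rintegral_cst_itv B (ltW ab)) -(RintegralD _ ic (ie k))//.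
  apply: le_Rintegral; [exact: mD|exact: (cts_integrable a b (@cD k))|exact: (integrableD _ ic (ie k))|].
  by move=> x _; rewrite -lerBlDl /e le_max lexx.
have := hm a; have := hm b; rewrite !ler_norml => /andP[b1 b2] /andP[a1 a2].
by move: h3; rewrite hI; lra.
Unshelve. all: by end_near. Qed.

End LipschitzAe.

(** * Metric properties of arc-length curves *)

Section Curve.
Variables (R : realType) (n : nat) (g : R -> 'rV[R]_n).
Local Notation leb := (@lebesgue_measure R).
Implicit Types (u v w : R).

Lemma dotp_ge0 (x : 'rV[R]_n) : 0 <= dotp x x.
Proof. by apply: sumr_ge0 => i _; rewrite -expr2 sqr_ge0. Qed.

Lemma enorm_ge0 (x : 'rV[R]_n) : 0 <= enorm x. Proof. exact: sqrtr_ge0. Qed.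

Lemma enorm_sqr (x : 'rV[R]_n) : enorm x ^+ 2 = dotp x x.
Proof. by rewrite sqr_sqrtr// dotp_ge0. Qed.

Lemma enorm_eq0 (x : 'rV[R]_n) : enorm x = 0 -> x = 0.
Proof.
move=> h; have : dotp x x = 0 by rewrite -enorm_sqr h expr0n.
move=> /eqP; rewrite psumr_eq0 => [/allP k|i _]; last by rewrite -expr2 sqr_ge0.
apply/rowP => i; rewrite mxE; apply/eqP; rewrite -sqrf_eq0 expr2.
by apply: k; rewrite mem_index_enum.
Qed.

Lemma dotp_CS (x y : 'rV[R]_n) : dotp x y <= enorm x * enorm y.
Proof.
have [/eqP ab|ab] := eqVneq (enorm x * enorm y) 0.
  move: ab; rewrite mulf_eq0 => /orP[] /eqP h; have h0 := enorm_eq0 h; rewrite h mul0r || rewrite h mulr0;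
  by rewrite /dotp big1// => i _; rewrite h0 mxE ?mul0r ?mulr0.
have p0 : 0 < enorm x * enorm y by rewrite lt0r ab mulr_ge0 ?enorm_ge0.
have : 0 <= \sum_i (enorm y * x ord0 i - enorm x * y ord0 i) ^+ 2.
  by apply: sumr_ge0 => i _; exact: sqr_ge0.
have -> : \sum_i (enorm y * x ord0 i - enorm x * y ord0 i) ^+ 2 =
    2 * (enorm x * enorm y) * (enorm x * enorm y - dotp x y).
  rewrite (eq_bigr (fun i => enorm y ^+ 2 * (x ord0 i * x ord0 i) + enorm x ^+ 2 * (y ord0 i * y ord0 i)
    - 2 * (enorm x * enorm y) * (x ord0 i * y ord0 i))); last by move=> i _; ring.
  rewrite sumrB big_split/= -!mulr_sumr -/(dotp x x) -/(dotp y y) -/(dotp x y) -!enorm_sqr.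
  by ring.
have p20 : 0 < 2 * (enorm x * enorm y) by lra.
by rewrite (pmulr_rge0 _ p20) subr_ge0.
Qed.

Definition component i u := g u ord0 i.

Hypothesis g_lip : lipschitz_curve g.
Hypothesis g_arc : arclength_param g.

Lemma periodic_comp i : periodic (component i).
Proof. by move=> u; have [h _] := g_lip; rewrite /component h. Qed.

(** With e = g v - g u, the function <e, g> has derivative at most |e| almost everywhere by
    Cauchy-Schwarz, so |e|^2 <= |e| (v - u). *)
Lemma lip1 u v : u < v -> \sum_i (component i v - component i u) ^+ 2 <= (v - u) ^+ 2.
Proof.
move=> uv; set e := g v - g u.
have eE : \sum_i (component i v - component i u) ^+ 2 = enorm e ^+ 2.
  by rewrite enorm_sqr /dotp; apply: eq_bigr => i _; rewrite /e !mxE -expr2.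
pose q x := dotp e (g x).
have [_ [L0 hL0]] := g_lip.
pose L := `|L0|; have hL x y : enorm (g x - g y) <= L * `|x - y|.
  by apply: (le_trans (hL0 x y)); apply: ler_wpM2r => //; exact: ler_norm.
have dotpB x y z : dotp x (y - z) = dotp x y - dotp x z.
  by rewrite /dotp -sumrB; apply: eq_bigr => i _; rewrite !mxE mulrBr.
have qL x y : `|q x - q y| <= enorm e * L * `|x - y|.
  have K a b : q a - q b <= enorm e * L * `|a - b|.
    rewrite /q -dotpB; apply: (le_trans (dotp_CS _ _)); rewrite -mulrA.
    by apply: ler_wpM2l; [exact: enorm_ge0|exact: hL].
  by rewrite ler_norml K andbT lerNl opprB distrC K.
have : q v - q u <= enorm e * (v - u).
  apply: (@lipschitz_ae_le R q (enorm e * L)) => //; first by apply: mulr_ge0; [exact: sqrtr_ge0|exact: normr_ge0].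
  have [N [mN N0 sN]] := g_arc; exists N; split=> // x nx; apply: sN => -[dx n1]; apply: nx.
  have dxi i : derivable (fun x => g x ord0 i) x 1 by have /derivable_mxP := dx; exact.
  have gx i : 'D_1 (fun x => g x ord0 i) x = derive1 g x ord0 i.
    by rewrite derive1E derive_mx// mxE.
  have D : is_derive x (1:R) q (dotp e (derive1 g x)).
    have -> : q = (\sum_i (fun x => e ord0 i *: g x ord0 i)).
      by apply/funext => z; rewrite fct_sumE.
    apply: is_derive_sum => i; rewrite -gx.
    by apply: is_deriveZ; exact: derivableP.
  split; first by case: D.
  by rewrite derive1E; case: D => _ ->; rewrite (le_trans (dotp_CS _ _))// n1 mulr1.
rewrite /q -dotpB -/e -enorm_sqr eE => h.
have [e0|e0] := eqVneq (enorm e) 0; first by rewrite e0 expr0n sqr_ge0.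
have ep : 0 < enorm e by rewrite lt0r e0 enorm_ge0.
have : enorm e <= v - u by rewrite -(ler_pM2l ep) -expr2.
move=> k; rewrite ler_pXn2r ?nnegrE ?enorm_ge0//; lra.
Qed.

Lemma lip1_norm u w : \sum_i (component i (u + w) - component i u) ^+ 2 <= w ^+ 2.
Proof.
have [w0|w0|->] := ltgtP w 0.
- have uw : u + w < u by lra.
  have := lip1 uw; rewrite (_ : (u - (u + w)) ^+ 2 = w ^+ 2); last by ring.
  by under eq_bigr do rewrite -sqrrN opprB.
- have uw : u < u + w by lra.
  by have := lip1 uw; rewrite (_ : (u + w - u) ^+ 2 = w ^+ 2)//; ring.
- by rewrite addr0 big1 ?sqr_ge0// => i _; rewrite subrr expr0n.
Qed.

Lemma comp_lip i u w : `|component i (u + w) - component i u| <= `|w|.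
Proof.
rewrite -(@ler_pXn2r _ 2) ?nnegrE// !real_normK ?num_real//.
apply: le_trans (lip1_norm u w).
by rewrite (bigD1 i)//= lerDl; apply: sumr_ge0 => j _; exact: sqr_ge0.
Qed.

Lemma cts_comp i : continuous (component i).
Proof.
apply: (@lipschitz_cts R _ 1) => // x y; rewrite mul1r.
by have := comp_lip i y (x - y); rewrite (_ : y + (x - y) = x)//; ring.
Qed.

Lemma enorm_deriv_ae : {ae leb, forall x, enorm (derive1 g x) = 1}.
Proof.
have [N [mN N0 sN]] := g_arc; exists N; split=> // x nx; apply: sN => -[_ h].
exact: nx.
Qed.

(** The total length is 1, so the arc of length |w| <= 1/2 is the shorter of the two. *)
Lemma intr_distE u w : `|w| <= 1/2 -> intr_dist g u w = `|w|.
Proof.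
move=> w2; rewrite /intr_dist.
have -> : curve_length g = 1.
  by rewrite /curve_length Rintegral_ae_one ?subr0//; [move=> x; exact: enorm_ge0|exact: enorm_deriv_ae].
have -> : arc_length g u w = `|w|.
  rewrite /arc_length Rintegral_ae_one; last 3 first.
  - by rewrite ge_min le_max lexx.
  - by move=> x; exact: enorm_ge0.
  - exact: enorm_deriv_ae.
  have [w0|w0] := leP 0 w.
    by rewrite ger0_norm// max_r ?min_l; lra.
  by rewrite ltr0_norm// max_l ?min_r; lra.
by rewrite min_l//; lra.
Qed.

Definition chord2 u w := \sum_i (component i (u + w) - component i u) ^+ 2.

Lemma chord2_ge0 u w : 0 <= chord2 u w.
Proof. by apply: sumr_ge0 => i _; exact: sqr_ge0. Qed.

Lemma enorm_chord u w : enorm (g (u + w) - g u) = Num.sqrt (chord2 u w).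
Proof.
by rewrite /enorm /dotp; congr Num.sqrt; apply: eq_bigr => i _; rewrite !mxE -expr2.
Qed.

Lemma chord_le u w : enorm (g (u + w) - g u) <= `|w|.
Proof. by rewrite enorm_chord -sqrtr_sqr ler_sqrt ?sqr_ge0//; exact: lip1_norm. Qed.

End Curve.

(** * Testing the finite energy with measurable minorants *)

Section EnergyBound.
Variables (R : realType) (n : nat) (alpha : R) (g : R -> 'rV[R]_n).
Local Notation leb := (@lebesgue_measure R).
Implicit Types (u v w eps : R).
Hypothesis alpha_gt2 : 2 < alpha.
Hypothesis g_lip : lipschitz_curve g.
Hypothesis g_arc : arclength_param g.

Lemma J12_measurable eps (X : R -> R -> R) : 0 < eps -> adm X ->
  measurable_fun (`[0, 1] : set R) (fun u => (Rintegral leb (W eps) (fun w => X u w))%:E).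
Proof.
move=> e0 aX; have iX := adm_integrable e0 aX.
have := iX; rewrite integrable_mkcond; last exact: measurable_box.
move=> iX'; have mG := measurable_fubini_F iX'.
apply: (eq_measurable_fun _ _ (measurable_funTS mG)) => u hu.
rewrite /fubini_F/= /patch /Rintegral fineK; last first.
  by apply: integrable_fin_num; [exact: measurable_W|exact: adm_slice1].
rewrite [RHS]integral_mkcond; apply: eq_integral => w _.
by rewrite /patch box_memE hu.
Qed.

Lemma inv_powE_diff_ge0 x y : 0 <= x -> x <= y -> 0 < y ->
  (0 <= inv_powE alpha x - inv_powE alpha y)%E.
Proof.
move=> x0 xy y0; rewrite /inv_powE (gt_eqF y0); case: eqVneq => [_|xn0].
  by rewrite addye// leey.
by rewrite -EFinB lee_fin subr_ge0 powRN_le ?lt0r ?xn0//; move: alpha_gt2; lra.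
Qed.

Lemma ohara_integrandE u w : w != 0 -> `|w| <= 1/2 ->
  ohara_integrand alpha g u w =
  ((inv_powE alpha (enorm (g (u + w) - g u)) - inv_powE alpha `|w|) *
   (enorm (derive1 g (u + w)) * enorm (derive1 g u))%:E)%E.
Proof. by move=> w0 w2; rewrite /ohara_integrand (negbTE w0) intr_distE. Qed.

Lemma ohara_integrand_ge0 u w : `|w| <= 1/2 -> (0 <= ohara_integrand alpha g u w)%E.
Proof.
move=> w2; have [->|w0] := eqVneq w 0; first by rewrite /ohara_integrand eqxx.
rewrite ohara_integrandE//; apply: mule_ge0; last by rewrite lee_fin mulr_ge0 ?enorm_ge0.
by apply: inv_powE_diff_ge0; rewrite ?enorm_ge0 ?chord_le ?normr_gt0.
Qed.

(** The energy enters only through measurable minorants X of its integrand. The Jacobian is 1 off a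
    null set of u and, for each remaining u, off a translate of that set in w, so the comparison is
    made almost everywhere twice. *)
Lemma energy_J : (ohara_energy alpha g < +oo)%E -> exists2 E0, 0 < E0 &
  forall eps (X : R -> R -> R), 0 < eps -> adm X -> (forall u w, W0 w -> 0 <= X u w) ->
  (forall u w, W0 w -> ((X u w)%:E <= inv_powE alpha (enorm (g (u + w) - g u)) -
     inv_powE alpha `|w|)%E) ->
  J eps X <= E0.
Proof.
move=> hE.
have half w : (`[(- (1 / 2))%R, (1 / 2)%R]%classic : set R) w -> `|w| <= 1 / 2.
  by rewrite /= in_itv/= ler_norml.
have E_ge0 : (0 <= ohara_energy alpha g)%E.
  apply: integral_ge0 => u _; apply: integral_ge0 => w hw.
  by apply: ohara_integrand_ge0; exact: half.
have E_fin : ohara_energy alpha g \is a fin_num by rewrite ge0_fin_numE.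
exists (fine (ohara_energy alpha g) + 1).
  by rewrite ltr_wpDl// fine_ge0.
move=> eps X e0 aX X0 XE.
have [N [mN N0 sN]] := enorm_deriv_ae g_arc.
have nN x : ~ N x -> enorm (derive1 g x) = 1.
  by move=> h; apply: contrapT => k; apply: h; exact: sN.
apply: (@le_trans _ _ (fine (ohara_energy alpha g))); last by rewrite lerDl.
rewrite J12// [X in X <= _]/Rintegral.
have v0 u : 0 <= Rintegral leb (W eps) (fun w => X u w).
  by apply: Rintegral_ge0 => w hw; apply: X0; exact: W_W0 hw.
suff key : (\int[leb]_(u in `[0%R, 1%R]) (Rintegral leb (W eps) (fun w => X u w))%:E
     <= ohara_energy alpha g)%E.
  apply: fine_le => //; rewrite ge0_fin_numE; first exact: le_lt_trans hE.
  by apply: integral_ge0 => u _; rewrite lee_fin.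
apply: (ae_le_integral (measurable_itv _) mN N0).
- exact: J12_measurable.
- by move=> u _; rewrite lee_fin.
- by move=> u _; apply: integral_ge0 => w hw; apply: ohara_integrand_ge0; exact: half.
move=> u _ /nN hu.
rewrite /Rintegral fineK; last first.
  by apply: integrable_fin_num; [exact: measurable_W|exact: adm_slice1].
pose N' := [set w : R | N (w + u)].
have mN' : measurable N'.
  have mf : measurable_fun [set: R] (fun x : R => x + u).
    by apply: measurable_funD; [exact: measurable_id|exact: measurable_cst].
  by have := mf measurableT N mN; rewrite setTI.
have N'0 : leb N' = 0%E by rewrite /N' leb_translate.
apply: (@le_trans _ _ (\int[leb]_(w in W eps) ohara_integrand alpha g u w)%E).
  apply: (ae_le_integral (measurable_W eps) mN' N'0).
  - by have /integrableP[] := adm_slice1 u e0 aX.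
  - by move=> w hw; rewrite lee_fin; apply: X0; exact: W_W0 hw.
  - by move=> w /(WP e0)[_ _ w2]; exact: ohara_integrand_ge0.
  move=> w hw; rewrite /N' /= => /nN; rewrite addrC => huw.
  have [w0 _ w2] := WP e0 hw.
  rewrite ohara_integrandE// huw hu mul1r mule1.
  by apply: XE; exact: W_W0 hw.
rewrite integral_mkcond [leRHS]integral_mkcond.
apply: ge0_le_integral_any => w _; rewrite /patch.
  by case: ifPn => //; rewrite inE => /(WP e0)[_ _ w2]; exact: ohara_integrand_ge0.
case: ifPn => [|_].
  rewrite inE => /(WP e0)[_ _ w2]; rewrite mem_set//=.
  by rewrite in_itv/= -ler_norml.
by case: ifPn => //; rewrite inE => /half; exact: ohara_integrand_ge0.
Qed.

End EnergyBound.

(** * Lower bounds for the energy integrand and for box integrals *)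

Section CurveC1.
Variables (R : realType) (n : nat) (alpha : R) (g : R -> 'rV[R]_n).
Local Notation leb := (@lebesgue_measure R).
Implicit Types (u v w eps : R).
Hypothesis alpha_gt2 : 2 < alpha.
Hypothesis alpha_lt3 : alpha < 3.
Hypothesis g_lip : lipschitz_curve g.
Hypothesis g_arc : arclength_param g.
Local Notation P := (component g).
Local Notation wt := (wt alpha).

Lemma adm_bigsum (I : Type) (s : seq I) (X : I -> R -> R -> R) :
  (forall i, adm (X i)) -> adm (fun u w => \sum_(i <- s) X i u w).
Proof.
move=> h; elim: s => [|i s IH].
  by apply: adm_ext (adm_cst 0) => u w; rewrite big_nil.
by apply: adm_ext (adm_add (h i) IH) => u w; rewrite big_cons.
Qed.

Lemma adm_chord2 : adm (chord2 g).
Proof.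
apply: adm_bigsum => i.
have a : adm (fun u w => P i (u + w) - P i u).
  have mP : measurable_fun setT (P i) by apply: continuous_measurable_fun; exact: cts_comp.
  split.
    apply: measurable_funB; first exact: (measurableT_comp mP (@measurable_sum2 R)).
    exact: (measurableT_comp mP measurable_fst).
  move=> e e0; exists (1/2) => u w /(WP e0)[_ _ w2].
  by apply: le_trans w2; exact: comp_lip.
exact: (adm_mul a a).
Qed.

Lemma adm_invw : adm (fun (_ : R) w => w^-1).
Proof.
split; first exact: (measurableT_comp (@measurable_invr R) measurable_snd).
move=> e e0; exists e^-1 => u w /(WP e0)[w0 ew _].
by rewrite normfV lef_pV2 ?posrE ?normr_gt0.
Qed.

(** The variance of g' over [u, u + w], written through chords because g' is not yet known to be
    continuous. *)
Definition excess u w := 1 - chord2 g u w / w ^+ 2.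

Lemma adm_excess : adm excess.
Proof.
apply: adm_sub; first exact: adm_cst.
apply: adm_ext (adm_mul adm_chord2 (adm_mul adm_invw adm_invw)) => u w.
by rewrite expr2 invfM.
Qed.

Lemma excess_ge0 u w : w != 0 -> 0 <= excess u w.
Proof.
move=> w0; rewrite subr_ge0 ler_pdivrMr ?exprn_even_gt0// mul1r.
exact: lip1_norm.
Qed.

(** With t = chord / |w| <= 1 the claim reads 1 - t^2 <= t^-alpha - 1, and it follows from t^2 +
    t^-2 >= 2 and t^-2 <= t^-alpha. A vanishing chord makes the right-hand side infinite. *)
Lemma excess_le_integrand u w : W0 w ->
  ((wt w * excess u w)%:E <= inv_powE alpha (enorm (g (u + w) - g u)) - inv_powE alpha `|w|)%E.
Proof.
move=> [w0 _]; have wp : 0 < `|w| by rewrite normr_gt0.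
rewrite /inv_powE (gt_eqF wp); case: eqVneq => [_|c0].
  by rewrite addye// leey.
set c := enorm _ in c0 *; have cw : c <= `|w| by exact: chord_le.
have cp : 0 < c by rewrite lt0r c0 enorm_ge0.
rewrite -EFinB lee_fin /excess (_ : chord2 g u w = c ^+ 2); last by rewrite /c enorm_chord sqr_sqrtr ?chord2_ge0//.
rewrite /wt.
pose t := c / `|w|.
have t0 : 0 < t by rewrite divr_gt0.
have t1 : t <= 1 by rewrite ler_pdivrMr// mul1r.
have cE : c = t * `|w| by rewrite /t divfK// gt_eqF.
have -> : c ^+ 2 / w ^+ 2 = t ^+ 2.
  by rewrite /t expr_div_n real_normK ?num_real.
have -> : c `^ (- alpha) = t `^ (- alpha) * `|w| `^ (- alpha) by rewrite cE powRM ?ltW.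
have tt : (t ^+ 2)^-1 <= t `^ (- alpha).
  rewrite -powR_invn ?(ltW t0)//; apply: ger_powR; first by rewrite t0 t1.
  by move: alpha_gt2; lra.
have t2 : 0 < t ^+ 2 by exact: exprn_gt0.
have k : 2 - t ^+ 2 <= (t ^+ 2)^-1.
  rewrite -[leRHS]mul1r ler_pdivlMr//; have := sqr_ge0 (t ^+ 2 - 1); lra.
rewrite [X in _ <= X](_ : _ = `|w| `^ (- alpha) * (t `^ (- alpha) - 1)); last by ring.
by apply: ler_wpM2l; [exact: powR_ge0|lra].
Qed.

Lemma Rintegral_ge_itv (D : set R) (h : R -> R) a b B : measurable D -> a <= b ->
  leb.-integrable D (EFin \o h) -> `[a, b]%classic `<=` D -> (forall x, D x -> 0 <= h x) ->
  (forall x, a <= x <= b -> B <= h x) -> B * (b - a) <= Rintegral leb D h.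
Proof.
move=> mD ab ih sub h0 hB.
have ih' : leb.-integrable `[a, b] (EFin \o h).
  by apply: integrableS ih => //; exact: measurable_itv.
apply: (@le_trans _ _ (Rintegral leb `[a, b] h)).
  rewrite -(Rintegral_cst_itv B ab).
  apply: le_Rintegral; [exact: measurable_itv|exact: cts_integrable (cts_cst _)|exact: ih'|].
  by move=> x /=; rewrite in_itv/=; exact: hB.
rewrite /Rintegral; apply: fine_le.
- by apply: integrable_fin_num; [exact: measurable_itv|exact: ih'].
- by apply: integrable_fin_num; [exact: mD|exact: ih].
apply: ge0_subset_integral; [exact: measurable_itv|exact: mD| | |exact: sub].
- by case/integrableP : ih.
- by move=> x /h0; rewrite lee_fin.
Qed.

Lemma J_box_ge eps (X : R -> R -> R) a a' b b' B : 0 < eps -> adm X ->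
  (forall u w, W0 w -> 0 <= X u w) -> 0 <= a -> a <= a' -> a' <= 1 -> eps <= b -> b <= b' -> b' <= 1/2 ->
  (forall u w, a <= u <= a' -> b <= w <= b' -> B <= X u w) ->
  B * (a' - a) * (b' - b) <= J eps X.
Proof.
move=> e0 aX X0 a0 aa a1 eb bb b2 hB; rewrite J21//.
have hW w : b <= w <= b' -> W eps w.
  by move=> /andP[h1 h2]; right; rewrite /= in_itv/=; apply/andP; split; lra.
apply: Rintegral_ge_itv; [exact: measurable_W|exact: bb|exact: J21_integrable|..].
- by move=> w /=; rewrite in_itv/=; exact: hW.
- by move=> w hw; apply: Rintegral_ge0 => u _; apply: X0; exact: W_W0 hw.
move=> w hw; have hw' := hW w hw; 
apply: Rintegral_ge_itv; [exact: measurable_itv|exact: aa|exact: (adm_slice2 e0 hw' aX)|..].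
- by move=> u /=; rewrite !in_itv/= => /andP[h1 h2]; apply/andP; split; lra.
- by move=> u _; apply: X0; exact: W_W0 hw'.
by move=> u hu; exact: hB.
Qed.

End CurveC1.

(** * Continuity of the tangent and non-degenerate chords *)

Section CurveC1Main.
Variables (R : realType) (n : nat) (alpha : R) (g : R -> 'rV[R]_n) (E0 : R).
Local Notation leb := (@lebesgue_measure R).
Implicit Types (u v w r eps : R).
Hypothesis alpha_gt2 : 2 < alpha.
Hypothesis alpha_lt3 : alpha < 3.
Hypothesis g_lip : lipschitz_curve g.
Hypothesis g_arc : arclength_param g.
Local Notation P := (component g).
Local Notation wt := (wt alpha).
Local Notation En := (En alpha).
Hypothesis E0_gt0 : 0 < E0.
Hypothesis energyJ : forall eps (X : R -> R -> R), 0 < eps -> adm X ->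
  (forall u w, W0 w -> 0 <= X u w) ->
  (forall u w, W0 w -> ((X u w)%:E <= inv_powE alpha (enorm (g (u + w) - g u)) -
     inv_powE alpha `|w|)%E) -> J eps X <= E0.

Let K := 6 * 3 `^ alpha * E0.
Let b := (alpha - 2) / 2.

Let K0 : 0 <= K. Proof. by rewrite !mulr_ge0 ?powR_ge0// ltW. Qed.
Let b0 : 0 < b. Proof. by move: alpha_gt2; rewrite /b; lra. Qed.

Lemma excess_J eps : 0 < eps -> J eps (fun u w => wt w * excess g u w) <= E0.
Proof.
move=> e0; apply: energyJ => //.
- by apply: adm_wtM => //; exact: adm_excess.
- by move=> u w [w0 _]; rewrite mulr_ge0 ?wt_ge0 ?excess_ge0.
- by move=> u w; exact: excess_le_integrand.
Qed.

(** The second argument [id] is the primitive of |g'|^2 = 1. *)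
Lemma deficit_excess u w : w != 0 -> deficit P id u (u + w) = w * excess g u w.
Proof.
move=> w0; rewrite /deficit /excess /chord2 (_ : u + w - u = w); last by ring.
by field.
Qed.

Lemma deficit_comp_ge0 u v : u < v -> 0 <= deficit P id u v.
Proof.
move=> uv; rewrite (_ : v = u + (v - u)); last by ring.
have w0 : 0 < v - u by lra.
by rewrite deficit_excess ?gt_eqF// mulr_ge0 ?(ltW w0)// excess_ge0 ?gt_eqF.
Qed.

Lemma cts_deficit_comp w : 0 < w -> continuous (fun u => deficit P id u (u + w)).
Proof.
move=> w0; have cc i : continuous (fun u => P i (u + w) - P i u).
  by apply: cts_diff; exact: cts_comp.
have cs (s : seq 'I_n) : continuous (fun u => \sum_(i <- s) (P i (u + w) - P i u) ^+ 2).
  elim: s => [|i s IH]; first by under eq_fun do rewrite big_nil; exact: cts_cst.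
  by under eq_fun do rewrite big_cons; apply: cts_add => //; exact: cts_sqr.
have := cts_sub (cts_cst w) (cts_scale w^-1 (cs (index_enum _))).
rewrite [X in continuous X -> _](_ : _ = (fun u => deficit P id u (u + w)))//.
apply/funext => u; rewrite /deficit (_ : u + w - u = w); last by ring.
by rewrite mulrC.
Qed.

Lemma per_deficit_comp w : periodic (fun u => deficit P id u (u + w)).
Proof.
move=> u; rewrite /deficit (addrAC u 1 w).
rewrite (_ : u + w + 1 - (u + 1) = u + w - u); last by ring.
by congr (_ - _ / _); apply: eq_bigr => i _; rewrite !periodic_comp.
Qed.

Lemma scale_comp r : 0 < r -> r <= 6^-1 -> exists2 w, 2 * r <= w <= 3 * r &
  int01 (fun u => deficit P id u (u + w)) <= K * r `^ alpha.
Proof.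
move=> r0 r6; have [|||w hw hi] := @scale_slice R alpha alpha_gt2 (excess g) E0 r r0 r6 E0_gt0.
- exact: adm_excess.
- by move=> u w /WP[]; [lra|move=> w0 _ _; exact: excess_ge0].
- by apply: excess_J; lra.
exists w => //; have /andP[w1 w2] := hw; have w0 : 0 < w by lra.
have wn0 : w != 0 by rewrite gt_eqF.
have c1 := cts_scale w^-1 (cts_deficit_comp w0).
have -> : int01 (fun u => deficit P id u (u + w)) = w * int01 (fun u => excess g u w).
  have -> : (fun u => excess g u w) = (fun u => w^-1 * deficit P id u (u + w)).
    by apply/funext => u; rewrite deficit_excess// mulKf.
  by rewrite int01Z; [rewrite mulVKf|exact: cts_deficit_comp].
have a0 : 0 < alpha by move: alpha_gt2; lra.
have i0 : 0 <= int01 (fun u => excess g u w) by apply: int01_ge0 => u; exact: excess_ge0.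
apply: (@le_trans _ _ ((3 * r) * (2 * 3 `^ alpha * E0 * r `^ (alpha - 1)))).
  by apply: ler_pM => //; lra.
by rewrite -(mulr_powRB1 (ltW r0) a0) /K; lra.
Qed.

Lemma excess_le u w : 0 < w -> w <= 6^-1 -> excess g u w <= K * w `^ (2 * b).
Proof.
move=> w0 w6; have := deficit_quot_bound deficit_comp_ge0 alpha_gt2 K0 cts_deficit_comp
  per_deficit_comp scale_comp u w0 w6.
rewrite deficit_excess ?gt_eqF// mulrAC mulfV ?gt_eqF// mul1r exprMn sqr_sqrtr//.
by rewrite powR_sqr ?(ltW w0).
Qed.

Lemma curve_derivative : exists f : 'I_n -> R -> R,
  [/\ forall i, isD (P i) (f i), forall i, continuous (f i), forall i, periodic (f i) &
   forall u, \sum_i f i u ^+ 2 = 1].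
Proof.
have [d [h1 h2]] := morrey deficit_comp_ge0 alpha_gt2 alpha_lt3 K0 cts_deficit_comp
  per_deficit_comp scale_comp.
set M := _ * _ in h1 h2; rewrite -/b in h1 h2.
have M0 : 0 <= M.
  apply: mulr_ge0; last exact: sqrtr_ge0.
  apply: divr_ge0 => //; rewrite subr_ge0.
  rewrite [leRHS](_ : 1 = 1 `^ b); last by rewrite powR1.
  by apply: ge0_ler_powR; rewrite ?nnegrE ?invr_ge0 ?invf_le1 ?ler1n ?(ltW b0).
have r00 : (0 : R) < 12^-1 by lra.
have D i : isD (P i) (d i) := isD_of_right_rate r00 b0 M0 (h1 i) (h2 i).
exists d; split=> //.
- by move=> i; exact: (holder_continuous r00 b0 M0 (h2 i)).
- move=> i; have := isD_shift 1 (D i); have -> : (fun x => P i (x + 1)) = P i.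
    by apply/funext => x; exact: periodic_comp.
  by move=> /isD_uniq/(_ (D i)).
(* The squared slopes sum to 1 minus the excess; the excess and the distance of each slope from the
   derivative vanish with w, which upgrades unit speed from almost everywhere to everywhere. *)
move=> u; apply/eqP; rewrite -subr_eq0 -normr_eq0 eq_le normr_ge0 andbT.
apply/ler_addgt0Pr => e e0; rewrite add0r.
pose C := K + n%:R * (M * (2 + M)).
have C0 : 0 <= C.
  by apply: addr_ge0 => //; apply: mulr_ge0; [exact: ler0n|apply: mulr_ge0 => //; lra].
have [eta eta0 heta] := small_powR b0 C0 e0.
pose w := Num.min eta 12^-1.
have w0 : 0 < w by rewrite lt_min eta0/=; lra.
have w12 : w <= 12^-1 by rewrite /w ge_min lexx orbT.
have we : w <= eta by rewrite /w ge_min lexx.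
apply: le_trans (heta w (ltW w0) we).
have wn0 : w != 0 by rewrite gt_eqF.
have w6 : w <= 6^-1 by lra.
have x1 := excess_le u w0 w6; have x0 := excess_ge0 g_lip g_arc u wn0.
have wb0 : 0 <= w `^ b by exact: powR_ge0.
have wb1 : w `^ b <= 1.
  rewrite [leRHS](_ : 1 = 1 `^ b); last by rewrite powR1.
  by apply: ge0_ler_powR; rewrite ?nnegrE ?(ltW b0) ?ler01//; lra.
have wbb : w `^ (2 * b) <= w `^ b.
  by rewrite -powR_sqr ?(ltW w0)// expr2; apply: ler_piMl.
have exE : excess g u w = 1 - \sum_i slope P i u w ^+ 2.
  rewrite /excess /chord2 mulr_suml; congr (_ - _); apply: eq_bigr => i _.
  by rewrite /slope expr_div_n.
have sl i : `|slope P i u w| <= 1.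
  rewrite /slope normrM normfV ler_pdivrMr ?normr_gt0// mul1r.
  exact: comp_lip.
have diff i : `|d i u ^+ 2 - slope P i u w ^+ 2| <= M * (2 + M) * w `^ b.
  have hh := h1 i u w w0 w12; rewrite distrC in hh.
  have Mw : M * w `^ b <= M by rewrite -[leRHS]mulr1; apply: ler_wpM2l.
  have dd : `|d i u| <= 1 + M.
    by have := ler_distD (slope P i u w) (d i u) 0; rewrite !subr0; have := sl i; lra.
  rewrite subr_sqr normrM.
  have : `|d i u - slope P i u w| * `|d i u + slope P i u w| <= (M * w `^ b) * (2 + M).
    apply: ler_pM => //; apply: (le_trans (ler_normD _ _)); have := sl i; lra.
  by lra.
have sd : `|\sum_i d i u ^+ 2 - \sum_i slope P i u w ^+ 2| <= n%:R * (M * (2 + M) * w `^ b).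
  rewrite -sumrB; apply: (le_trans (ler_norm_sum _ _ _)).
  apply: (le_trans (ler_sum _ (fun i _ => diff i))).
  by rewrite sumr_const card_ord mulr_natl.
have K1 := ler_wpM2l K0 wbb.
have -> : \sum_i d i u ^+ 2 - 1 =
  (\sum_i d i u ^+ 2 - \sum_i slope P i u w ^+ 2) - excess g u w by rewrite exE; ring.
apply: (le_trans (ler_normB _ _)); rewrite (ger0_norm x0) /C; lra.
Qed.

(** By the 1-Lipschitz bound the endpoints move by at most r and 2 r; the square of a sum of three
    terms gives 3 (4 + 1 + 1) = 18. *)
Lemma chord2_perturb u w u0 w0 r : 0 < r -> `|u - u0| <= r -> `|w - w0| <= r ->
  chord2 g u0 w0 <= r ^+ 2 -> chord2 g u w <= 18 * r ^+ 2.
Proof.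
move=> r0 hu hw hc.
have l1 : \sum_i (P i u0 - P i u) ^+ 2 <= r ^+ 2.
  have := lip1_norm g_lip g_arc u (u0 - u); rewrite (_ : u + (u0 - u) = u0); last by ring.
  move=> /le_trans; apply; rewrite -real_normK ?num_real// ler_pXn2r ?nnegrE ?(ltW r0)//.
  by rewrite distrC.
have l2 : \sum_i (P i (u + w) - P i (u0 + w0)) ^+ 2 <= 4 * r ^+ 2.
  have := lip1_norm g_lip g_arc (u0 + w0) (u + w - (u0 + w0)).
  rewrite (_ : u0 + w0 + (u + w - (u0 + w0)) = u + w); last by ring.
  move=> /le_trans; apply; rewrite -real_normK ?num_real//.
  have -> : 4 * r ^+ 2 = (2 * r) ^+ 2 by ring.
  rewrite ler_pXn2r ?nnegrE//; last by lra.
  rewrite (_ : u + w - (u0 + w0) = (u - u0) + (w - w0)); last by ring.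
  by apply: (le_trans (ler_normD _ _)); lra.
apply: (@le_trans _ _ (\sum_i (3 * (P i (u + w) - P i (u0 + w0)) ^+ 2 +
    (3 * (P i (u0 + w0) - P i u0) ^+ 2 + 3 * (P i u0 - P i u) ^+ 2)))).
  apply: ler_sum => i _.
  set x := P i (u + w) - P i (u0 + w0); set y := P i (u0 + w0) - P i u0; set z := P i u0 - P i u.
  rewrite (_ : P i (u + w) - P i u = x + y + z); last by rewrite /x /y /z; ring.
  have := sqr_ge0 (x - y); have := sqr_ge0 (y - z); have := sqr_ge0 (x - z); lra.
rewrite !big_split/= -!mulr_sumr; move: hc; rewrite /chord2; lra.
Qed.

(** Chords may still vanish at this stage: rho keeps the function bounded, as [adm] requires, and
    the positive part makes it nonnegative while it stays below the energy integrand. *)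
Definition trunc_integrand rho u w :=
  Num.max 0 ((chord2 g u w + rho) `^ (- (alpha / 2)) - `|w| `^ (- alpha)).

Lemma adm_trunc_integrand rho : 0 < rho -> adm (trunc_integrand rho).
Proof.
move=> rho0; have a2 : 0 <= alpha / 2 by move: alpha_gt2; lra.
split.
  apply: measurable_maxr; first exact: measurable_cst.
  apply: measurable_funB; last by have [] := adm_wt alpha_gt2.
  apply: (measurableT_comp (measurable_powR (- (alpha / 2)))).
  by apply: measurable_funD; [have [] := adm_chord2 g_lip g_arc|exact: measurable_cst].
move=> e _; exists (rho `^ (- (alpha / 2))) => u w _.
rewrite ger0_norm ?le_max ?lexx// ge_max powR_ge0/=.
have := powR_ge0 `|w| (- alpha).
have : (chord2 g u w + rho) `^ (- (alpha / 2)) <= rho `^ (- (alpha / 2)).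
  by apply: powRN_le => //; rewrite lerDr chord2_ge0.
by lra.
Qed.

Lemma trunc_integrand_J rho eps : 0 < rho -> 0 < eps -> J eps (trunc_integrand rho) <= E0.
Proof.
move=> rho0 e0; have a2 : 0 <= alpha / 2 by move: alpha_gt2; lra.
apply: energyJ => //; first exact: adm_trunc_integrand.
  by move=> u w _; rewrite le_max lexx.
move=> u w [w0 _]; have wp : 0 < `|w| by rewrite normr_gt0.
rewrite /inv_powE (gt_eqF wp); case: eqVneq => [_|c0].
  by rewrite addye// leey.
set c := enorm _ in c0 *; have cw : c <= `|w| by exact: chord_le.
have cp : 0 < c by rewrite lt0r c0 enorm_ge0.
have cE : chord2 g u w = c ^+ 2 by rewrite /c enorm_chord sqr_sqrtr ?chord2_ge0.
have al0 : 0 <= alpha by lra.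
rewrite -EFinB lee_fin /trunc_integrand ge_max subr_ge0 powRN_le//= lerD2r.
have -> : c `^ (- alpha) = (c ^+ 2) `^ (- (alpha / 2)).
  by rewrite -powR_mulrn ?(ltW cp)// -powRrM; congr (_ `^ _); field.
by rewrite cE; apply: powRN_le => //; [exact: exprn_gt0|lra].
Qed.

(* A chord shorter than r stays shorter than 5r on a box of side r, which costs an energy of
   order r^(2 - alpha). *)
Lemma chord2_lower : exists2 c, 0 < c & forall u w, W0 w -> c <= chord2 g u w / w ^+ 2.
Proof.
have al2 := alpha_gt2.
have b20 : 0 < 2 * b by move: b0; lra.
have half0 : (0 : R) < 2^-1 by lra.
have [eta eta0 heta] := small_powR b20 K0 half0.
pose r0 := Num.min eta 6^-1.
have r00 : 0 < r0 by rewrite lt_min eta0/=; lra.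
have r06 : r0 <= 6^-1 by rewrite /r0 ge_min lexx orbT.
have r0e : r0 <= eta by rewrite /r0 ge_min lexx.
pose K1 := E0 + (r0 / 2) `^ (- alpha).
have K10 : 0 <= 5 `^ alpha * K1.
  by rewrite mulr_ge0 ?powR_ge0// addr_ge0 ?powR_ge0// ltW.
have am2 : 0 < alpha - 2 by lra.
have [r1 r10 hr1] := small_powR am2 K10 half0.
(* [r1] makes (5 r)^-alpha r^2, the order of the energy of a box of side r, exceed K1, and r <= r0 /
   2 keeps the box in the region w >= r0 / 2. *)
pose r := Num.min r1 (r0 / 2).
have rp : 0 < r by rewrite lt_min r10/=; lra.
have rr0 : r <= r0 / 2 by rewrite /r ge_min lexx orbT.
have rr1 : r <= r1 by rewrite /r ge_min lexx.
have hr := hr1 r (ltW rp) rr1.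
have r2 : 0 < r ^+ 2 by exact: exprn_gt0.
have r21 : r ^+ 2 <= 1 by rewrite expr_le1//; lra.
have big u0 w0 : 0 <= u0 -> u0 <= 1 -> r0 <= w0 -> w0 <= 1/2 -> r ^+ 2 < chord2 g u0 w0.
  move=> u00 u01 w0r w02; rewrite ltNge; apply/negP => hc.
  pose B := (5 * r) `^ (- alpha) - (r0 / 2) `^ (- alpha).
  have Bx u w : `|u - u0| <= r -> `|w - w0| <= r -> B <= trunc_integrand (r ^+ 2) u w.
    move=> hu hw; have h18 := chord2_perturb rp hu hw hc.
    rewrite /trunc_integrand le_max; apply/orP; right.
    have wr : r0 / 2 <= `|w|.
      by have := ler_norm w; move: hw; rewrite ler_norml => /andP[]; lra.
    have k1 : `|w| `^ (- alpha) <= (r0 / 2) `^ (- alpha) by apply: powRN_le; lra.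
    have k2 : (5 * r) `^ (- alpha) <= (chord2 g u w + r ^+ 2) `^ (- (alpha / 2)).
      have -> : (5 * r) `^ (- alpha) = ((5 * r) ^+ 2) `^ (- (alpha / 2)).
        rewrite -powR_mulrn; last by lra.
        by rewrite -powRrM; congr (_ `^ _); field.
      apply: powRN_le; first by lra.
        by rewrite ltr_wpDl// chord2_ge0.
      by rewrite exprMn; lra.
    by rewrite /B; lra.
  have e0 : 0 < r0 / 2 by lra.
  have aT := adm_trunc_integrand r2.
  have T0 u w : W0 w -> 0 <= trunc_integrand (r ^+ 2) u w by move=> _; rewrite le_max lexx.
  have hJ := trunc_integrand_J r2 e0.
  have box : B * r * r <= E0.
    apply: le_trans hJ.
    (* The box extends to the side of u0 on which it stays inside [0, 1]. *)
    have [uh|uh] := leP u0 (1/2).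
      have := @J_box_ge R _ _ u0 (u0 + r) (w0 - r) w0 B e0 aT T0.
      have e1 : u0 + r - u0 = r by ring.
      have e2 : w0 - (w0 - r) = r by ring.
      rewrite e1 e2.
      apply; try lra.
      by move=> u w /andP[a1 a2] /andP[a3 a4]; apply: Bx; rewrite ler_norml; apply/andP; split; lra.
    have := @J_box_ge R _ _ (u0 - r) u0 (w0 - r) w0 B e0 aT T0.
    have e1 : u0 - (u0 - r) = r by ring.
    have e2 : w0 - (w0 - r) = r by ring.
    rewrite e1 e2.
    apply; try lra.
    by move=> u w /andP[a1 a2] /andP[a3 a4]; apply: Bx; rewrite ler_norml; apply/andP; split; lra.
  have q0 := powR_ge0 (r0 / 2) (- alpha).
  have h1 : (5 * r) `^ (- alpha) * r ^+ 2 <= K1.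
    have : (r0 / 2) `^ (- alpha) * r ^+ 2 <= (r0 / 2) `^ (- alpha) * 1 by apply: ler_wpM2l.
    by move: box; rewrite /B /K1; lra.
  have h2 : 5 `^ alpha * r `^ (alpha - 2) * ((5 * r) `^ (- alpha) * r ^+ 2) = 1.
    have rn : r != 0 by rewrite gt_eqF.
    rewrite powRM ?(ltW rp)// !powRN powRB ?rn ?implybT// powR_mulrn ?(ltW rp)//.
    field; rewrite rn !gt_eqF ?powR_gt0//.
  have h3 : 5 `^ alpha * r `^ (alpha - 2) * ((5 * r) `^ (- alpha) * r ^+ 2) <=
      5 `^ alpha * r `^ (alpha - 2) * K1.
    by apply: ler_wpM2l => //; rewrite mulr_ge0 ?powR_ge0.
  by move: h3; rewrite h2; lra.
have bigp u w : r0 <= w -> w <= 1/2 -> r ^+ 2 < chord2 g u w.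
  move=> w1 w2; pose k := Num.floor u.
  have e : chord2 g u w = chord2 g (u - k%:~R) w.
    apply: eq_bigr => i _; rewrite -(periodicZ (periodic_comp g_lip i) k (u - k%:~R)) subrK.
    rewrite -(periodicZ (periodic_comp g_lip i) k (u - k%:~R + w)).
    by rewrite (_ : u - k%:~R + w + k%:~R = u + w)//; ring.
  rewrite e; apply: big => //; first by rewrite subr_ge0 Num.Theory.ge_floor.
  rewrite lerBlDl; apply/ltW.
  by have := Num.Theory.lt_succ_floor u; rewrite intrD1 addrC.
pose c := Num.min 2^-1 (r ^+ 2).
(* Up to r0 the excess is at most 1/2; beyond it the box argument applies, after reduction of u
   modulo 1. *)
have pos u w : 0 < w -> w <= 1/2 -> c <= chord2 g u w / w ^+ 2.
  move=> w0 w2; have [wr|wr] := leP w r0.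
    apply: (@le_trans _ _ 2^-1); first by rewrite /c ge_min lexx.
    have w6 : w <= 6^-1 by lra.
    have we : w <= eta by lra.
    have := excess_le u w0 w6; have := heta w (ltW w0) we; rewrite /excess; lra.
  apply: (@le_trans _ _ (r ^+ 2)); first by rewrite /c ge_min lexx orbT.
  rewrite ler_pdivlMr ?exprn_gt0//.
  have w21 : w ^+ 2 <= 1 by rewrite expr_le1//; lra.
  apply: (le_trans _ (ltW (bigp u w (ltW wr) w2))).
  by rewrite -[leRHS]mulr1; apply: ler_wpM2l => //; exact: ltW.
exists c; first by rewrite lt_min half0.
move=> u w [w0 w2]; have [wn|wp|we] := ltgtP w 0; last by rewrite we eqxx in w0.
  (* A chord of negative step is the same chord seen from its other end. *)
  have h : c <= chord2 g (u + w) (- w) / (- w) ^+ 2.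
    by apply: pos; [lra|move: w2; rewrite ltr0_norm].
  rewrite sqrrN in h; apply: (le_trans h); rewrite le_eqVlt; apply/orP; left; apply/eqP; congr (_ / _).
  by apply: eq_bigr => i _; rewrite addrK -sqrrN opprB.
by apply: pos => //; move: w2; rewrite gtr0_norm.
Qed.

End CurveC1Main.

(** * Admissible test functions *)

Section TestFunctions.
Variables (R : realType) (n : nat).
Local Notation leb := (@lebesgue_measure R).
Implicit Types (h : R -> R) (k : nat).

Definition freq k : R := 2 * pi * k%:R.

Lemma isD_cosf k : isD (fun x => cos (freq k * x)) (fun x => - freq k * sin (freq k * x)).
Proof.
have := isD_comp (fun x => is_derive_cos x) (isDZ (freq k) (@isD_id R)).
by apply: isD_ext => // x; ring.
Qed.

Lemma isD_sinf k : isD (fun x => sin (freq k * x)) (fun x => freq k * cos (freq k * x)).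
Proof.
have := isD_comp (fun x => is_derive_sin x) (isDZ (freq k) (@isD_id R)).
by apply: isD_ext => // x; ring.
Qed.

Lemma cts_cosf k : continuous (fun x => cos (freq k * x)).
Proof. exact: isD_continuous (isD_cosf k). Qed.

Lemma cts_sinf k : continuous (fun x => sin (freq k * x)).
Proof. exact: isD_continuous (isD_sinf k). Qed.

Lemma periodic_cosf k : periodic (fun x => cos (freq k * x)).
Proof.
move=> x; rewrite mulrDr mulr1 /freq (_ : 2 * pi * k%:R = (pi *+ 2) *+ k).
  exact: (periodicn (@cosD2pi R)).
by rewrite mulr_natr mulr_natl.
Qed.

Lemma periodic_sinf k : periodic (fun x => sin (freq k * x)).
Proof.
move=> x; rewrite mulrDr mulr1 /freq (_ : 2 * pi * k%:R = (pi *+ 2) *+ k).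
  exact: (periodicn (@sinD2pi R)).
by rewrite mulr_natr mulr_natl.
Qed.

Lemma fourier_IBP k p dp : isD p dp -> continuous dp -> periodic p ->
  int01 (fun x => dp x * cos (freq k * x)) = freq k * int01 (fun x => p x * sin (freq k * x)) /\
  int01 (fun x => dp x * sin (freq k * x)) = - freq k * int01 (fun x => p x * cos (freq k * x)).
Proof.
move=> hp cd pp; have cp := isD_continuous hp.
have cs := @cts_sinf k; have cc := @cts_cosf k.
split.
  rewrite (int01_IBP hp (isD_cosf k) cd (cts_scale (- freq k) cs) pp (@periodic_cosf k)).
  rewrite -int01Z; last exact: cts_mul.
  rewrite -mulN1r -int01Z; last by apply: cts_mul => //; exact: cts_scale.
  by apply: eq_Rintegral => x _; ring.
rewrite (int01_IBP hp (isD_sinf k) cd (cts_scale (freq k) cc) pp (@periodic_sinf k)).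
rewrite -int01Z; last exact: cts_mul.
rewrite -mulN1r -int01Z; last by apply: cts_mul => //; exact: cts_scale.
by apply: eq_Rintegral => x _; ring.
Qed.

(** Three integrations by parts, without boundary terms by periodicity. *)
Lemma fourier_decay h : Ck 3 h -> exists2 B, 0 <= B & forall k,
  freq k ^+ 3 * `|int01 (fun x => h x * cos (freq k * x))| <= B /\
  freq k ^+ 3 * `|int01 (fun x => h x * sin (freq k * x))| <= B.
Proof.
move=> /Ck_dseq[D D0 [hD cD]].
have [c3 p3] := cD 3 isT; have [B hB] := periodic_bounded c3 p3.
have B0 : 0 <= B by exact: le_trans (hB 0).
exists B => // k; set a := freq k.
have a0 : 0 <= a by rewrite /a /freq !mulr_ge0// pi_ge0.
pose A l := int01 (fun x => D l x * cos (a * x)); pose S l := int01 (fun x => D l x * sin (a * x)).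
have st l : (l < 3)%N -> A l.+1 = a * S l /\ S l.+1 = - a * A l.
  by move=> l3; apply: fourier_IBP; [exact: hD|have [] := cD l.+1 l3|have [] := cD l (ltnW l3)].
have [a1 s1] := st 0%N isT; have [a2 s2] := st 1%N isT; have [a3 s3] := st 2%N isT.
have bA : `|A 3| <= B.
  apply: int01_norm_le; first by apply: cts_mul => //; exact: cts_cosf.
  move=> x; rewrite normrM -[leRHS]mulr1; apply: ler_pM => //.
  by rewrite ler_norml cos_geN1 cos_le1.
have bS : `|S 3| <= B.
  apply: int01_norm_le; first by apply: cts_mul => //; exact: cts_sinf.
  move=> x; rewrite normrM -[leRHS]mulr1; apply: ler_pM => //.
  by rewrite ler_norml sin_geN1 sin_le1.
have a30 : `|a ^+ 3| = a ^+ 3 by apply: ger0_norm; rewrite exprn_ge0.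
have eA : a ^+ 3 * `|A 0%N| = `|S 3|.
  rewrite s3 a2 s1 (_ : - a * (a * (- a * A 0%N)) = a ^+ 3 * A 0%N); last by ring.
  by rewrite normrM a30.
have eS : a ^+ 3 * `|S 0%N| = `|A 3|.
  rewrite a3 s2 a1 (_ : a * (- a * (a * S 0%N)) = - (a ^+ 3 * S 0%N)); last by ring.
  by rewrite normrN normrM a30.
by rewrite -/(A 0%N) -/(S 0%N) -D0 -/(A 0%N) -/(S 0%N) eA eS.
Qed.

(** Telescoping, from 1 / x^2 <= 2 / x - 2 / (x + 1) for x >= 1. *)
Lemma inv_sq_sum (N : nat) : \sum_(0 <= k < N) (k.+1%:R ^+ 2)^-1 <= 2 - 2 / N.+1%:R :> R.
Proof.
elim: N => [|N IH]; first by rewrite big_geq// divr1 subrr.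
rewrite big_nat_recr//=.
have x0 : (1 : R) <= N.+1%:R by rewrite ler1n.
have -> : N.+2%:R = N.+1%:R + 1 :> R by rewrite natr1.
set x : R := N.+1%:R in IH x0 *.
suff : (x ^+ 2)^-1 <= 2 / x - 2 / (x + 1).
  by move=> hx; apply: le_trans (lerD IH hx) _; rewrite addrA subrK.
have -> : 2 / x - 2 / (x + 1) = 2 * x / (x + 1) / x ^+ 2.
  by field; rewrite !gt_eqF//; lra.
rewrite -[leLHS]mul1r ler_pM2r; last by rewrite invr_gt0 exprn_gt0//; lra.
by rewrite ler_pdivlMr; lra.
Qed.

Lemma nneseries_lt_pinfty_inv_sq (t : nat -> R) C : (forall k, 0 <= t k) ->
  (forall k, t k <= C * (k.+1%:R ^+ 2)^-1) -> (\sum_(k <oo) (t k)%:E < +oo)%E.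
Proof.
move=> t0 tC.
have C0 : 0 <= C by have := le_trans (t0 0%N) (tC 0%N); rewrite expr1n invr1 mulr1.
apply: (@le_lt_trans _ _ (C * 2)%:E); last exact: ltry.
apply: lime_le; first by apply: is_cvg_nneseries => k _ _; rewrite lee_fin.
apply: nearW => N; rewrite sumEFin lee_fin.
apply: (@le_trans _ _ (\sum_(0 <= k < N) C * (k.+1%:R ^+ 2)^-1)).
  by apply: ler_sum => k _.
rewrite -mulr_sumr ler_wpM2l//; apply: (le_trans (inv_sq_sum N)).
by rewrite lerBlDr lerDl divr_ge0.
Qed.

Definition test_curve h (i : 'I_n) (x : R) : 'rV[R]_n := h x *: delta_mx ord0 i.

Lemma test_curveE h i x j : test_curve h i x ord0 j = (j == i)%:R * h x.
Proof. by rewrite !mxE eqxx mulrC. Qed.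

(** The coefficients are O(k^-3) and for s <= 2 the weight is O(k^4), so the terms are O(k^-2). For
    s = (1 + alpha) / 2 the condition s <= 2 is alpha <= 3. *)
Lemma test_curve_in_H2 s h i : 0 <= s <= 2 -> Ck 3 h -> in_H2 s (test_curve h i).
Proof.
move=> /andP[s0 s2] h3; have [ch ph] := Ck_cp h3.
split; first by move=> x; rewrite /test_curve ph.
have [B B0 hB] := fourier_decay h3.
pose c k := int01 (fun x => h x * cos (freq k * x)).
pose d k := int01 (fun x => h x * sin (freq k * x)).
have ck k j : fourier_cos (test_curve h i) k j = (j == i)%:R * c k.
  rewrite /c -int01Z; last by apply: cts_mul => //; exact: cts_cosf.
  by apply: eq_Rintegral => x _; rewrite test_curveE mulrA.
have dk k j : fourier_sin (test_curve h i) k j = (j == i)%:R * d k.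
  rewrite /d -int01Z; last by apply: cts_mul => //; exact: cts_sinf.
  by apply: eq_Rintegral => x _; rewrite test_curveE mulrA.
pose T k := (1 + freq k ^+ 2) `^ s * (c k ^+ 2 + d k ^+ 2).
have tT k : (1 + 4 * pi ^+ 2 * k%:R ^+ 2) `^ s * \sum_(j < n)
    (fourier_cos (test_curve h i) k j ^+ 2 + fourier_sin (test_curve h i) k j ^+ 2) = T k.
  rewrite /T; congr (_ * _).
    by congr (_ `^ _); rewrite /freq; ring.
  rewrite (bigD1 i)//= big1 => [|j /negbTE ji]; rewrite ck dk ?ji ?eqxx /= ?mulr1n ?mulr0n; ring.
rewrite (eq_eseriesr (fun k _ => congr1 EFin (tT k))).
have T0 k : 0 <= T k by rewrite /T mulr_ge0 ?powR_ge0// addr_ge0// sqr_ge0.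
apply: (@nneseries_lt_pinfty_inv_sq _ (T 0%N + 8 * B ^+ 2)) => // -[|k].
  by rewrite expr1n invr1 mulr1 lerDl mulr_ge0// sqr_ge0.
apply: (@le_trans _ _ (8 * B ^+ 2 * (k.+2%:R ^+ 2)^-1)); last first.
  by rewrite ler_wpM2r ?invr_ge0 ?exprn_ge0// lerDr.
set a := freq k.+1; have [hc hd] := hB k.+1; rewrite -/(c k.+1) -/(d k.+1) -/a in hc hd.
have ka : k.+2%:R <= a.
  have := @pi_ge2 R; have : (1 : R) <= k.+1%:R by rewrite ler1n.
  by rewrite /a /freq -[k.+2%:R]natr1; nra.
have a1 : 1 <= a by apply: le_trans ka; rewrite ler1n.
have a0 : 0 < a by lra.
have sq x : a ^+ 3 * `|x| <= B -> x ^+ 2 <= B ^+ 2 / a ^+ 6.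
  move=> xB; rewrite ler_pdivlMr ?exprn_gt0// -[x ^+ 2]real_normK ?num_real//.
  have -> : `|x| ^+ 2 * a ^+ 6 = (a ^+ 3 * `|x|) ^+ 2 by ring.
  by rewrite ler_sqr ?nnegrE// mulr_ge0// exprn_ge0// ltW.
have e1 : (1 + a ^+ 2) `^ s <= 4 * a ^+ 4.
  apply: (@le_trans _ _ ((1 + a ^+ 2) ^+ 2)).
    have a2 : 1 <= 1 + a ^+ 2 by rewrite lerDl sqr_ge0.
    by rewrite -[leRHS]powR_mulrn; [exact: ler_powR|lra].
  have : 1 <= a ^+ 2 by rewrite expr_ge1//; lra.
  by rewrite (_ : a ^+ 4 = a ^+ 2 * a ^+ 2); [nra|ring].
apply: (@le_trans _ _ (4 * a ^+ 4 * (2 * (B ^+ 2 / a ^+ 6)))).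
  apply: ler_pM => //; rewrite ?powR_ge0 ?addr_ge0 ?sqr_ge0//.
  by have := sq _ hc; have := sq _ hd; lra.
have -> : 4 * a ^+ 4 * (2 * (B ^+ 2 / a ^+ 6)) = 8 * B ^+ 2 * (a ^+ 2)^-1.
  by field; rewrite gt_eqF.
rewrite ler_wpM2l ?mulr_ge0 ?sqr_ge0//.
have k0 : (0 : R) < k.+2%:R by rewrite ltr0n.
rewrite lef_pV2 ?posrE ?exprn_gt0//.
by rewrite ler_sqr ?nnegrE//; lra.
Qed.

End TestFunctions.

(** * The Euler-Lagrange equation in terms of averages *)

Section EulerLagrange.
Variables (R : realType) (n : nat) (alpha lambda : R) (g : R -> 'rV[R]_n)
  (f : 'I_n -> R -> R) (c : R).
Local Notation leb := (@lebesgue_measure R).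
Hypothesis alpha_gt2 : 2 < alpha.
Hypothesis alpha_lt3 : alpha < 3.
Hypothesis gf : forall i, isD (component g i) (f i).
Hypothesis cf : forall i, continuous (f i).
Hypothesis pf : forall i, periodic (f i).
Hypothesis c_gt0 : 0 < c.
Hypothesis chord2_ge : forall u w, W0 w -> c <= chord2 g u w / w ^+ 2.
Hypothesis stationary : forall h : R -> 'rV[R]_n,
  (forall x, derivable h x 1) -> in_H2 ((1 + alpha) / 2) h ->
  first_var_eps alpha g h eps @[eps --> 0^'+] -->
    - (lambda * Rintegral leb `[0, 1] (fun u => dotp (derive1 g u) (derive1 h u))).
Let F i l := derive1n l (f i).

Lemma isD_row (h : R -> 'rV[R]_n) (d : 'I_n -> R -> R) x :
  (forall j, isD (fun y => h y ord0 j) (d j)) ->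
  derivable h x 1 /\ derive1 h x = \row_j d j x.
Proof.
move=> hd.
have dh : derivable h x 1.
  by apply/derivable_mxP => a j; rewrite ord1; have [] := hd j x.
split=> //; rewrite derive1E derive_mx//; apply/rowP => j.
by rewrite !mxE; have [_ <-] := hd j x.
Qed.

Lemma chordsqE u w : w != 0 -> chordsq F u w = chord2 g u w / w ^+ 2.
Proof.
move=> w0; rewrite /chordsq /chord2 mulr_suml; apply: eq_bigr => i _.
by rewrite (avgE w u (gf i) (@cf i)) expr_div_n.
Qed.

Lemma enorm_chord_powR u w r : W0 w ->
  enorm (g (u + w) - g u) `^ r = `|w| `^ r * chordsq F u w `^ (r / 2).
Proof.
move=> [w0 _]; rewrite enorm_chord.
have Q0 : 0 <= chordsq F u w by apply: sumr_ge0 => i _; rewrite sqr_ge0.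
have -> : chord2 g u w = w ^+ 2 * chordsq F u w.
  by rewrite chordsqE// mulrC divfK// sqrf_eq0.
rewrite sqrtrM ?sqr_ge0// sqrtr_sqr powRM ?sqrtr_ge0//; congr (_ * _).
by rewrite -powR12_sqrt// -powRrM mulrC.
Qed.

Lemma first_var_integrandE h k i u w : isD h k -> continuous k -> W0 w ->
  first_var_integrand alpha g (test_curve h i) u w = ELint alpha F i k u w.
Proof.
move=> hk ck hw; have [w0 _] := hw.
have [_ eg] := isD_row u gf.
have [_ eh] : derivable (test_curve h i) u 1 /\
    derive1 (test_curve h i) u = \row_j ((j == i)%:R * k u).
  apply: (@isD_row _ (fun j x => (j == i)%:R * k x)) => j.
  by apply: isD_ext (isDZ (j == i)%:R hk) => // x; rewrite test_curveE.
have pick (a : 'I_n -> R) b : \sum_j a j * ((j == i)%:R * b) = a i * b.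
  rewrite (bigD1 i)//= big1 => [|j /negbTE ->]; rewrite ?eqxx ?mul0r ?mulr0//.
  by rewrite mul1r addr0.
have e1 : dotp (derive1 g u) (derive1 (test_curve h i) u) = f i u * k u.
  rewrite eg eh /dotp -(pick (fun j => f j u)).
  by apply: eq_bigr => j _; rewrite !mxE.
have e2 : dotp (g (u + w) - g u) (test_curve h i (u + w) - test_curve h i u) =
    w ^+ 2 * (avg w (f i) u * avg w k u).
  rewrite (avgE w u (gf i) (@cf i)) (avgE w u hk ck).
  have -> : w ^+ 2 * ((component g i (u + w) - component g i u) / w * ((h (u + w) - h u) / w)) =
      (component g i (u + w) - component g i u) * (h (u + w) - h u) by field.
  rewrite -(pick (fun j => component g j (u + w) - component g j u)).
  by apply: eq_bigr => j _; rewrite !mxE /component eqxx /=; ring.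
rewrite /first_var_integrand e1 e2 !enorm_chord_powR//.
have Q0 : 0 < chordsq F u w by rewrite chordsqE//; apply: lt_le_trans (chord2_ge u hw).
have wn0 : 0 < `|w| by rewrite normr_gt0.
rewrite /ELint /wt (_ : F i 0%N = f i)//.
rewrite powRD; last by rewrite (gt_eqF wn0) implybT.
rewrite [(alpha + 2) / 2]mulrDl divff// [chordsq F u w `^ (_ + 1)]powRD; last first.
  by rewrite (gt_eqF Q0) implybT.
rewrite [chordsq F u w `^ (_ - 1)]powRD; last by rewrite (gt_eqF Q0) implybT.
rewrite !powRN !powRr1 ?ltW// powR_mulrn ?ltW// real_normK ?num_real//.
have := powR_gt0 alpha wn0; have := powR_gt0 (alpha / 2) Q0.
move: (`|w| `^ alpha) (chordsq F u w `^ (alpha / 2)) Q0 => p q Q0 q0 p0.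
by field; rewrite w0 !gt_eqF.
Qed.

Lemma adm_ELint i k : continuous k -> periodic k -> adm (ELint alpha F i k).
Proof.
move=> ck pk.
have aQ : adm (chordsq F).
  apply: adm_bigsum => j.
  by apply: adm_ext (adm_mul (adm_avg (@cf j) (@pf j)) (adm_avg (@cf j) (@pf j))) => u w.
have Qge u w : W0 w -> c <= chordsq F u w.
  by move=> hw; have [w0 _] := hw; rewrite chordsqE//; exact: chord2_ge.
have aP r := adm_powR c_gt0 Qge r aQ.
have af := adm_fun (@cf i) (@pf i); have ak := adm_fun ck pk.
have aa := adm_avg (@cf i) (@pf i); have ab := adm_avg ck pk.
apply: adm_wtM; first exact: alpha_gt2.
apply: adm_sub; last first.
  apply: adm_scale; apply: adm_mul => //; apply: adm_mul => //.
  by apply: adm_sub; [exact: aP|exact: adm_cst].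
apply: adm_add.
  by apply: adm_scale; apply: adm_sub; apply: adm_mul.
apply: adm_scale; apply: adm_mul => //; apply: adm_mul => //.
by apply: adm_sub; [exact: aP|exact: adm_cst].
Qed.

Lemma euler_lagrange i (h k : R -> R) : Ck 3 h -> isD h k ->
  J eps (ELint alpha F i k) @[eps --> 0^'+] --> - (lambda * int01 (fun u => F i 0%N u * k u)).
Proof.
move=> h3 hk.
have [ck pk] : continuous k /\ periodic k.
  case: h3 => _ _ [dh hdh [cd pd _]].
  by rewrite (funext (isD_uniq hk hdh)).
have dH u : derivable (test_curve h i) u 1 /\
    derive1 (test_curve h i) u = \row_j ((j == i)%:R * k u).
  apply: (@isD_row _ (fun j x => (j == i)%:R * k x)) => j.
  by apply: isD_ext (isDZ (j == i)%:R hk) => // x; rewrite test_curveE.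
have H2 : in_H2 ((1 + alpha) / 2) (test_curve h i).
  by apply: test_curve_in_H2 => //; move: alpha_gt2 alpha_lt3; lra.
have := stationary (fun x => (dH x).1) H2.
have -> : Rintegral leb `[0, 1] (fun u => dotp (derive1 g u) (derive1 (test_curve h i) u)) =
    int01 (fun u => F i 0%N u * k u).
  apply: eq_Rintegral => u _; have [_ eg] := isD_row u gf.
  rewrite eg (dH u).2 /dotp (bigD1 i)//= big1 => [|j /negbTE ji]; rewrite !mxE.
    by rewrite eqxx mul1r addr0.
  by rewrite ji mul0r mulr0.
apply: cvg_trans; apply: near_eq_cvg; near=> eps.
have e0 : 0 < eps by near: eps; exact: nbhs_right_gt.
rewrite (J12 e0 (adm_ELint i ck pk)).
apply: eq_Rintegral => u _; apply: eq_Rintegral => w; rewrite inE => hw.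
by apply: first_var_integrandE => //; exact: W_W0 hw.
Unshelve. all: by end_near. Qed.

End EulerLagrange.

(** * Passage to components and conclusion *)

Lemma smooth_of_components (R : realType) (n : nat) (g : R -> 'rV[R]_n) :
  (forall i l, isD (derive1n l (component g i)) (derive1n l.+1 (component g i))) -> smooth g.
Proof.
move=> hg.
have gE l x : derive1n l g x = \row_i derive1n l (component g i) x.
  elim: l x => [|l IH] x; first by apply/rowP => i; rewrite mxE.
  rewrite derive1nS; have [_ ->] := @isD_row R n (derive1n l g)
    (fun i => derive1n l.+1 (component g i)) x (fun i => isD_ext
      (fun y => esym (etrans (congr1 (fun v : 'rV_n => v ord0 i) (IH y)) (mxE _ _ _ _)))
      (fun=> erefl) (hg i l)).
  by [].
move=> l x; apply: (@isD_row R n (derive1n l g) (fun i => derive1n l.+1 (component g i)) x _).1 => i.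
by apply: isD_ext (hg i l) => // y; rewrite gE mxE.
Qed.

Unset Implicit Arguments.

Theorem theorem1p2 (R : realType) (n : nat) (alpha lambda : R)
  (g : R -> 'rV[R]_n) :
  2 < alpha < 3 -> 0 < lambda ->
  lipschitz_curve g -> arclength_param g ->
  (ohara_energy alpha g < +oo)%E ->
  (forall h : R -> 'rV[R]_n,
     (forall x, derivable h x 1) -> in_H2 ((1 + alpha) / 2) h ->
     first_var_eps alpha g h eps @[eps --> 0^'+] -->
       - (lambda * Rintegral (@lebesgue_measure R) `[0, 1]
                     (fun u => dotp (derive1 g u) (derive1 h u)))) ->
  smooth g.
Proof.
move=> /andP[a2 a3] l0 g_lip g_arc hE stat.
have [E0 E00 hJ] := energy_J a2 g_lip g_arc hE.
have [f [gf cf pf uf]] := curve_derivative a2 a3 g_lip g_arc E00 hJ.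
have [c c0 hc] := chord2_lower a2 g_lip g_arc E00 hJ.
have EL := euler_lagrange a2 a3 gf cf pf c0 hc stat.
have Qge u w : W0 w -> c <= chordsq (fun i l => derive1n l (f i)) u w.
  by move=> hw; have [w0 _] := hw; rewrite (chordsqE gf)//; exact: hc.
(* The variance of one component is at most the sum [defect], which equals [excess]; the energy
   bound for the excess passes to every f i. *)
have Ef i eps : 0 < eps -> En alpha eps (f i) <= E0.
  move=> e0; apply: le_trans (excess_J a2 g_lip g_arc hJ e0); apply: J_le => //.
  - by apply: adm_wtM => //; exact: adm_cov.
  - by apply: adm_wtM => //; exact: adm_excess.
  move=> u w hw; have hW := W_W0 e0 hw; have [w0 _] := hW.
  rewrite ler_wpM2l ?wt_ge0//.
  have d0 j : dseq 0 (fun l => derive1n l (f j)).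
    by split=> // l; rewrite leqn0 => /eqP->; split; [exact: cf|exact: pf].
  rewrite /excess -(chordsqE gf)// (chordsq_defect d0 uf u hW) opprB addrC subrK /defect.
  rewrite (bigD1 i)//= lerDl; apply: sumr_ge0 => j _; exact: var_ge0.
have B m := bootstrap a2 a3 l0 cf pf uf E00 Ef c0 Qge EL m.
(* Order 0 is the relation g' = f; the derivative of order l + 1 of a component is that of order l
   of f, differentiable by the induction at level l + 1. *)
apply: smooth_of_components => i [|l].
  apply: isD_ext (gf i) => // x; have [_ <-] := gf i x.
  by rewrite derive1nS derive1E.
have -> : derive1n l.+1 (component g i) = derive1n l (f i).
  rewrite derive1Sn; congr derive1n; apply/funext => x.
  by rewrite derive1E; have [_ ->] := gf i x.
have -> : derive1n l.+2 (component g i) = derive1n l.+1 (f i).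
  rewrite derive1Sn; congr derive1n; apply/funext => x.
  by rewrite derive1E; have [_ ->] := gf i x.
by have [_ _ [dF _ _ _]] := B l.+1; have [hd _] := dF i; apply: hd.
Qed.
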